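(* Assume independent and centered Gaussian vectors $x_0,x_1\in\mathbb R^p$ with covariance operators $\Sigma_0,\Sigma_1\succ0$ respectively. Define the uniformly upper bounded constant $$C_p=\sqrt{\mathbb P\left(y^TA_s y<p\right)}<1$$ for $y\sim\mathcal N(0,I)$ in $\mathbb R^p$, uniformly distributed $s\sim\mathcal U(0,1)$ and the matrix $$A_s=\frac{p\,\log'\Sigma_s}{\log'\det\Sigma_s}.$$ Then it holds $$\sup_{t}\left|\mathbb P(x_1\in\mathcal B_t)-\mathbb P(x_0\in\mathcal B_t)\right|\le C_p\sqrt{\left|\mathrm{Tr}\left(I-\left(\Sigma_0\Sigma_1^{-1}+\Sigma_0^{-1}\Sigma_1\right)/2\right)\right|}.$$
   Context: $\mathcal B_t=\{x\in\mathbb R^p:\|x\|<\sqrt t\}$ is the centered ball for the Euclidean norm $\|\cdot\|$. For $s\in[0,1]$, $\Sigma_s=(1-s)\Sigma_0+s\Sigma_1$; $\log'\Sigma_s$ denotes the matrix $(\Sigma_1-\Sigma_0)\Sigma_s^{-1}$, and $\log'\det\Sigma_s=\frac{d}{ds}\log\det\Sigma_s=\mathrm{Tr}\left((\Sigma_1-\Sigma_0)\Sigma_s^{-1}\right)$. The probability in $C_p$ is taken over both $y$ and $s$, which are independent. *)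

(* Defs.v *)
From HB Require Import structures.
From mathcomp Require Import all_boot all_order all_algebra.
From mathcomp Require Import all_classical all_reals all_analysis.

Set Implicit Arguments.
Unset Strict Implicit.
Unset Printing Implicit Defensive.

Import Order.TTheory GRing.Theory Num.Theory.
Import numFieldNormedType.Exports.

Local Open Scope classical_set_scope.
Local Open Scope ring_scope.

Section vectors_and_matrices.
Context {R : realType} {p : nat}.

Definition col_of_tuple (x : p.-tuple R) : 'cV[R]_p := \col_i tnth x i.

Definition quadform (A : 'M[R]_p) (v : 'cV[R]_p) : R := (v^T *m A *m v) 0 0.

Definition posdefmx (S : 'M[R]_p) : Prop :=
  S^T = S /\ forall v : 'cV[R]_p, v != 0 -> 0 < quadform S v.

(* The Euclidean norm: the norm `|v| of the library on matrices is the sup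
   norm. *)
Definition enorm (v : 'cV[R]_p) : R := Num.sqrt (\sum_i v i 0 ^+ 2).

Definition eball (t : R) : set 'cV[R]_p := [set v | enorm v < Num.sqrt t].

Variables S0 S1 : 'M[R]_p.

Definition Sigma_ (s : R) : 'M[R]_p := (1 - s) *: S0 + s *: S1.

Definition dlog_Sigma (s : R) : 'M[R]_p := (S1 - S0) *m invmx (Sigma_ s).

Definition dlogdet_Sigma (s : R) : R :=
  derive1 (fun r : R => ln (\det (Sigma_ r))) s.

(* Since x / 0 = 0, this is 0 where dlogdet_Sigma vanishes. When S0 != S1 are
   positive definite, that happens for at most one s in [0, 1]. *)
Definition A_ (s : R) : 'M[R]_p :=
  (p%:R / dlogdet_Sigma s) *: dlog_Sigma s.

End vectors_and_matrices.

Section laws.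
Context {R : realType} {d : measure_display} {T : measurableType d}.
Variable P : probability T R.

(* normal_prob m 0 is a junk value of the library, not the point mass at m. *)
Definition gaussian_law (m sigma : R) (B : set R) : \bar R :=
  if sigma == 0 then \d_m B else normal_prob m sigma B.

Definition is_gaussian (X : T -> R) : Prop :=
  exists m sigma : R,
    forall B : set R, measurable B -> P (X @^-1` B) = gaussian_law m sigma B.

Definition is_gaussian_vector (p : nat) (X : {RV P >-> p.-tuple R}) : Prop :=
  forall u : 'cV[R]_p,
    is_gaussian (fun w => (u^T *m col_of_tuple (X w)) 0 0).

Definition is_centered (p : nat) (X : {RV P >-> p.-tuple R}) : Prop :=
  forall i, ('E_P[fun w => tnth (X w) i] = 0)%E.

Definition has_covariance (p : nat) (X : {RV P >-> p.-tuple R})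
    (S : 'M[R]_p) : Prop :=
  forall i j,
    covariance P (fun w => tnth (X w) i) (fun w => tnth (X w) j) = (S i j)%:E.

Definition centered_gaussian (p : nat) (X : {RV P >-> p.-tuple R})
    (S : 'M[R]_p) : Prop :=
  [/\ is_gaussian_vector X, is_centered X & has_covariance X S].

Definition is_uniform01 (s : {RV P >-> R}) : Prop :=
  forall B : set R, measurable B -> P (s @^-1` B) = uniform_prob (@ltr01 R) B.

Definition independent_RVs d1 d2 (T1 : measurableType d1)
    (T2 : measurableType d2) (X : {RV P >-> T1}) (Y : {RV P >-> T2}) : Prop :=
  forall (B1 : set T1) (B2 : set T2), measurable B1 -> measurable B2 ->
    P (X @^-1` B1 `&` Y @^-1` B2) = (P (X @^-1` B1) * P (Y @^-1` B2))%E.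

Definition C_ (p : nat) (S0 S1 : 'M[R]_p) (y : {RV P >-> p.-tuple R})
    (s : {RV P >-> R}) : R :=
  Num.sqrt (fine
    (P [set w | quadform (A_ S0 S1 (s w)) (col_of_tuple (y w)) < p%:R])).

Definition ball_prob (p : nat) (X : {RV P >-> p.-tuple R}) (t : R) : \bar R :=
  P [set w | eball t (col_of_tuple (X w))].

End laws.

(* Main.v *)
Require Import Defs.
From HB Require Import structures.
From mathcomp Require Import all_boot all_order all_algebra.
From mathcomp Require Import complex.
From mathcomp Require Import all_classical all_reals all_analysis measurable_realfun.
From mathcomp Require Import ring lra.

Set Implicit Arguments.
Unset Strict Implicit.
Unset Printing Implicit Defensive.

Import Order.TTheory GRing.Theory Num.Theory.
Import numFieldNormedType.Exports.

Opaque integral.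

Local Open Scope classical_set_scope.
Local Open Scope ring_scope.

(* Write [Sigma0 = B B^T] and [Sigma1 = B D B^T] with [D] diagonal and positive,
   so that the trace under the square root is, up to sign,
   [J = (\sum_i (d_i + 1 / d_i - 2)) / 2]. The Hellinger affinities [rho_i] of the
   coordinates bound the distance in total variation:
   [(P1 A - P0 A)^2 <= 1 - \prod_i rho_i^2 <= J / 4] for every measurable [A]. So
   it is enough that [1 / 2 <= C_p <= c < 1] with [c] independent of [p], which
   holds once [P (y^T A_s y < p)] lies between 1/4 and 3/4.

   For almost every [s] the matrix [A_s] has trace [p], so both bounds say that a
   Gaussian quadratic form [Q = \sum_i l_i g_i^2] with [l != 0] is at most its mean
   [t] with probability at most 3/4. For an independent copy [Q'], polar
   coordinates in each plane [(g_i, g'_i)] turn [(Q, Q')] into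
   [(\sum_i l_i (1 + c_i) e_i, \sum_i l_i (1 - c_i) e_i)] with exponential [e_i]
   independent of the cosines [c_i]. Given the [c_i], one of the two sums has mean
   [t + |\sum_i l_i c_i| >= t], and since its tail is log-concave it exceeds [t]
   with probability at least [exp (-1)], and more when this excess is large.
   Averaging over the [c_i] gives [P (Q <= t) ^ 2 <= 9 / 16]. *)

(** The constants leave little freedom. For the bound [J / 4] to be absorbed by [C_p ^+ 2 * J], the
    probability of [y^T A_s y < p] must reach 1/4, so 3/4 is what the quadratic forms have to
    achieve. Log-concavity alone bounds the square of that probability by [1 - exp (-1) = 0.632...],
    more than [9 / 16 = 0.5625]; the gain from the excess [|\sum_i l_i c_i|], through its second and
    fourth moments, closes the gap with little to spare. Doubling the form is what makes
    log-concavity available: a squared Gaussian has no log-concave density, an exponential variable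
    has one. As [A_s] need be neither symmetric nor definite, the weights [l_i] have arbitrary
    signs, and the lower bound is the upper bound for [- l]. A Gaussian vector is given through the
    laws of its linear forms, so its law must also be identified with the image of independent
    standard Gaussians under a matrix; this is a Cramer-Wold argument with cosines. Integrands are
    kept nonnegative as far as possible: [1 + cos] replaces [cos], terms of opposite signs go to
    opposite sides, and a mean is read off second moments. *)

(** * Spectral theorem and simultaneous diagonalisation *)

Section symmetric_matrices.
Context {R : realType}.

Lemma sqnorm_mxE n (v : 'rV[R]_n) : (v *m v^T) 0 0 = \sum_i v 0 i ^+ 2.
Proof. by rewrite mxE; apply: eq_bigr => i _; rewrite mxE expr2. Qed.

Lemma tr_mx11 (M : 'M[R]_1) : M^T = M.
Proof. by apply/matrixP => i j; rewrite !ord1 mxE. Qed.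

Lemma sqnorm_gt0 n (v : 'rV[R]_n) : v != 0 -> 0 < (v *m v^T) 0 0.
Proof.
move=> v0; rewrite sqnorm_mxE lt_neqAle eq_sym.
have p i : true -> 0 <= v 0 i ^+ 2 by rewrite sqr_ge0.
rewrite sumr_ge0 ?andbT//; apply: contra v0 => /eqP/psumr_eq0P h.
apply/eqP/rowP => i; rewrite mxE; apply/eqP; rewrite -sqrf_eq0.
by apply/eqP; exact: h.
Qed.

(* Over the complex numbers [S] has an eigenvector; its eigenvalue is real
   because [S] is symmetric, hence its real and imaginary parts are real
   eigenvectors, or zero. *)
Lemma sym_eigenvector n (S : 'M[R]_n.+1) : S^T = S ->
  exists a (v : 'rV[R]_n.+1), v != 0 /\ v *m S = a *: v.
Proof.
move=> symS.
pose C : numClosedFieldType := complex.complex R.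
pose toC (r : R) : C := complex.Complex r 0.
pose SC : 'M[C]_n.+1 := \matrix_(i, j) toC (S i j).
have [l] : exists x : C, root (char_poly SC) x.
  by apply/closed_rootP; rewrite size_char_poly.
rewrite -eigenvalue_root_char => /eigenvalueP[v vS v0].
pose re (z : C) : R := complex.Re z; pose im (z : C) : R := complex.Im z.
have reD : {morph re : x y / x + y} by move=> [? ?] [? ?].
have imD : {morph im : x y / x + y} by move=> [? ?] [? ?].
have reMl z w : re (z * w) = re z * re w - im z * im w by case: z w => [? ?] [? ?].
have imMl z w : im (z * w) = re z * im w + im z * re w by case: z w => [? ?] [? ?].
have reM z r : re (z * toC r) = re z * r by case: z => c d; rewrite /re/= mulr0 subr0.
have imM z r : im (z * toC r) = im z * r by case: z => c d; rewrite /im/= mulr0 add0r.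
pose x : 'rV[R]_n.+1 := \row_k re (v 0 k); pose y : 'rV[R]_n.+1 := \row_k im (v 0 k).
pose a := re l; pose b := im l.
have vSj j : \sum_k v 0 k * toC (S k j) = l * v 0 j.
  have /rowP/(_ j) := vS; rewrite !mxE => <-.
  by apply: eq_bigr => k _; rewrite mxE.
have xS : x *m S = a *: x - b *: y.
  apply/rowP => j; rewrite !mxE; have := congr1 re (vSj j).
  rewrite (big_morph re reD (erefl : re 0 = 0)) => h.
  transitivity (re (l * v 0 j)).
    by rewrite -h; apply: eq_bigr => k _; rewrite mxE reM.
  by rewrite reMl.
have yS : y *m S = a *: y + b *: x.
  apply/rowP => j; rewrite !mxE; have := congr1 im (vSj j).
  rewrite (big_morph im imD (erefl : im 0 = 0)) => h.
  transitivity (im (l * v 0 j)).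
    by rewrite -h; apply: eq_bigr => k _; rewrite mxE imM.
  by rewrite imMl.
have xy0 : (x != 0) || (y != 0).
  rewrite -negb_and; apply: contra v0 => /andP[/eqP x0 /eqP y0].
  apply/eqP/rowP => j; rewrite mxE.
  have /rowP/(_ j) := x0; have /rowP/(_ j) := y0; rewrite !mxE.
  by case: (v 0 j) => c d /= -> ->.
have n0 (u : 'rV[R]_n.+1) : 0 <= (u *m u^T) 0 0.
  by rewrite sqnorm_mxE; apply: sumr_ge0 => i _; exact: sqr_ge0.
have b0 : b = 0.
  have h : b * ((x *m x^T) 0 0 + (y *m y^T) 0 0) = 0.
    have e1 : ((x *m S) *m y^T) 0 0 = ((y *m S) *m x^T) 0 0.
      by rewrite -[y *m S *m _]tr_mx11 !trmx_mul trmxK symS mulmxA.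
    have e2 : (x *m y^T) 0 0 = (y *m x^T) 0 0.
      by rewrite -[y *m _]tr_mx11 trmx_mul trmxK.
    move: e1; rewrite xS yS -scaleNr !mulmxDl -!scalemxAl.
    have E (M N : 'M[R]_1) : (M + N) 0 0 = M 0 0 + N 0 0 by rewrite mxE.
    have Z (k : R) (M : 'M[R]_1) : (k *: M) 0 0 = k * M 0 0 by rewrite mxE.
    rewrite !E !Z -e2; lra.
  move/eqP: h; rewrite mulf_eq0 => /orP[/eqP//|].
  case/orP: xy0 => /sqnorm_gt0 h.
    by rewrite gt_eqF// ltr_pwDl.
  by rewrite gt_eqF// ltr_wpDl.
rewrite b0 !scale0r ?subr0 ?addr0 in xS yS.
by case/orP: xy0 => h; [exists a, x|exists a, y].
Qed.

(** The reflection in the hyperplane orthogonal to [w = u - e] exchanges the unit vectors [e] and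
    [u]; for [u = e] the identity does. It brings an eigenvector onto the first axis in
    [real_spectral]. *)
Lemma householder n (u : 'rV[R]_n.+1) : u *m u^T = 1 ->
  exists H : 'M[R]_n.+1, H *m H^T = 1 /\ delta_mx 0 0 *m H = u.
Proof.
move=> u1; pose e : 'rV[R]_n.+1 := delta_mx 0 0; pose w := u - e.
have [w0|w0] := eqVneq w 0.
  exists 1; rewrite trmx1 mulmx1; split => //.
  by rewrite mulmx1; apply/esym/eqP; rewrite -subr_eq0 -/e -/w w0.
have := sqnorm_gt0 w0; set q := (w *m w^T) 0 0 => q0.
have wq : w *m w^T = q%:M by rewrite [LHS]mx11_scalar.
pose H : 'M[R]_n.+1 := 1 - (2 / q) *: (w^T *m w).
have HT : H^T = H by rewrite /H linearB/= linearZ/= trmx_mul trmxK trmx1.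
have ee : e *m e^T = 1 by rewrite trmx_delta mul_delta_mx; apply/matrixP => i j;
  rewrite !mxE !ord1.
have ue : u *m e^T = e *m u^T.
  by rewrite -[e *m _]tr_mx11 trmx_mul trmxK.
have qE : q%:M = 2 *: (1 - e *m u^T) :> 'M[R]_1.
  rewrite -wq /w linearB/= mulmxBl !mulmxBr u1 ee ue; apply/matrixP => i j; rewrite !mxE; ring.
(* Both vectors have norm one, so [q = |u - e|^2] equals [2 (1 - e.u)], whence
   [e.w = e.u - 1 = - q / 2]. *)
have ew : e *m w^T = (- (q / 2))%:M.
  rewrite /w linearB/= mulmxBr ee.
  have -> : e *m u^T = 1 - 2^-1 *: q%:M by rewrite qE scalerA mulVf// scale1r opprB addrC subrK.
  by apply/matrixP => i j; rewrite !mxE !ord1; field.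
exists H; rewrite HT; split.
  pose N : 'M[R]_n.+1 := w^T *m w.
  have NN : N * N = q *: N.
    by rewrite -[N * N]/(N *m N) /N -mulmxA (mulmxA w) wq mul_scalar_mx -scalemxAr.
  have kk : 2 / q * (2 / q) * q = 2 / q + 2 / q by field; rewrite gt_eqF.
  rewrite -[H *m H]/(H * H) /H -/N mulrBl mul1r mulrBr mulr1 -scalerAl -scalerAr NN !scalerA.
  by rewrite kk scalerDl opprB addrK subrK.
rewrite -/e /H mulmxBr -[1]/(1%:M) mulmx1 -scalemxAr mulmxA ew mul_scalar_mx scalerA.
have -> : 2 / q * - (q / 2) = -1 by field; rewrite gt_eqF.
by rewrite scaleN1r opprK /w addrC subrK.
Qed.

(** Deflation: once a unit eigenvector is the first basis vector, symmetry clears the first row and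
    the first column off the diagonal, and the induction hypothesis applies to the lower right
    block. The eigenvectors are the rows of [U]. *)
Theorem real_spectral n (S : 'M[R]_n) : S^T = S ->
  exists (U : 'M[R]_n) (d : 'rV[R]_n), U *m U^T = 1%:M /\ U *m S *m U^T = diag_mx d.
Proof.
elim: n S => [|n IH] S symS.
  by exists 1%:M, 0; split; apply/matrixP => -[].
have [a [v [v0 vS]]] := sym_eigenvector symS.
have q0 := sqnorm_gt0 v0; set q := (v *m v^T) 0 0 in q0.
pose u := (Num.sqrt q)^-1 *: v.
have r0 : Num.sqrt q != 0 by rewrite gt_eqF// sqrtr_gt0.
have u1 : u *m u^T = 1.
  rewrite /u linearZ/= -scalemxAl -scalemxAr scalerA [v *m _]mx11_scalar -/q.
  rewrite scale_scalar_mx (_ : _ * q = 1)//.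
  by rewrite -[X in _ * X](sqr_sqrtr (ltW q0)); field.
have uS : u *m S = a *: u by rewrite /u -scalemxAl vS !scalerA mulrC.
have [H [HH eH]] := householder u1.
have HTH : H^T *m H = 1 by apply: mulmx1C.
pose S' := H *m S *m H^T.
have S'sym : S'^T = S' by rewrite /S' !trmx_mul trmxK symS mulmxA.
have eS' : delta_mx 0 0 *m S' = a *: delta_mx 0 0 :> 'rV_n.+1.
  rewrite /S' !mulmxA eH uS -scalemxAl; congr (_ *: _).
  by rewrite -eH -mulmxA HH mulmx1.
have S'def : H *m S *m H^T = S' by [].
clearbody S'; pose T1 : 'M[R]_(1 + n) := S'.
pose S1 : 'M[R]_n := drsubmx T1.
have row0E (j : 'I_n.+1) : S' 0 j = a * (j == 0)%:R.
  have := congr1 (fun M : 'rV_n.+1 => M 0 j) eS'.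
  by rewrite -rowE !mxE.
have S'E : S' = block_mx a%:M 0 0 S1 :> 'M[R]_(1 + n).
  rewrite -[LHS](@submxK _ 1 n 1 n); congr block_mx.
  - apply/matrixP => i j; rewrite !ord1 !mxE.
    by rewrite (_ : lshift n 0 = 0) ?row0E ?eqxx ?mulr1//; exact/val_inj.
  - apply/matrixP => i j; rewrite !ord1 !mxE.
    by rewrite (_ : lshift n 0 = 0) ?row0E ?mulr0//; exact/val_inj.
  - apply/matrixP => i j; rewrite !ord1 !mxE -S'sym mxE.
    by rewrite (_ : lshift n 0 = 0) ?row0E ?mulr0//; exact/val_inj.
have symS1 : S1^T = S1 by rewrite /S1 trmx_drsub S'sym.
have [U1 [d1 [UU Ud]]] := IH S1 symS1.
pose U2 : 'M[R]_(1 + n) := block_mx 1 0 0 U1.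
have U2U2 : U2 *m U2^T = 1%:M.
  rewrite /U2 tr_block_mx mulmx_block !trmx0 trmx1 !mulmx0 !mul0mx mulmx1 !addr0 !add0r UU.
  by rewrite -scalar_mx_block.
have U2D : U2 *m block_mx a%:M 0 0 S1 *m U2^T = diag_mx (row_mx a%:M d1).
  rewrite /U2 tr_block_mx !trmx0 trmx1 !mulmx_block !mulmx0 !mul0mx !addr0 !add0r.
  rewrite !mulmx1 !mul1mx ?mulmx0 ?mul0mx ?addr0 ?add0r Ud diag_mx_row.
  by congr block_mx; apply/matrixP => i j; rewrite !mxE !ord1 eqxx.
exists (U2 *m H), (row_mx a%:M d1); split.
  by rewrite trmx_mul mulmxA -(mulmxA U2) HH -[1]/(1%:M) mulmx1; exact: U2U2.
by rewrite -U2D -S'E -S'def trmx_mul !mulmxA.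
Qed.

(** [B0] whitens [S0]. The rotation [V] that then diagonalises [invmx B0 *m S1 *m (invmx B0)^T]
    leaves the identity matrix unchanged, so a single congruence [B] reduces both matrices. *)
Lemma posdefmx_diag n (S0 S1 : 'M[R]_n) : posdefmx S0 -> posdefmx S1 ->
  exists (B : 'M[R]_n) (d : 'rV[R]_n), [/\ B \in unitmx, forall i, 0 < d 0 i,
    S0 = B *m B^T & S1 = B *m diag_mx d *m B^T].
Proof.
move=> [sym0 pos0] [sym1 pos1].
have pos_diag (S U : 'M[R]_n) (d : 'rV[R]_n) : (forall v, v != 0 -> 0 < quadform S v) ->
    U \in unitmx -> U *m S *m U^T = diag_mx d -> forall i, 0 < d 0 i.
  move=> posS uU dE i.
  have : 0 < quadform S (row i U)^T.
    apply: posS; apply/eqP => /(congr1 trmx); rewrite trmxK trmx0 => ri0.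
    have : row i (U *m invmx U) = 0 by rewrite row_mul ri0 mul0mx.
    by rewrite mulmxV// => /rowP/(_ i) /eqP; rewrite !mxE eqxx oner_eq0.
  rewrite /quadform trmxK.
  have -> : row i U *m S *m (row i U)^T = row i (U *m S *m U^T) *m (delta_mx 0 i)^T.
    by rewrite !rowE trmx_mul !mulmxA.
  by rewrite dE trmx_delta -colE !mxE eqxx.
have [U [e [UU US]]] := real_spectral sym0.
have uU : U \in unitmx by case: (mulmx1_unit UU).
have e0 := pos_diag _ _ _ pos0 uU US.
have UTU : U^T *m U = 1%:M by exact: mulmx1C.
pose r : 'rV[R]_n := \row_i Num.sqrt (e 0 i).
have r2 : diag_mx r *m diag_mx r = diag_mx e.
  by rewrite mulmx_diag; congr diag_mx; apply/rowP => i; rewrite !mxE -expr2 sqr_sqrtr// ltW.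
pose B0 := U^T *m diag_mx r.
have B0B0 : B0 *m B0^T = S0.
  rewrite /B0 trmx_mul tr_diag_mx trmxK mulmxA -(mulmxA U^T) r2 -US.
  by rewrite !mulmxA UTU mul1mx -mulmxA UTU mulmx1.
have uB0 : B0 \in unitmx.
  rewrite unitmx_mul unitmx_tr uU/= unitmxE det_diag unitfE.
  by apply/prodf_neq0 => i _; rewrite mxE gt_eqF// sqrtr_gt0.
pose T := invmx B0 *m S1 *m (invmx B0)^T.
have symT : T^T = T by rewrite /T !trmx_mul trmxK sym1 mulmxA.
have [V [d [VV VT]]] := real_spectral symT.
have VTV : V^T *m V = 1%:M by exact: mulmx1C.
have uV : V \in unitmx by case: (mulmx1_unit VV).
pose B := B0 *m V^T.
have uB : B \in unitmx by rewrite unitmx_mul uB0 unitmx_tr.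
have S1E : S1 = B *m diag_mx d *m B^T.
  rewrite -VT /B trmx_mul trmxK !mulmxA -(mulmxA B0) VTV mulmx1.
  rewrite -(mulmxA _ V^T) VTV mulmx1 mulmxV// mul1mx -mulmxA -trmx_mul.
  by rewrite mulmxV// trmx1 mulmx1.
have S0E : S0 = B *m B^T by rewrite /B trmx_mul trmxK mulmxA -(mulmxA B0) VTV mulmx1 B0B0.
clearbody B; exists B, d; split => //.
apply: (pos_diag S1 (invmx B)) => //; first by rewrite unitmx_inv.
rewrite {1}S1E !mulmxA mulVmx// mul1mx -mulmxA -trmx_mul.
by rewrite mulVmx// trmx1 mulmx1.
Qed.

End symmetric_matrices.

(** * Image measures, densities and affine changes of variable *)

Section pushforward_probability.
Context d d' (T : measurableType d) (T' : measurableType d') (R : realType).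

Definition pushp (P : probability T R) (f : T -> T')
    (mf : measurable_fun setT f) : probability T' R :=
  distribution P (HB.pack_for {mfun T >-> T'} f
    (@isMeasurableFun.Build _ _ _ _ f mf)).

Lemma pushpE (P : probability T R) (f : T -> T') (mf : measurable_fun setT f) A :
  pushp P mf A = P (f @^-1` A).
Proof. by []. Qed.

Lemma ge0_integral_pushp (P : probability T R) (f : T -> T')
    (mf : measurable_fun setT f) (g : T' -> \bar R) :
  measurable_fun setT g -> (forall y, 0 <= g y)%E ->
  (\int[pushp P mf]_y g y = \int[P]_x g (f x))%E.
Proof. by move=> mg g0; rewrite ge0_integral_distribution. Qed.

End pushforward_probability.

Section density.
Local Open Scope ereal_scope.
Context d (T : measurableType d) (R : realType).
Variables (mu nu : {measure set T -> \bar R}) (f : T -> R).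
Hypotheses (f0 : forall x, (0 <= f x)%R) (mf : measurable_fun setT f).
Hypothesis nuE : forall A, measurable A -> nu A = \int[mu]_(x in A) (f x)%:E.

Import HBNNSimple.

Lemma ge0_integral_density (g : T -> \bar R) :
  measurable_fun setT g -> (forall x, 0 <= g x) ->
  \int[nu]_x g x = \int[mu]_x (g x * (f x)%:E).
Proof.
move=> mg g0; pose g_ := nnsfun_approx measurableT mg.
have mfE : measurable_fun setT (EFin \o f) by exact/measurable_EFinP.
transitivity (limn (fun n => \int[nu]_x (g_ n x)%:E)).
  rewrite -monotone_convergence//.
  - by apply: eq_integral => x _; apply/esym/cvg_lim => //; exact: cvg_nnsfun_approx.
  - by move=> n; exact/measurable_EFinP.
  - by move=> n x _; rewrite lee_fin.
  - by move=> x _ m n mn; rewrite lee_fin; exact/lefP/nd_nnsfun_approx.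
transitivity (limn (fun n => \int[mu]_x ((g_ n x)%:E * (f x)%:E))); last first.
  rewrite -monotone_convergence//.
  - apply: eq_integral => x _; apply/cvg_lim => //.
    by apply: cvgeZr => //; exact: cvg_nnsfun_approx.
  - by move=> n; apply: emeasurable_funM => //; exact/measurable_EFinP.
  - by move=> n x _; rewrite mule_ge0// lee_fin.
  - move=> x _ m n mn; rewrite lee_wpmul2r// lee_fin//.
    exact/lefP/nd_nnsfun_approx.
congr (limn _); apply/funext => n.
under eq_integral do rewrite fimfunE// -fsumEFin//.
rewrite ge0_integral_fsum//; last 2 first.
  - by move=> r; exact/measurable_EFinP/measurableT_comp.
  - by move=> r x _; rewrite nnfun_muleindic_ge0.
under [RHS]eq_integral.
  move=> x _; rewrite fimfunE// -fsumEFin// ge0_mule_fsuml; last first.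
    by move=> r; rewrite nnfun_muleindic_ge0.
  over.
rewrite ge0_integral_fsum//; last 2 first.
  - move=> r; apply: emeasurable_funM => //.
    exact/measurable_EFinP/measurableT_comp.
  - by move=> r x _; rewrite mule_ge0 ?nnfun_muleindic_ge0// lee_fin.
apply: eq_fsbigr => r _.
rewrite integralZl_indic_nnsfun// integral_indic// setIT nuE//.
have mP : measurable (g_ n @^-1` [set r]) by [].
under [RHS]eq_integral do rewrite EFinM -muleA.
have [r0|r0] := leP 0%R r; last first.
  rewrite preimage_nnfun0// integral_set0 mule0.
  by rewrite integral0_eq// => x _; rewrite indicE in_set0 mul0e mule0.
rewrite ge0_integralZl//; last 2 first.
  - apply: emeasurable_funM => //; exact/measurable_EFinP/measurable_indic.
  - by move=> x _; rewrite mule_ge0 ?lee_fin.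
congr (_ * _).
rewrite [LHS]integral_mkcond/=; apply: eq_integral => x _.
by rewrite /patch indicE; case: ifPn => _; rewrite ?mul1e ?mul0e.
Qed.

End density.

Section real_line.
Context {R : realType}.
Local Notation mu := (@lebesgue_measure R).

Lemma probability_eq_ccdf (P Q : probability R R) :
  (forall x, P `]x, +oo[%classic = Q `]x, +oo[%classic) ->
  forall A, measurable A -> P A = Q A.
Proof.
move=> PQ A mA.
have := (@measure_unique _ R R (@RGenOInfty.G R)
  (fun n => `](- n%:R), +oo[%classic) _ _ _ _ P Q _ _ A).
apply => //.
- exact: (RGenOInfty.measurableE R).
- move=> _ _ [x ->] [y ->]; exists (Num.max x y).
  apply/seteqP; split => z /=; rewrite !in_itv/= !andbT gt_max.
    by move=> [-> ->].
  by move=> /andP[].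
- by move=> n; exists (- n%:R).
- rewrite -subTset => x _; exists (Num.bound `|x|) => //=.
  rewrite in_itv/= andbT ltrNl (le_lt_trans (ler_norm _))// normrN.
  by apply: archi_boundP; exact: normr_ge0.
- by move=> _ [x ->]; exact: PQ.
- by move=> n; rewrite (le_lt_trans (probability_le1 _ _)) ?ltry.
Qed.

Lemma lebesgue_affine (m k : R) A : 0 < k -> measurable A ->
  (k%:E * mu ((fun x => (m + k * x)%R) @^-1` A) = mu A)%E.
Proof.
move=> k0 mA.
have mf : measurable_fun [set: measurableTypeR R]
    ((fun x : R => m + k * x) : measurableTypeR R -> measurableTypeR R).
  by apply: measurable_funD => //; exact: measurable_funM.
pose nu := mscale (NngNum (ltW k0))
  (measure_function_pushforward__canonical__measure_function_Measure mu mf).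
have /= -> // := @lebesgue_measure_unique _ nu _ _ mA.
move=> _ [[a b]] _ <-; rewrite /nu/= /mscale/= /pushforward/=.
rewrite (_ : _ @^-1` _ = `](a - m) / k, (b - m) / k]%classic).
  rewrite !lebesgue_measure_itv/= !lte_fin ltr_pM2r ?invr_gt0// ltrD2r.
  case: ifPn => ab; rewrite ?mule0// -!EFinD -EFinM; congr (_%:E).
  by field; rewrite gt_eqF.
apply/seteqP; split => x /=; rewrite !in_itv/= ltr_pdivrMr// ler_pdivlMr//.
  by move=> /andP[? ?]; apply/andP; split; lra.
by move=> /andP[? ?]; apply/andP; split; lra.
Qed.

Lemma ge0_integral_affine (m k : R) (f : R -> \bar R) : 0 < k ->
  measurable_fun setT f -> (forall x, 0 <= f x)%E ->
  (\int[mu]_x (f (m + k * x)%R * k%:E) = \int[mu]_x f x)%E.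
Proof.
move=> k0 mf f0.
have maff : measurable_fun [set: measurableTypeR R]
    ((fun x : R => m + k * x) : measurableTypeR R -> measurableTypeR R).
  by apply: measurable_funD => //; exact: measurable_funM.
rewrite ge0_integralZr//; last 2 first.
- exact: measurableT_comp.
- by rewrite lee_fin ltW.
rewrite -(@ge0_integral_pushforward _ _ _ _ _ _ maff mu setT f)//.
rewrite muleC -(@ge0_integral_mscale _ _ _ _ _ _ (NngNum (ltW k0)))//.
apply: eq_measure_integral => A mA _.
exact: lebesgue_affine.
Qed.

Lemma normal_density (m s : R) (g : R -> \bar R) :
  measurable_fun setT g -> (forall x, 0 <= g x)%E ->
  (\int[normal_prob m s]_x g x = \int[mu]_x (g x * (normal_pdf m s x)%:E))%E.
Proof.
move=> mg g0; apply: ge0_integral_density => //.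
- exact: normal_pdf_ge0.
- exact: measurable_normal_pdf.
Qed.

(* The density of [N(m, s^2)] at [m + |s| x], times the Jacobian [|s|]. *)
Lemma normal_pdf_affine (m s x : R) : s != 0 ->
  normal_pdf m s (m + `|s| * x) * `|s| = normal_pdf 0 1 x.
Proof.
move=> s0; have ns : 0 < `|s| by rewrite normr_gt0.
rewrite !normal_pdfE ?oner_neq0// /normal_peak /normal_fun.
rewrite (_ : s ^+ 2 = `|s| ^+ 2); last by rewrite real_normK// num_real.
rewrite -!mulrnAr (sqrtrM _ (sqr_ge0 _)) sqrtr_sqr normr_id expr1n mul1r.
set q := _ (pi *+ 2); have q0 : q != 0.
  by rewrite gt_eqF// sqrtr_gt0 mulrn_wgt0// pi_gt0.
rewrite (_ : - _ / (`|s| * (`|s| *+ 2)) = - (x - 0) ^+ 2 / (1 * 2)).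
  by field; rewrite q0 gt_eqF.
by field; rewrite gt_eqF.
Qed.

(** The normal density depends on [s] only through [s ^+ 2]; taking [|s|] keeps the change of
    variable increasing, as [ge0_integral_affine] requires. *)
Lemma normal_prob_affine (m s : R) A : s != 0 -> measurable A ->
  normal_prob m s A = normal_prob 0 1 ((fun x => m + `|s| * x) @^-1` A).
Proof.
move=> s0 mA.
have mf : measurable_fun [set: measurableTypeR R]
    ((fun x : R => m + `|s| * x) : measurableTypeR R -> measurableTypeR R).
  by apply: measurable_funD => //; exact: measurable_funM.
have mfA : measurable ((fun x => m + `|s| * x) @^-1` A).
  by rewrite -[X in measurable X]setTI; exact: mf.
have mIpdf B m' s' : measurable B -> measurable_fun [set: measurableTypeR R]
    (fun x => (\1_B x)%:E * (normal_pdf m' s' x)%:E)%E.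
  move=> mB; apply: emeasurable_funM; apply/measurable_EFinP.
    exact: measurable_indic.
  exact: measurable_normal_pdf.
have nE m' s' B : measurable B -> (normal_prob m' s' B =
    \int[mu]_x ((\1_B x)%:E * (normal_pdf m' s' x)%:E))%E.
  move=> mB; rewrite -normal_density ?integral_indic ?setIT//.
  - exact/measurable_EFinP/measurable_indic.
rewrite !nE// -(@ge0_integral_affine m `|s|) ?normr_gt0//; last 2 first.
- exact: mIpdf.
- by move=> x; rewrite mule_ge0// lee_fin// normal_pdf_ge0.
apply: eq_integral => x _.
by rewrite -muleA -EFinM normal_pdf_affine// !indicE; congr (_%:R%:E * _)%E.
Qed.

End real_line.

(** * Finite products of a probability *)

Section iterated_product.
Context d (T : measurableType d) (R : realType).

Definition tcons n (xt : T * n.-tuple T) : n.+1.-tuple T :=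
  [tuple of xt.1 :: xt.2].

Lemma measurable_tcons n : measurable_fun setT (@tcons n).
Proof. exact: measurable_cons. Qed.

Variable mu : probability T R.

(** The product law is built from the front, so that statements on independent coordinates go by
    induction on the tuple of coefficients, conditioning on the first coordinate. *)
Fixpoint ipro n : probability (n.-tuple T) R :=
  match n with
  | 0 => \d_[tuple]
  | m.+1 => pushp (mu \x ipro m)%E (@measurable_tcons m)
  end.

Lemma ge0_integral_ipro0 (f : 0.-tuple T -> \bar R) :
  measurable_fun setT f -> (\int[ipro 0]_t f t = f [tuple])%E.
Proof. by move=> mf; rewrite /= integral_dirac// diracT mul1e. Qed.

Lemma ge0_integral_iproS n (f : n.+1.-tuple T -> \bar R) :
  measurable_fun setT f -> (forall t, 0 <= f t)%E ->
  (\int[ipro n.+1]_t f t = \int[mu]_x \int[ipro n]_t f (tcons (x, t)))%E.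
Proof.
move=> mf f0; rewrite ge0_integral_pushp// fubini_tonelli1//.
exact: measurableT_comp mf (@measurable_tcons _).
Qed.

Lemma measurable_tconsl n (x : T) : measurable_fun setT (fun t : n.-tuple T => tcons (x, t)).
Proof. exact: measurableT_comp (@measurable_tcons n) (measurable_pair1 x). Qed.

Lemma measurable_integral_tcons n (f : n.+1.-tuple T -> \bar R) :
  measurable_fun setT f -> (forall t, 0 <= f t)%E ->
  measurable_fun setT (fun x => \int[ipro n]_t f (tcons (x, t)))%E.
Proof.
move=> mf f0.
apply: (measurable_fun_fubini_tonelli_F (f \o @tcons n)) => //.
  exact: measurableT_comp mf (@measurable_tcons _).
by move=> x; exact: f0.
Qed.

End iterated_product.

(** * Rayleigh integrals and polar coordinates for a Gaussian pair *)

Section rayleigh.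
Context {R : realType}.
Local Notation mu := (@lebesgue_measure R).

Lemma is_derive_expR_comp (f : R -> R) (x a : R) : is_derive x 1 f a ->
  is_derive x 1 (fun z => expR (f z)) (expR (f x) * a).
Proof. by move=> fa; exact: (is_derive1_comp (is_derive_expR (f x)) fa). Qed.

Lemma is_derive_gauss (x : R) :
  is_derive x 1 (fun r : R => expR (- r ^+ 2 / 2)) (- (x * expR (- x ^+ 2 / 2))).
Proof.
have h : is_derive x 1 (fun r : R => - r ^+ 2 / 2) (- x).
  by apply: is_derive_eq; rewrite /GRing.scale/=; field.
by have := is_derive_expR_comp h; rewrite mulrN mulrC.
Qed.

Lemma cvgy_gauss : (expR (- r ^+ 2 / 2) : R) @[r --> +oo%R] --> (0 : R).
Proof.
under eq_fun do rewrite mulNr.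
have h : (r ^+ 2 / 2 : R) @[r --> +oo%R] --> +oo%R.
  by apply: gt0_cvgMly; [rewrite invr_gt0|exact: cvgr_expr2].
exact: (cvg_comp _ _ h (@cvgr_expR R)).
Qed.

Lemma continuous_gauss : continuous (fun r : R => expR (- r ^+ 2 / 2)).
Proof.
move=> x; have [+ _] := is_derive_gauss x.
by move=> /derivable1_diffP/differentiable_continuous.
Qed.

Lemma integral_rayleigh (a : R) : 0 <= a ->
  (\int[mu]_(r in `[a, +oo[) (r * expR (- r ^+ 2 / 2))%:E =
   (expR (- a ^+ 2 / 2))%:E)%E.
Proof.
move=> a0.
rewrite (@ge0_continuous_FTC2y _ _ (fun r : R => - expR (- r ^+ 2 / 2)) _ 0).
- by rewrite sub0e EFinN oppeK.
- by move=> x ax; rewrite mulr_ge0 ?expR_ge0// (le_trans a0).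
- apply: continuous_subspaceT => x; apply: cvgM; first exact: cvg_id.
  exact: continuous_gauss.
- by rewrite -oppr0; apply: cvgN; exact: cvgy_gauss.
- by move=> x _; have [+ _] := is_derive_gauss x; exact: derivableN.
- by apply: cvg_at_right_filter; apply: cvgN; exact: continuous_gauss.
- move=> x _; rewrite derive1E deriveN; last by have [] := is_derive_gauss x.
  by have [_ ->] := is_derive_gauss x; rewrite opprK.
Qed.

Lemma ge0_integral_fold (f : R -> \bar R) : measurable_fun setT f ->
  (forall x, 0 <= f x)%E ->
  (\int[mu]_x f x = \int[mu]_(x in `[0%R, +oo[) f x + \int[mu]_(x in `[0%R, +oo[) f (- x)%R)%E.
Proof.
move=> mf f0.
have mfS (D : set R) : measurable_fun D f by exact: measurable_funTS.
have mD : measurable (`[0%R, +oo[%classic : set (measurableTypeR R)) by [].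
rewrite -(setUv (`[0%R, +oo[%classic : set R)).
rewrite (ge0_integral_setU _ mD (measurableC mD))//=; last 2 first.
- exact: mfS.
- exact/disj_setPCl.
rewrite setCitvr integral_itv_bndo_bndc//; congr (_ + _)%E.
rewrite ge0_integration_by_substitution0//; last first.
  by apply: (measurableT_comp mf); apply: measurable_funN.
by apply: eq_integral => x _; rewrite ?opprK.
Qed.

Lemma ge0_integral_even (f : R -> \bar R) : measurable_fun setT f ->
  (forall x, 0 <= f x)%E -> (forall x, f (- x) = f x) ->
  (\int[mu]_x f x = 2%:E * \int[mu]_(x in `[0%R, +oo[) f x)%E.
Proof.
move=> mf f0 fe; rewrite ge0_integral_fold// mule_natl mule2n; congr (_ + _)%E.
by apply: eq_integral => x _; rewrite fe.
Qed.

Lemma measurable_fun_inv : measurable_fun setT (fun x : R => x^-1).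
Proof.
(* A form of the inverse that stays correct at 0, where both sides are 0, and at negative [x]. *)
rewrite (_ : (fun x => x^-1) = fun x : R => x * powR (x ^+ 2) (-1)).
  apply: measurable_funM => //.
  by apply: (@measurableT_comp _ _ _ _ _ _ (fun y : R => powR y (-1)) _
    (fun x : R => x ^+ 2)) => //; exact: measurable_powR.
apply/funext => x; have [->|x0] := eqVneq x 0; first by rewrite invr0 mul0r.
by rewrite powR_inv1 ?sqr_ge0//; field.
Qed.

End rayleigh.

Ltac meas := repeat first
  [ exact: measurable_id | exact: measurable_cst | exact: measurable_fst
  | exact: measurable_snd | done
  | apply: measurable_fun_pair | apply: measurable_funD
  | apply: measurable_funM | apply: measurable_funB | apply: measurable_funX
  | apply: measurable_funN
  | match goal with
    | |- measurable_fun _ (fun z => EFin _) => apply/measurable_EFinP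
    | |- measurable_fun _ (fun z => expR _) =>
        apply: (measurableT_comp (@measurable_expR _))
    | |- measurable_fun _ (fun z => Num.norm _) =>
        apply: (measurableT_comp (@normr_measurable _ setT))
    | |- measurable_fun _ (fun z => (_ _)^-1) =>
        apply: (measurableT_comp measurable_fun_inv)
    | |- measurable_fun _ (fun z => GRing.inv _) =>
        apply: (measurableT_comp measurable_fun_inv)
    | |- measurable_fun _ (fun z => (_ * _)%E) => apply: emeasurable_funM
    | |- measurable_fun _ (fun z => (_ + _)%E) => apply: emeasurable_funD
    end ].

Section polar.
Context {R : realType}.
Local Notation mu := (@lebesgue_measure R).

(* The library measures [R] with two displays: [lebesgue_measure] and
   [normal_prob] live on [measurableTypeR R], random variables on [R]. *)
Definition gauss1 : probability R R :=
  pushp (normal_prob 0 1 : probability (measurableTypeR R) R)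
    (@measurable_id _ (measurableTypeR R) setT
      : measurable_fun setT (id : measurableTypeR R -> R)).
Local Notation gamma := gauss1.
Local Notation K := (normal_peak (1 : R)).

Lemma stdnormal_pdfE (x : R) : normal_pdf 0 1 x = K * expR (- x ^+ 2 / 2).
Proof.
by rewrite normal_pdfE ?oner_neq0// /normal_fun subr0 expr1n.
Qed.

(** The Cauchy density [1 / (pi (1 + t ^+ 2))], as [K ^+ 2 = 1 / (2 pi)]: the law of the slope of a
    Gaussian point. *)
Definition polar_weight (t : R) : R := 2 * K ^+ 2 / (1 + t ^+ 2).
(** The Rayleigh density of the radius, halved and extended evenly to the whole line. *)
Definition polar_radius (r : R) : R := `|r| * expR (- r ^+ 2 / 2) / 2.

Lemma measurable_polar_weight : measurable_fun setT polar_weight.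
Proof. rewrite /polar_weight; meas. Qed.

Lemma measurable_polar_radius : measurable_fun setT polar_radius.
Proof. rewrite /polar_radius; meas. Qed.

Lemma polar_weight_ge0 (t : R) : 0 <= polar_weight t.
Proof.
by apply: divr_ge0; [apply: mulr_ge0 => //; exact: sqr_ge0|rewrite addr_ge0 ?sqr_ge0].
Qed.

Lemma polar_radius_ge0 (r : R) : 0 <= polar_radius r.
Proof. by rewrite /polar_radius divr_ge0 ?mulr_ge0 ?expR_ge0. Qed.

Lemma gauss1E (f : R -> \bar R) : measurable_fun setT f ->
  (forall x, 0 <= f x)%E ->
  (\int[gamma]_x f x = \int[mu]_x (f x * (K * expR (- x ^+ 2 / 2))%:E))%E.
Proof.
move=> mf f0; rewrite ge0_integral_pushp// normal_density//.
by apply: eq_integral => x _; rewrite stdnormal_pdfE.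
Qed.

(* Polar coordinates, with the slope [t = y / x] in place of the angle; [t] and
   the radius range over all of [R], so each point of the plane is met twice. *)
Lemma integral_polar_aux (F : R * R -> \bar R) : measurable_fun setT F ->
  (forall z, 0 <= F z)%E ->
  (\int[gamma]_x \int[gamma]_y F (x ^+ 2, y ^+ 2)%R =
   \int[mu]_t ((polar_weight t)%:E * \int[mu]_r ((polar_radius r)%:E *
      F (r ^+ 2 / (1 + t ^+ 2), r ^+ 2 * t ^+ 2 / (1 + t ^+ 2))%R)))%E.
Proof.
move=> mF F0.
pose H := fun xt : R * R => (F (xt.1 ^+ 2, (xt.1 * xt.2) ^+ 2)%R *
  (K ^+ 2 * `|xt.1| * expR (- (xt.1 ^+ 2 * (1 + xt.2 ^+ 2)) / 2))%R%:E)%E.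
have K0 : 0 < K by rewrite normal_peak_gt0// oner_neq0.
have mH : measurable_fun setT H.
  rewrite /H; apply: emeasurable_funM; last by meas.
  by apply: (measurableT_comp mF); meas.
have H0 z : (0 <= H z)%E.
  by rewrite /H mule_ge0// lee_fin mulr_ge0 ?expR_ge0// mulr_ge0// sqr_ge0.
have mF2 : measurable_fun setT (fun z : R * R => F (z.1 ^+ 2, z.2 ^+ 2)).
  by apply: (measurableT_comp mF); meas.
have mG : measurable_fun setT (fun x : R => \int[gamma]_y F (x ^+ 2, y ^+ 2)%R)%E.
  apply: (@measurable_fun_fubini_tonelli_F _ _ _ _ _ gamma
    (fun z : R * R => F (z.1 ^+ 2, z.2 ^+ 2)) mF2) => z.
  exact: F0.
have mHx : measurable_fun setT (fun x : R => \int[mu]_t H (x, t))%E.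
  exact: (@measurable_fun_fubini_tonelli_F _ _ _ _ _ mu H mH H0).
have mFx x : measurable_fun setT (fun y : R => F (x ^+ 2, y ^+ 2)%R).
  by apply: (measurableT_comp mF); meas.
transitivity (\int[mu]_x \int[mu]_t H (x, t))%E.
  rewrite gauss1E//; last first.
  - by move=> x; exact: integral_ge0.
  have mLHS : measurable_fun setT (fun x : R => \int[gamma]_y F (x ^+ 2, y ^+ 2)%R *
      (K * expR (- x ^+ 2 / 2))%R%:E)%E.
    by apply: emeasurable_funM => //; meas.
  have m0 : measurable (~` [set 0] : set (measurableTypeR R)).
    exact: measurableC.
  (* The substitution [y = |x| t] made below degenerates at [x = 0], a null point which is removed
     from both integrals. *)
  rewrite -(@integral_setD1 _ _ 0)//=; last 2 first.
  - by rewrite setTD.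
  - exact: measurable_funTS.
  rewrite -[RHS](@integral_setD1 _ _ 0)//=; last 2 first.
  - by rewrite setTD.
  - exact: measurable_funTS.
  apply: eq_integral => x; rewrite inE/= => -[_ /eqP x0].
  rewrite gauss1E//.
  rewrite -(@ge0_integral_affine _ 0 `|x|) ?normr_gt0//; last 2 first.
  - by meas; exact: mFx.
  - by move=> y; rewrite mule_ge0// lee_fin mulr_ge0 ?expR_ge0// ltW.
  rewrite -ge0_integralZr//; last 3 first.
  - apply: emeasurable_funM; last by meas.
    apply: emeasurable_funM; last by meas.
    by apply: (measurableT_comp (mFx x)); meas.
  - by move=> y _; rewrite !mule_ge0// lee_fin// mulr_ge0 ?expR_ge0// ltW.
  - by rewrite lee_fin mulr_ge0 ?expR_ge0// ltW.
  apply: eq_integral => y _; rewrite /H/= add0r.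
  rewrite exprMn real_normK ?num_real// -exprMn -!muleA -!EFinM.
  congr (_ * _%:E)%E.
  rewrite (_ : - (x ^+ 2 * (1 + y ^+ 2)) / 2 = - (x * y) ^+ 2 / 2 + - x ^+ 2 / 2).
    by rewrite expRD; ring.
  by field.
transitivity (\int[mu]_t \int[mu]_x H (x, t))%E.
  exact: (@fubini_tonelli _ _ _ _ _ mu mu H mH H0).
apply: eq_integral => t _.
have t0 : 0 < 1 + t ^+ 2 by rewrite ltr_pwDl// sqr_ge0.
(* Substituting [x = k r] makes [r ^+ 2 = x ^+ 2 * (1 + t ^+ 2)] the squared radius. *)
pose k := (Num.sqrt (1 + t ^+ 2))^-1.
have k0 : 0 < k by rewrite invr_gt0 sqrtr_gt0.
have kk : k ^+ 2 = (1 + t ^+ 2)^-1 by rewrite exprVn sqr_sqrtr// ltW.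
rewrite -(@ge0_integral_affine _ 0 k)//; last first.
  by apply: (measurableT_comp mH); meas.
rewrite -ge0_integralZl//; last 3 first.
- apply: emeasurable_funM; last by apply: (measurableT_comp mF); meas.
  by apply/measurable_EFinP; exact: measurable_polar_radius.
- by move=> r _; rewrite mule_ge0// lee_fin polar_radius_ge0.
- by rewrite lee_fin polar_weight_ge0.
apply: eq_integral => r _; rewrite /H/= add0r.
have -> : (k * r) ^+ 2 = r ^+ 2 / (1 + t ^+ 2) by rewrite exprMn kk mulrC.
have -> : (k * r * t) ^+ 2 = r ^+ 2 * t ^+ 2 / (1 + t ^+ 2).
  by rewrite !exprMn kk; ring.
rewrite -muleA -EFinM [RHS]muleA -EFinM [RHS]muleC; congr (_ * _%:E)%E.
rewrite normrM (ger0_norm (ltW k0)) /polar_weight /polar_radius.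
rewrite (_ : r ^+ 2 / (1 + t ^+ 2) * (1 + t ^+ 2) = r ^+ 2); last first.
  by rewrite divfK// gt_eqF.
transitivity (K ^+ 2 * k ^+ 2 * `|r| * expR (- r ^+ 2 / 2)).
  by ring.
by rewrite kk; field; rewrite gt_eqF.
Qed.

End polar.

(** * Independence of the angle and the radius *)

Section polar_laws.
Context {R : realType}.
Local Notation mu := (@lebesgue_measure R).
Local Notation gamma := (@gauss1 R).

Lemma integral_polar_radius : (\int[mu]_r (polar_radius r)%:E = 1)%E.
Proof.
rewrite ge0_integral_even; first last.
- by move=> x; rewrite /polar_radius normrN sqrrN.
- by move=> x; rewrite lee_fin polar_radius_ge0.
- by apply/measurable_EFinP; exact: measurable_polar_radius.
rewrite -ge0_integralZl//; last 2 first.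
- by apply/measurable_EFinP/measurable_funTS; exact: measurable_polar_radius.
- by move=> x _; rewrite lee_fin polar_radius_ge0.
have := integral_rayleigh (lexx (0 : R)); rewrite expr0n/= oppr0 mul0r expR0 => <-.
apply: eq_integral => x; rewrite inE/= in_itv/= andbT => x0.
by rewrite -EFinM /polar_radius ger0_norm//; congr EFin; field.
Qed.

(** The polar formula at the constant function 1 yields it, given the radial mass, without an
    antiderivative of the Cauchy density. *)
Lemma integral_polar_weight : (\int[mu]_t (polar_weight t)%:E = 1)%E.
Proof.
have I1 : (\int[gamma]_y (cst 1 y) = 1 :> \bar R)%E.
  by rewrite integral_cst//= probability_setT mule1.
have := @integral_polar_aux R (cst 1%E) (measurable_cst _) (fun=> lee01).
rewrite [X in X = _](_ : _ = 1)%E => [->|]; last first.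
  by rewrite (eq_integral (cst 1%E)).
apply: eq_integral => t _.
rewrite (eq_integral (fun r : measurableTypeR R => (polar_radius r)%:E)) => [|r _].
  by rewrite integral_polar_radius mule1.
by rewrite /= mule1.
Qed.

Definition polar_ratio (z : R * R) : R :=
  (z.1 ^+ 2 - z.2 ^+ 2) / (z.1 ^+ 2 + z.2 ^+ 2).

Lemma measurable_polar_ratio : measurable_fun setT polar_ratio.
Proof. rewrite /polar_ratio; meas. Qed.

Definition half_sqnorm (z : R * R) : R := (z.1 ^+ 2 + z.2 ^+ 2) / 2.

Lemma measurable_half_sqnorm : measurable_fun setT half_sqnorm.
Proof. rewrite /half_sqnorm; meas. Qed.

(* The cosine of twice the angle, and half of the squared radius, of a standard
   Gaussian point of the plane. *)
Definition cos2_law : probability R R := pushp (gamma \x gamma)%E measurable_polar_ratio.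
Definition exp_law : probability R R := pushp (gamma \x gamma)%E measurable_half_sqnorm.

Lemma integral_cos2_law (h : R -> \bar R) : measurable_fun setT h ->
  (forall x, 0 <= h x)%E ->
  (\int[cos2_law]_x h x =
   \int[mu]_t ((polar_weight t)%:E * h ((1 - t ^+ 2) / (1 + t ^+ 2))%R))%E.
Proof.
move=> mh h0; rewrite ge0_integral_pushp// fubini_tonelli1//; last first.
  exact: (measurableT_comp mh measurable_polar_ratio).
rewrite /fubini_F.
rewrite (integral_polar_aux (F := fun z => h ((z.1 - z.2) / (z.1 + z.2)))) //; last first.
  by apply: (measurableT_comp mh); meas.
apply: eq_integral => t _; congr (_ * _)%E.
rewrite -[RHS]mul1e -integral_polar_radius -ge0_integralZr//; last 2 first.
- by apply/measurable_EFinP; exact: measurable_polar_radius.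
- by move=> r _; rewrite lee_fin polar_radius_ge0.
apply: eq_integral => r _ /=.
have [->|r0] := eqVneq r 0; first by rewrite /polar_radius normr0 !mul0r !mul0e.
congr (_ * h _)%E.
have t0 : 1 + t ^+ 2 != 0 by rewrite gt_eqF// ltr_pwDl// sqr_ge0.
have -> : r ^+ 2 / (1 + t ^+ 2) + r ^+ 2 * t ^+ 2 / (1 + t ^+ 2) = r ^+ 2.
  by field; rewrite t0.
by field; rewrite r0 t0.
Qed.

Lemma integral_exp_law_aux (h : R -> \bar R) : measurable_fun setT h ->
  (forall x, 0 <= h x)%E ->
  (\int[exp_law]_x h x = \int[mu]_r ((polar_radius r)%:E * h (r ^+ 2 / 2)%R))%E.
Proof.
move=> mh h0; rewrite ge0_integral_pushp// fubini_tonelli1//; last first.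
  exact: (measurableT_comp mh measurable_half_sqnorm).
rewrite /fubini_F.
rewrite (integral_polar_aux (F := fun z => h ((z.1 + z.2) / 2))) //; last first.
  by apply: (measurableT_comp mh); meas.
rewrite -[RHS]mul1e -integral_polar_weight -ge0_integralZr//; last 3 first.
- by apply/measurable_EFinP; exact: measurable_polar_weight.
- by move=> r _; rewrite lee_fin polar_weight_ge0.
- by apply: integral_ge0 => r _; rewrite mule_ge0// lee_fin polar_radius_ge0.
apply: eq_integral => t _; congr (_ * _)%E.
apply: eq_integral => r _; congr (_ * h _)%E => /=.
have t0 : 1 + t ^+ 2 != 0 by rewrite gt_eqF// ltr_pwDl// sqr_ge0.
by field; rewrite t0.
Qed.

(** With [e = (x^2 + y^2) / 2] and [c = (x^2 - y^2) / (x^2 + y^2)], the squares are [e (1 + c)] and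
    [e (1 - c)]. As [c] depends on the slope only, [e] on the radius only, and the polar weight is a
    product, the two are independent. *)
Lemma gauss_polar (F : R * R -> \bar R) : measurable_fun setT F ->
  (forall z, 0 <= F z)%E ->
  (\int[gamma]_x \int[gamma]_y F (x ^+ 2, y ^+ 2)%R =
   \int[cos2_law]_c \int[exp_law]_e F (e * (1 + c), e * (1 - c))%R)%E.
Proof.
move=> mF F0; rewrite integral_polar_aux//.
have mFe : measurable_fun setT (fun ce : R * R => F (ce.2 * (1 + ce.1), ce.2 * (1 - ce.1))).
  by apply: (measurableT_comp mF); meas.
rewrite integral_cos2_law; last 2 first.
- apply: (@measurable_fun_fubini_tonelli_F _ _ _ _ _ exp_law
    (fun ce : R * R => F (ce.2 * (1 + ce.1), ce.2 * (1 - ce.1))) mFe) => z.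
  exact: F0.
- by move=> x; exact: integral_ge0.
apply: eq_integral => t _; congr (_ * _)%E.
rewrite (integral_exp_law_aux (h := fun e => F _))//; last first.
  by apply: (measurableT_comp mF); meas.
apply: eq_integral => r _; congr (_ * F (_, _))%E.
- have t0 : 1 + t ^+ 2 != 0 by rewrite gt_eqF// ltr_pwDl// sqr_ge0.
  by field; rewrite t0.
- have t0 : 1 + t ^+ 2 != 0 by rewrite gt_eqF// ltr_pwDl// sqr_ge0.
  by field; rewrite t0.
Qed.

Lemma integral_exp_law_half (h : R -> \bar R) : measurable_fun setT h ->
  (forall x, 0 <= h x)%E ->
  (\int[exp_law]_e h e = \int[gamma]_x \int[gamma]_y h ((x ^+ 2 + y ^+ 2) / 2)%R)%E.
Proof.
move=> mh h0; rewrite ge0_integral_pushp// fubini_tonelli1//.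
exact: (measurableT_comp mh measurable_half_sqnorm).
Qed.

(** Exchanging [x] and [y] preserves the law of the pair and turns [c] into [- c]. *)
Lemma integral_cos2_sym (h : R -> \bar R) : measurable_fun setT h ->
  (forall x, 0 <= h x)%E ->
  (\int[cos2_law]_c h (- c)%R = \int[cos2_law]_c h c)%E.
Proof.
move=> mh h0.
have mhN : measurable_fun setT (fun c : R => h (- c)%R).
  by apply: (measurableT_comp mh); meas.
rewrite !ge0_integral_pushp//.
have mhr : measurable_fun setT (fun z : R * R => h (polar_ratio z)).
  exact: (measurableT_comp mh measurable_polar_ratio).
have mhNr : measurable_fun setT (fun z : R * R => h (- polar_ratio z)%R).
  exact: (measurableT_comp mhN measurable_polar_ratio).
rewrite (@fubini_tonelli1 _ _ _ _ _ gamma gamma _ mhNr)//.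
rewrite (@fubini_tonelli1 _ _ _ _ _ gamma gamma _ mhr)//.
rewrite [RHS](@fubini_tonelli _ _ _ _ _ gamma gamma (fun z : R * R => h (polar_ratio z)) mhr)//.
apply: eq_integral => x _; apply: eq_integral => y _; congr h.
by rewrite /polar_ratio/= -mulNr opprB; congr (_ / _); rewrite addrC.
Qed.

End polar_laws.

Opaque gauss1 cos2_law exp_law.

(** * The exponential law: tail, density and memorylessness *)

Section exponential_law.
Context {R : realType}.
Local Notation mu := (@lebesgue_measure R).

Lemma eq_le_refl (x y : R) : x = y -> x <= y. Proof. by move=> ->. Qed.

Lemma cvgy_invr (C : R) : (C / x : R) @[x --> +oo%R] --> (0 : R).
Proof.
rewrite -(mulr0 C); apply: cvgM; first exact: cvg_cst.
apply/gtr0_cvgV0; last exact: cvg_id.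
exact: nbhs_pinfty_gt.
Qed.

Lemma cvgy_squeeze_invr (f : R -> R) (C : R) :
  (forall x, 0 < x -> 0 <= f x <= C / x) -> f x @[x --> +oo%R] --> (0 : R).
Proof.
move=> fC; apply: (@squeeze_cvgr _ _ _ _ (cst 0) (fun x => C / x)).
- by near=> x; apply: fC; near: x; exact: nbhs_pinfty_gt.
- exact: cvg_cst.
- exact: cvgy_invr.
Unshelve. all: by end_near. Qed.

Lemma expRN_le (n : nat) (y : R) : 0 < y -> expR (- y) <= n.+1`!%:R / y ^+ n.+1.
Proof.
move=> y0; rewrite expRN -invf_div lef_pV2 ?posrE ?expR_gt0//; last first.
  by rewrite divr_gt0 ?exprn_gt0// ltr0n fact_gt0.
by rewrite (le_trans _ (expR_ge1Dxn n (ltW y0)))// lerDr.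
Qed.

Lemma is_derive_expNM (k x : R) :
  is_derive x 1 (fun z : R => expR (- (k * z))) (- (k * expR (- (k * x)))).
Proof.
have h : is_derive x 1 (fun z : R => - (k * z)) (- k).
  by apply: is_derive_eq; rewrite /GRing.scale/= mulr1.
by have := is_derive_expR_comp h; rewrite mulrN mulrC.
Qed.

Lemma integral_pol_exp (F f : R -> R) (l a : R) :
  (forall x, a <= x -> 0 <= f x) -> continuous f ->
  (forall x : R, derivable F x 1 /\ 'D_1 F x = f x) -> F x @[x --> +oo%R] --> l ->
  (\int[mu]_(x in `[a, +oo[) (f x)%:E = l%:E - (F a)%:E)%E.
Proof.
move=> f0 cf dF Fl; apply: ge0_continuous_FTC2y => //.
- exact: continuous_subspaceT.
- by move=> x _; have [] := dF x.
- apply: cvg_at_right_filter; have [+ _] := dF a.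
  by move=> /derivable1_diffP/differentiable_continuous.
- by move=> x _; rewrite derive1E; have [_ ->] := dF x.
Qed.

Lemma continuous_expNM (k : R) : continuous (fun x : R => expR (- (k * x))).
Proof.
move=> x; have [+ _] := is_derive_expNM k x.
by move=> /derivable1_diffP/differentiable_continuous.
Qed.

Lemma cvgy_expNM (k : R) : 0 < k -> (expR (- (k * x)) : R) @[x --> +oo%R] --> (0 : R).
Proof.
move=> k0; apply: (@cvgy_squeeze_invr _ (1 / k)) => x x0.
rewrite expR_ge0/= (le_trans (expRN_le 0 _)) ?mulr_gt0//.
by rewrite expr1 !mul1r invfM.
Qed.

Lemma integral_expNM (k a : R) : 0 < k ->
  (\int[mu]_(x in `[a, +oo[) (expR (- (k * x)))%:E = (expR (- (k * a)) / k)%:E)%E.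
Proof.
move=> k0.
rewrite (integral_pol_exp (F := fun x => - (expR (- (k * x)) / k)) (l := 0)).
- by rewrite sub0e -EFinN opprK.
- by move=> x _; exact: expR_ge0.
- exact: continuous_expNM.
- move=> x.
  have := is_deriveN (is_deriveZ k^-1 (is_derive_expNM k x)).
  rewrite /GRing.scale/= mulrN opprK mulrA mulVf ?mul1r ?gt_eqF// => -[].
  rewrite (_ : - (k^-1 \*o _) = fun z => - (expR (- (k * z)) / k)) //.
  by apply/funext => z; rewrite [in RHS]mulrC.
- by rewrite -oppr0; apply: cvgN; rewrite -(mul0r k^-1); apply: cvgM;
    [exact: cvgy_expNM|exact: cvg_cst].
Qed.

Lemma integral_x_expNM (k : R) : 0 < k ->
  (\int[mu]_(x in `[0%R, +oo[) (x * expR (- (k * x)))%:E = (k^-1 ^+ 2)%:E)%E.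
Proof.
move=> k0; pose p := fun x : R => - (x / k + k^-1 ^+ 2).
rewrite (integral_pol_exp (F := fun x => p x * expR (- (k * x))) (l := 0)).
- by rewrite sub0e -EFinN /p mul0r add0r mulr0 oppr0 expR0 mulr1 opprK.
- by move=> x x0; rewrite mulr_ge0// expR_ge0.
- by move=> x; apply: cvgM; [exact: cvg_id|exact: continuous_expNM].
- move=> x.
  have hp : is_derive x 1 p (- k^-1).
    by rewrite /p; apply: is_derive_eq; rewrite /GRing.scale/=; ring.
  have := is_deriveM hp (is_derive_expNM k x).
  rewrite /GRing.scale/= /p => -[dF FE]; split => //; rewrite FE.
  by field; rewrite gt_eqF.
- rewrite /p; under eq_fun do rewrite mulNr mulrDl; rewrite -oppr0.
  apply: cvgN; rewrite -(addr0 0); apply: cvgD; last first.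
    by rewrite -[X in _ --> X](mulr0 (k^-1 ^+ 2)); apply: cvgM;
      [exact: cvg_cst|exact: cvgy_expNM].
  apply: (@cvgy_squeeze_invr _ (2 / k ^+ 3)) => x x0.
  have xk0 : 0 <= x / k by rewrite divr_ge0// ltW.
  apply/andP; split; first by rewrite mulr_ge0 ?expR_ge0.
  rewrite (le_trans (ler_wpM2l _ (expRN_le 1 _))) ?mulr_gt0//.
  by apply/eq_le_refl; rewrite !factS fact0 !muln1; field; rewrite !gt_eqF.
Qed.

Lemma integral_x2_expN :
  (\int[mu]_(x in `[0%R, +oo[) (x ^+ 2 * expR (- (1 * x)))%:E = 2%:E)%E.
Proof.
pose p := fun x : R => - (x ^+ 2 + 2 * x + 2).
rewrite (integral_pol_exp (F := fun x => p x * expR (- (1 * x))) (l := 0)).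
- by rewrite sub0e -EFinN /p mulr0 expr0n/= !add0r mulr0 oppr0 expR0 mulr1 opprK.
- by move=> x x0; rewrite mulr_ge0 ?sqr_ge0// expR_ge0.
- move=> x; apply: cvgM; last exact: continuous_expNM.
  exact: exprn_continuous.
- move=> x.
  have hp : is_derive x 1 p (- (2 * x + 2)).
    by rewrite /p; apply: is_derive_eq; rewrite /GRing.scale/=; ring.
  have := is_deriveM hp (is_derive_expNM 1 x).
  rewrite /GRing.scale/= /p => -[dF FE]; split => //; rewrite FE.
  by ring.
- rewrite /p; under eq_fun do rewrite mulNr; rewrite -oppr0.
  (* The bounds [6 / x], [2 / x] and [1 / x] proved below, weighted by the coefficients 1, 2 and 2,
     add up to [12 / x]. *)
  apply: cvgN; apply: (@cvgy_squeeze_invr _ 12) => x x0.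
  apply/andP; split.
    by rewrite mulr_ge0 ?expR_ge0// !addr_ge0 ?sqr_ge0// mulr_ge0// ltW.
  rewrite mul1r.
  have h3 : x ^+ 2 * expR (- x) <= 6 / x.
    rewrite (le_trans (ler_wpM2l (sqr_ge0 _) (expRN_le 2 x0)))//.
    by apply/eq_le_refl; rewrite !factS fact0 !muln1; field; rewrite gt_eqF.
  have h2 : x * expR (- x) <= 2 / x.
    rewrite (le_trans (ler_wpM2l (ltW x0) (expRN_le 1 x0)))//.
    by apply/eq_le_refl; rewrite !factS fact0 !muln1; field; rewrite gt_eqF.
  have h1 : expR (- x) <= 1 / x by have := expRN_le 0 x0; rewrite expr1.
  rewrite (_ : (_ + _ + 2) * _ =
    x ^+ 2 * expR (- x) + 2 * (x * expR (- x)) + 2 * expR (- x)); last by ring.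
  rewrite (_ : 12 / x = 6 / x + 2 * (2 / x) + 2 * (1 / x)); last by ring.
  by rewrite !lerD// ler_pM2l.
Qed.

End exponential_law.

Section exp_law.
Context {R : realType}.
Local Notation mu := (@lebesgue_measure R).
Local Notation gamma := (@gauss1 R).
Local Notation Exp := (@exp_law R).

(** For [a >= 0], [r ^+ 2 / 2 > a] means [|r| > sqrt (2 a)], and the Rayleigh integral from
    [sqrt (2 a)] is [exp (- a)]; the maximum accounts for negative [x]. *)
Lemma exp_law_ccdf (x : R) :
  Exp `]x, +oo[%classic = (expR (- Num.max x 0))%:E.
Proof.
pose I := (`]x, +oo[%classic : set R).
have mI : measurable I by exact: measurable_itv.
have mind : measurable_fun setT (fun e : R => (\1_I e)%:E : \bar R).
  by apply/measurable_EFinP/measurable_indic.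
transitivity (\int[Exp]_e (\1_I e)%:E)%E; first by rewrite (integral_indic _ measurableT mI) setIT.
rewrite integral_exp_law_aux//.
have msq : measurable_fun setT (fun r : R => (\1_I (r ^+ 2 / 2))%:E : \bar R).
  by apply: (measurableT_comp mind); meas.
have mrad : measurable_fun setT (fun r : R => (polar_radius r)%:E : \bar R).
  by apply/measurable_EFinP; exact: measurable_polar_radius.
rewrite ge0_integral_even; first last.
- by move=> r; rewrite /polar_radius normrN sqrrN.
- by move=> r; rewrite mule_ge0// lee_fin polar_radius_ge0.
- exact: emeasurable_funM.
rewrite -ge0_integralZl//; last 2 first.
- by apply: measurable_funTS; exact: emeasurable_funM.
- by move=> r _; rewrite mule_ge0// lee_fin polar_radius_ge0.
set a := Num.max x 0; have a0 : 0 <= a by rewrite le_max lexx orbT.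
pose b := Num.sqrt (2 * a).
have b0 : 0 <= b by exact: sqrtr_ge0.
have b2 : b ^+ 2 = 2 * a by rewrite sqr_sqrtr// mulr_ge0.
transitivity (\int[mu]_(r in `[0%R, +oo[)
    ((fun r => (r * expR (- r ^+ 2 / 2))%:E) \_ `]b, +oo[%classic) r)%E.
  apply: eq_integral => r; rewrite inE/= in_itv/= andbT => r0.
  rewrite patchE; case: ifPn => [|]; rewrite ?inE ?notin_setE/= in_itv/= andbT => br.
    rewrite indicE mem_set ?mule1.
      by rewrite -EFinM /polar_radius ger0_norm//; congr EFin; field.
    rewrite /I/= in_itv/= andbT.
    have : b ^+ 2 < r ^+ 2 by rewrite ltr_sqr ?nnegrE// ltW.
    have : x <= a by rewrite le_max lexx.
    by rewrite b2 ltr_pdivlMr//; lra.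
  have [->|rn0] := eqVneq r 0; first by rewrite /polar_radius normr0 !mul0r !mul0e mule0.
  rewrite indicE memNset ?mule0//= /I/= in_itv/= andbT => xr; apply: br.
  rewrite -ltr_sqr ?nnegrE// b2.
  have r2 : 0 < r ^+ 2 by rewrite exprn_gt0// lt_neqAle eq_sym rn0.
  by rewrite /a; case: (leP x 0) xr => x0; rewrite ltr_pdivlMr//; lra.
rewrite -integral_mkcondr (_ : _ `&` _ = `]b, +oo[%classic); last first.
  apply/seteqP; split => r /=; rewrite !in_itv/= !andbT; first by case.
  by move=> br; split => //; rewrite (le_trans b0)// ltW.
rewrite integral_itv_obnd_cbnd; last first.
  by apply: measurable_funTS; meas.
rewrite integral_rayleigh// b2 mulNr mulrC mulKf//.
Qed.

End exp_law.

Section exp_law2.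
Context {R : realType}.
Local Notation mu := (@lebesgue_measure R).
Local Notation gamma := (@gauss1 R).
Local Notation Exp := (@exp_law R).

Lemma exponential_prob_ccdf (x : R) :
  exponential_prob 1 `]x, +oo[%classic = (expR (- Num.max x 0))%:E :> \bar R.
Proof.
rewrite /exponential_prob /exponential_pdf.
pose g (z : R) : \bar R := (expR (- (1 * z)))%:E.
transitivity (\int[mu]_(z in `]x, +oo[) (g \_ `[0%R, +oo[%classic) z)%E.
  apply: eq_integral => z _; rewrite /patch /g; case: ifPn => // _.
  by rewrite mul1r mulN1r mul1r.
set a := Num.max x 0; have a0 : 0 <= a by rewrite le_max lexx orbT.
rewrite -integral_mkcondr.
have -> : (\int[mu]_(z in `]x, +oo[ `&` `[0%R, +oo[) g z = \int[mu]_(z in `[a, +oo[) g z)%E.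
  rewrite /a; case: (leP x 0) => x0; last first.
    rewrite -(integral_itv_obnd_cbnd (r := x)); last first.
      by apply: measurable_funTS; rewrite /g; meas.
    congr (integral _ _ _); apply/seteqP; split => r /=; rewrite !in_itv/= !andbT.
      by case.
    by move=> xr; split => //; rewrite ltW// (lt_trans x0).
  move: x0; rewrite le_eqVlt => /predU1P[->|x0].
    rewrite -(integral_itv_obnd_cbnd (r := 0)); last first.
      by apply: measurable_funTS; rewrite /g; meas.
    congr (integral _ _ _); apply/seteqP; split => r /=; rewrite !in_itv/= !andbT.
      by case.
    by move=> xr; split => //; rewrite ltW.
  congr (integral _ _ _); apply/seteqP; split => r /=; rewrite !in_itv/= !andbT.
    by case.
  by move=> xr; split => //; rewrite (lt_le_trans x0).
by rewrite integral_expNM// divr1 mul1r.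
Qed.

Definition exp_prob : probability R R :=
  pushp (exponential_distribution_exponential_prob__canonical__probability_measure_Probability
    (@ltr01 R))
    (@measurable_id _ (measurableTypeR R) setT
      : measurable_fun setT (id : measurableTypeR R -> R)).

Lemma integral_exp_law (f : R -> \bar R) : measurable_fun setT f ->
  (forall x, 0 <= f x)%E ->
  (\int[Exp]_x f x = \int[mu]_(x in `[0%R, +oo[) (f x * (expR (- x))%:E))%E.
Proof.
move=> mf f0.
transitivity (\int[exp_prob]_x f x)%E.
  apply: eq_measure_integral => A mA _; apply: probability_eq_ccdf => // x.
  by rewrite exp_law_ccdf -exponential_prob_ccdf.
rewrite ge0_integral_pushp// (ge0_integral_density (mu := mu)
  (f := exponential_pdf 1))//.
- rewrite [RHS]integral_mkcond; apply: eq_integral => x _.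
  rewrite /exponential_pdf /patch; case: ifPn => // _; last by rewrite mule0.
  by rewrite mul1r mulN1r.
- by move=> x; apply: exponential_pdf_ge0.
- exact: measurable_exponential_pdf.
Qed.

(** Memorylessness: beyond [z] the density is [exp (- z)] times its own translate. *)
Lemma integral_exp_law_shift (f : R -> \bar R) (z : R) : 0 <= z ->
  measurable_fun setT f -> (forall x, 0 <= f x)%E ->
  (\int[Exp]_x f x = \int[mu]_(x in `[0%R, z[) (f x * (expR (- x))%:E) +
     (expR (- z))%:E * \int[Exp]_x f (x + z)%R)%E.
Proof.
move=> z0 mf f0; rewrite !integral_exp_law//; last by apply: (measurableT_comp mf); meas.
have mg : measurable_fun setT (fun x : R => (f x * (expR (- x))%:E)%E).
  by apply: emeasurable_funM => //; meas.
have g0 x : (0 <= f x * (expR (- x))%:E)%E by rewrite mule_ge0// lee_fin expR_ge0.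
have zE : `[0, +oo[%classic = `[0, z[%classic `|` `[z, +oo[%classic :> set (measurableTypeR R).
  apply/seteqP; split => x /=; rewrite !in_itv/= !andbT.
    by move=> x0; case: (leP z x) => xz; [right|left; rewrite x0].
  by move=> [/andP[]//|zx]; rewrite (le_trans z0).
rewrite [in LHS]zE (@ge0_integral_setU _ _ _ mu `[0, z[ `[z, +oo[)//=; last 2 first.
- exact: measurable_funTS.
- apply/disj_setPRL => x /=; rewrite !in_itv/= andbT => xz /andP[_].
  by rewrite ltNge xz.
congr (_ + _)%E.
rewrite integral_mkcond -(@ge0_integral_affine _ z 1)//; last 2 first.
- by apply/(measurable_restrictT _ _).1 => //; exact: measurable_funTS.
- by move=> x; rewrite erestrict_ge0.
rewrite -ge0_integralZl//; last 2 first.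
- apply: measurable_funTS; apply: emeasurable_funM; last by meas.
  by apply: (measurableT_comp mf); meas.
- by move=> x _; rewrite mule_ge0// lee_fin expR_ge0.
rewrite [RHS]integral_mkcond; apply: eq_integral => x _.
rewrite mule1 !patchE mul1r !mem_setE/= !in_itv/= !andbT lerDl.
case: ifPn => // x0; rewrite addrC opprD expRD EFinM muleA muleAC muleC.
by rewrite muleCA [RHS]muleCA [X in (_ * X)%E]muleC.
Qed.

End exp_law2.

(** * Moments of the exponential, Gaussian and cosine laws *)

Section moments.
Context {R : realType}.
Local Notation mu := (@lebesgue_measure R).
Local Notation gamma := (@gauss1 R).
Local Notation Exp := (@exp_law R).
Local Notation Cos := (@cos2_law R).

Lemma exp_law_moment1 : (\int[Exp]_e `|e|%:E = 1)%E.
Proof.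
rewrite integral_exp_law//; last by meas.
transitivity (\int[mu]_(x in `[0%R, +oo[) (x * expR (- (1 * x)))%:E)%E.
  apply: eq_integral => x; rewrite inE/= in_itv/= andbT => x0.
  by rewrite ger0_norm// mul1r EFinM.
by rewrite integral_x_expNM// invr1 expr1n.
Qed.

Lemma exp_law_moment2 : (\int[Exp]_e (e ^+ 2)%:E = 2%:E)%E.
Proof.
rewrite integral_exp_law//; last 2 first.
- by meas.
- by move=> x; rewrite lee_fin sqr_ge0.
rewrite -integral_x2_expN; apply: eq_integral => x _.
by rewrite mul1r EFinM.
Qed.

(** Half the squared norm of a Gaussian pair has mean 1, hence [(m + m) / 2 = 1]. The integral is a
    priori an extended real, so [m = +oo] is excluded at the end. *)
Lemma gauss1_moment2 : (\int[gamma]_x (x ^+ 2)%:E = 1)%E.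
Proof.
have mx : measurable_fun setT (fun x : R => (x ^+ 2)%:E : \bar R) by meas.
have [m mE] : exists m, (\int[gamma]_x (x ^+ 2)%:E = m)%E by eexists.
have m0 : (0 <= m)%E.
  by rewrite -mE; apply: integral_ge0 => x _; rewrite lee_fin sqr_ge0.
rewrite mE.
have E1 (x : R) : (\int[gamma]_y (`|(x ^+ 2 + y ^+ 2) / 2|%:E) =
    (2^-1)%:E * ((x ^+ 2)%:E + m))%E.
  under eq_integral.
    move=> y _; rewrite ger0_norm ?divr_ge0 ?addr_ge0 ?sqr_ge0//.
    rewrite mulrC EFinM EFinD; over.
  rewrite ge0_integralZl//; last 2 first.
  - by apply: emeasurable_funD => //; exact: measurable_cst.
  - by move=> y _; rewrite adde_ge0// lee_fin sqr_ge0.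
  rewrite ge0_integralD//; last 2 first.
  - by move=> y _; rewrite lee_fin sqr_ge0.
  - by move=> y _; rewrite lee_fin sqr_ge0.
  by rewrite mE integral_cst//= probability_setT mule1.
have := exp_law_moment1; rewrite integral_exp_law_half//; last by meas.
under eq_integral do rewrite E1.
rewrite ge0_integralZl//; last 2 first.
- by apply: emeasurable_funD => //; exact: measurable_cst.
- by move=> y _; rewrite adde_ge0// lee_fin sqr_ge0.
rewrite ge0_integralD//; last first.
  by move=> y _; rewrite lee_fin sqr_ge0.
rewrite mE integral_cst//= probability_setT mule1.
case: m m0 {mE E1} => [r| |]//= _.
  by rewrite -EFinD -EFinM => -[<-]; congr EFin; field.
by rewrite mulry gtr0_sg// mul1e.
Qed.

(** The integration variable of [cos2_law] ranges over the whole line. Clamping gives [-1 < c < 1]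
    everywhere instead of almost everywhere, so that [1 + c] and [1 - c] are always positive and
    below 2. *)
Definition clamp1 (c : R) : R := if (-1 < c < 1) then c else 0.

Lemma clamp1_itv (c : R) : -1 < clamp1 c < 1.
Proof. by rewrite /clamp1; case: ifPn => // _; rewrite ltrN10 ltr01. Qed.

Lemma measurable_clamp1 : measurable_fun setT clamp1.
Proof.
apply: measurable_fun_ifT => //.
by apply: measurable_and; apply: measurable_fun_ltr.
Qed.

Lemma integral_cos2_clamp1 (h : R -> \bar R) : measurable_fun setT h ->
  (forall x, 0 <= h x)%E ->
  (\int[Cos]_c h (clamp1 c) = \int[Cos]_c h c)%E.
Proof.
move=> mh h0; have mhc : measurable_fun setT (h \o clamp1).
  exact: (measurableT_comp mh measurable_clamp1).
rewrite !integral_cos2_law//.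
have m0 : measurable (~` [set 0] : set (measurableTypeR R)) by exact: measurableC.
have mW g : measurable_fun setT g -> measurable_fun ([set: measurableTypeR R] `\ 0)
    (fun t : R => (polar_weight t)%:E * (g ((1 - t ^+ 2) / (1 + t ^+ 2))%R : \bar R))%E.
  move=> mg; apply: measurable_funTS; apply: emeasurable_funM.
    by apply/measurable_EFinP; exact: measurable_polar_weight.
  by apply: (measurableT_comp mg); meas.
rewrite -(@integral_setD1 _ _ 0)//=; last 2 first.
- by rewrite setTD.
- exact: (mW _ mhc).
rewrite -[RHS](@integral_setD1 _ _ 0)//=; last 2 first.
- by rewrite setTD.
- exact: mW.
apply: eq_integral => t; rewrite inE/= => -[_ /eqP t0].
rewrite /clamp1 ifT//.
have t2 : 0 < t ^+ 2 by rewrite exprn_even_gt0.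
by rewrite ltr_pdivlMr ?ltr_pdivrMr; lra.
Qed.

Lemma gauss_polar_clamp (F : R * R -> \bar R) : measurable_fun setT F ->
  (forall z, 0 <= F z)%E ->
  (\int[gamma]_x \int[gamma]_y F (x ^+ 2, y ^+ 2)%R =
   \int[Cos]_c \int[Exp]_e F (e * (1 + clamp1 c), e * (1 - clamp1 c))%R)%E.
Proof.
move=> mF F0; apply: (etrans (gauss_polar mF F0)).
have mFe : measurable_fun setT (fun ce : R * R => F (ce.2 * (1 + ce.1), ce.2 * (1 - ce.1))).
  by apply: (measurableT_comp mF); meas.
apply/esym/(integral_cos2_clamp1
  (h := fun c => \int[Exp]_e F (e * (1 + c), e * (1 - c))%R)%E).
- apply: (@measurable_fun_fubini_tonelli_F _ _ _ _ _ Exp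
    (fun ce : R * R => F (ce.2 * (1 + ce.1), ce.2 * (1 - ce.1))) mFe) => z.
  exact: F0.
- by move=> x; exact: integral_ge0.
Qed.

(** With [X = x^2] and [Y = y^2], polar coordinates give [E (X + Y)^2 = E (2 e)^2 = 8] and
    [E (X - Y)^2 = E (2 e c)^2 = 8 E c^2]. These differ by [4 E X E Y = 4], so [E c^2 = 1 / 2]. *)
Lemma cos2_moment2 : (\int[Cos]_c (c ^+ 2)%:E = (2^-1)%:E)%E.
Proof.
have mP (k : R) : measurable_fun setT (fun z : R * R => ((z.1 + k * z.2) ^+ 2)%:E : \bar R).
  by meas.
have P0 (k : R) (z : R * R) : (0 <= ((z.1 + k * z.2) ^+ 2)%:E)%E by rewrite lee_fin sqr_ge0.
have cos0 (k : R) : (0 <= \int[Cos]_c (c ^+ 2)%:E)%E.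
  by apply: integral_ge0 => c _; rewrite lee_fin sqr_ge0.
have Hp : (\int[gamma]_x \int[gamma]_y ((x ^+ 2 + 1 * y ^+ 2) ^+ 2)%:E =
    \int[Cos]_c \int[Exp]_e ((e * (1 + c) + 1 * (e * (1 - c))) ^+ 2)%:E)%E.
  exact: (@gauss_polar R (fun z => ((z.1 + 1 * z.2) ^+ 2)%:E)%E (mP 1) (P0 1)).
have Hm : (\int[gamma]_x \int[gamma]_y ((x ^+ 2 + -1 * y ^+ 2) ^+ 2)%:E =
    \int[Cos]_c \int[Exp]_e ((e * (1 + c) + -1 * (e * (1 - c))) ^+ 2)%:E)%E.
  exact: (@gauss_polar R (fun z => ((z.1 + -1 * z.2) ^+ 2)%:E)%E (mP (-1)) (P0 (-1))).
have Ep : (\int[Cos]_c \int[Exp]_e ((e * (1 + c) + 1 * (e * (1 - c))) ^+ 2)%:E = 8%:E)%E.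
  under eq_integral => c _.
    under eq_integral => e _.
      rewrite (_ : (_ + _) ^+ 2 = 4 * e ^+ 2); last by ring.
      rewrite EFinM; over.
    rewrite ge0_integralZl//; last 2 first.
    - by meas.
    - by move=> e _; rewrite lee_fin sqr_ge0.
    rewrite exp_law_moment2 -EFinM; over.
  rewrite integral_cst//= probability_setT mule1.
  by congr EFin; ring.
have Em : (\int[Cos]_c \int[Exp]_e ((e * (1 + c) + -1 * (e * (1 - c))) ^+ 2)%:E =
    8%:E * \int[Cos]_c (c ^+ 2)%:E)%E.
  under eq_integral => c _.
    under eq_integral => e _.
      rewrite (_ : (_ + _) ^+ 2 = (4 * c ^+ 2) * e ^+ 2); last by ring.
      rewrite EFinM; over.
    rewrite ge0_integralZl//; last 3 first.
    - by meas.
    - by move=> e _; rewrite lee_fin sqr_ge0.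
    - by rewrite lee_fin mulr_ge0// sqr_ge0.
    rewrite exp_law_moment2 -EFinM.
    rewrite (_ : 4 * c ^+ 2 * 2 = 8 * c ^+ 2); last by ring.
    rewrite EFinM; over.
  rewrite ge0_integralZl//.
  - by meas.
  - by move=> e _; rewrite lee_fin sqr_ge0.
have Eg : (\int[gamma]_x \int[gamma]_y ((x ^+ 2 + -1 * y ^+ 2) ^+ 2)%:E +
    4%:E = \int[gamma]_x \int[gamma]_y ((x ^+ 2 + 1 * y ^+ 2) ^+ 2)%:E)%E.
  have mxy k : measurable_fun setT (fun y : R => ((k + -1 * y ^+ 2) ^+ 2)%:E : \bar R).
    by meas.
  have E1 (x : R) : (\int[gamma]_y ((x ^+ 2 + 1 * y ^+ 2) ^+ 2)%:E =
      \int[gamma]_y ((x ^+ 2 + -1 * y ^+ 2) ^+ 2)%:E + 4%:E * (x ^+ 2)%:E)%E.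
    under eq_integral => y _.
      rewrite (_ : _ ^+ 2 = (x ^+ 2 + -1 * y ^+ 2) ^+ 2 + 4 * x ^+ 2 * y ^+ 2); last by ring.
      rewrite EFinD (EFinM (4 * x ^+ 2)); over.
    rewrite ge0_integralD//; last 3 first.
    - by move=> y _; rewrite lee_fin sqr_ge0.
    - by move=> y _; rewrite lee_fin mulr_ge0 ?sqr_ge0// mulr_ge0// sqr_ge0.
    - by meas.
    rewrite ge0_integralZl//; last 3 first.
    - by meas.
    - by move=> y _; rewrite lee_fin sqr_ge0.
    - by rewrite lee_fin mulr_ge0// sqr_ge0.
    by rewrite gauss1_moment2 mule1 EFinM.
  under [RHS]eq_integral do rewrite E1.
  have mI : measurable_fun setT
      (fun x : R => \int[gamma]_y ((x ^+ 2 + -1 * y ^+ 2) ^+ 2)%:E)%E.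
    apply: (@measurable_fun_fubini_tonelli_F _ _ _ _ _ gamma
      (fun z : R * R => ((z.1 ^+ 2 + -1 * z.2 ^+ 2) ^+ 2)%:E)%E).
      by meas.
    by move=> z; rewrite lee_fin sqr_ge0.
  have I0 (x : R) : (0 <= \int[gamma]_y ((x ^+ 2 + -1 * y ^+ 2) ^+ 2)%:E)%E.
    by apply: integral_ge0 => y _; rewrite lee_fin sqr_ge0.
  have m4 : measurable_fun setT (fun x : R => 4%:E * (x ^+ 2)%:E : \bar R)%E by meas.
  have q4 (x : R) : (0 <= 4%:E * (x ^+ 2)%:E :> \bar R)%E.
    by rewrite mule_ge0// lee_fin sqr_ge0.
  rewrite [RHS](@ge0_integralD _ _ _ gamma _ measurableT _ _
    (fun x _ => I0 x) mI (fun x _ => q4 x) m4); congr (_ + _)%E.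
  rewrite ge0_integralZl//; last 2 first.
  - by meas.
  - by move=> x _; rewrite lee_fin sqr_ge0.
  by rewrite gauss1_moment2 mule1.
have := etrans (congr1 (fun x => x + 4%:E)%E (esym (etrans Hm Em)))
  (etrans Eg (etrans Hp Ep)).
have := cos0 1; case: (\int[Cos]_c (c ^+ 2)%:E)%E => [r| |]//= r0.
  by rewrite -EFinM -EFinD => -[h]; congr EFin; clear -h; lra.
by rewrite mulry gtr0_sg// mul1e.
Qed.

End moments.

(** * The tangent line of a log-concave tail *)

Section logconcave_tail.
Context {R : realType}.
Variable G : R -> R.
Hypotheses (G0 : forall x, 0 <= G x) (Gnincr : forall x y, x <= y -> G y <= G x).
(** Log-concavity without logarithms, so that [G] may vanish: the ratio [G (z + d) / G z] is
    nonincreasing in [z]. *)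
Hypothesis GLC : forall x y d, x <= y -> 0 <= d ->
  G x * G (y + d) <= G (x + d) * G y.
Hypothesis G0_gt0 : 0 < G 0.

Let G_gt0 x : x <= 0 -> 0 < G x.
Proof. by move=> x0; rewrite (lt_le_trans G0_gt0)// Gnincr. Qed.

Let ln_step_right y n : 0 < y -> 0 < G y -> (0 < n)%N ->
  (ln (G (- (y / n%:R))) - ln (G 0)) *+ n <= ln (G 0) - ln (G y).
Proof.
move=> y0 Gy n0; set e := y / n%:R.
have e0 : 0 < e by rewrite divr_gt0// ltr0n.
have Gje j : (j <= n)%N -> 0 < G (j%:R * e).
  move=> jn; rewrite (lt_le_trans Gy)// Gnincr// /e mulrCA ler_piMr ?(ltW y0)//.
  by rewrite ler_pdivrMr ?ltr0n// mul1r ler_nat.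
have : forall j, (j <= n)%N ->
    (ln (G (- e)) - ln (G 0)) *+ j <= ln (G 0) - ln (G (j%:R * e)).
  elim=> [_|j IH jn]; first by rewrite mulr0n mul0r subrr.
  rewrite mulrS (le_trans (lerD (lexx _) (IH (ltnW jn))))//.
  have := @GLC (- e) (j%:R * e) e.
  rewrite addNr (_ : j%:R * e + e = j.+1%:R * e); last by rewrite -natr1; ring.
  move=> /(_ _ (ltW e0)) H.
  have {}H : G (- e) * G (j.+1%:R * e) <= G 0 * G (j%:R * e).
    by apply: H; have := mulr_ge0 (ler0n R j) (ltW e0); clear -e0; lra.
  have Gne : 0 < G (- e) by apply: G_gt0; rewrite oppr_le0 ltW.
  move: H; rewrite -ler_ln ?posrE ?mulr_gt0 ?Gje ?(ltnW jn)//.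
  rewrite !lnM ?posrE ?Gje ?(ltnW jn)//.
  lra.
move=> /(_ n (leqnn n)); rewrite (_ : n%:R * e = y)// /e mulrC divfK//.
by rewrite pnatr_eq0 -lt0n.
Qed.

Let ln_step_left e n : 0 < e ->
  ln (G (- (n%:R * e))) - ln (G 0) <= (ln (G (- e)) - ln (G 0)) *+ n.
Proof.
move=> e0; elim: n => [|n IH]; first by rewrite mulr0n mul0r oppr0 subrr.
have Gne k : 0 < G (- (k%:R * e)).
  by apply: G_gt0; rewrite oppr_le0 mulr_ge0// ltW.
have Ge : 0 < G (- e) by apply: G_gt0; rewrite oppr_le0 ltW.
rewrite [leRHS]mulrS; have [->|n0] := posnP n.
  by rewrite mulr0n addr0 mul1r.
have := @GLC (- (n.+1%:R * e)) (- e) e.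
rewrite addNr (_ : - (n.+1%:R * e) + e = - (n%:R * e)); last by rewrite -natr1; ring.
move=> /(_ _ (ltW e0)) H.
have {}H : G (- (n.+1%:R * e)) * G 0 <= G (- (n%:R * e)) * G (- e).
  by apply: H; rewrite lerN2 ler_peMl ?(ltW e0)// ler1n.
move: H; rewrite -ler_ln ?posrE ?mulr_gt0//.
rewrite !lnM ?posrE//.
lra.
Qed.

(** On a grid of mesh [y / n], the two chords are compared through the single increment on
    [[- y / n, 0]]. As [x] need not lie on the grid, monotonicity of [G] allows rounding it outward
    to [N] steps, at a cost of at most [B / n <= eps]. *)
Let ln_slopes x y : x < 0 -> 0 < y -> 0 < G y ->
  (ln (G x) - ln (G 0)) / (- x) <= (ln (G 0) - ln (G y)) / y.
Proof.
move=> x0 y0 Gy; have Nx0 : 0 < - x by rewrite oppr_gt0.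
set B := ln (G 0) - ln (G y).
have B0 : 0 <= B by rewrite subr_ge0 ler_ln ?posrE//; apply: Gnincr; exact: ltW.
rewrite ler_pdivrMr// mulrAC; apply/ler_addgt0Pr => eps eps0.
pose n := (Num.bound (B / eps)).+1.
have n0 : (0 < n)%N by [].
have nR0 : 0 < n%:R :> R by rewrite ltr0n.
have Bn : B / n%:R <= eps.
  rewrite ler_pdivrMr// -ler_pdivrMl// mulrC (le_trans (ltW (archi_boundP _)))//.
    by apply: divr_ge0 => //; exact: ltW.
  by rewrite ler_nat.
have e0 : 0 < y / n%:R by rewrite divr_gt0.
pose N := (Num.truncn (- x / (y / n%:R))).+1.
have Nx : - x <= N%:R * (y / n%:R).
  by rewrite -ler_pdivrMr// ltW// truncnS_gt.
have Nle : N%:R <= - x / (y / n%:R) + 1.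
  by rewrite /N -natr1 lerD2r truncn_le// divr_ge0// ltW.
have h1 := ln_step_right y0 Gy n0.
have h2 := ln_step_left N e0.
have h3 : ln (G x) <= ln (G (- (N%:R * (y / n%:R)))).
  have hx : 0 < G x by apply: G_gt0; exact: ltW.
  have Ny0 : 0 < N%:R * (y / n%:R) by rewrite mulr_gt0// ltr0n.
  have hN : 0 < G (- (N%:R * (y / n%:R))) by apply: G_gt0; rewrite oppr_le0 ltW.
  by rewrite ler_ln ?posrE//; apply: Gnincr; rewrite lerNl.
set A := ln (G (- (y / n%:R))) - ln (G 0) in h1 h2.
rewrite -/B in h1.
have h4 : A <= B / n%:R by rewrite ler_pdivlMr// mulr_natr.
have h5 : A *+ N <= N%:R * (B / n%:R) by rewrite -[A *+ N]mulr_natl ler_wpM2l.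
have h6 : N%:R * (B / n%:R) <= (- x / (y / n%:R) + 1) * (B / n%:R).
  by rewrite ler_wpM2r// divr_ge0// ltW.
have h7 : (- x / (y / n%:R) + 1) * (B / n%:R) = B * - x / y + B / n%:R.
  by field; rewrite !gt_eqF.
lra.
Qed.

(* The tangent line at [0] to the concave function [ln \o G]. *)
Lemma logconcave_tangent y : 0 < y -> 0 < G y ->
  exists2 h : R, 0 <= h & forall x, G x <= G 0 * expR (- (h * x)).
Proof.
move=> y0 Gy.
(* The slopes of descent from 0 to the right. Their infimum is the slope of the tangent: by
   [ln_slopes] it is at least every slope on the left. *)
pose S := [set (ln (G 0) - ln (G z)) / z | z in [set z | 0 < z /\ 0 < G z]].
have S0 : S !=set0 by exists ((ln (G 0) - ln (G y)) / y); exists y.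
have lbS x : x < 0 -> lbound S ((ln (G x) - ln (G 0)) / (- x)).
  by move=> x0 _ [z [z0 Gz] <-]; exact: ln_slopes.
have lb0 : lbound S 0.
  move=> _ [z [z0 Gz] <-]; apply: divr_ge0; last exact: ltW.
  by rewrite subr_ge0 ler_ln ?posrE//; apply: Gnincr; exact: ltW.
exists (inf S); first exact: lb_le_inf.
move=> x; case: (ltgtP x 0) => [x0|x0|->].
- have := lb_le_inf S0 (lbS _ x0).
  rewrite ler_pdivrMr ?oppr_gt0// => h.
  rewrite -[leLHS]lnK ?posrE ?(G_gt0 (ltW x0))// -[X in _ <= X * _]lnK ?posrE//.
  rewrite -expRD ler_expR; move: h; rewrite mulrN; lra.
- have [Gx|Gx] := ltP 0 (G x); last first.
    by rewrite (le_trans Gx)// mulr_ge0 ?expR_ge0.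
  have : inf S <= (ln (G 0) - ln (G x)) / x.
    by apply: ge_inf; [exists 0|exists x].
  rewrite ler_pdivlMr// => h.
  rewrite -[leLHS]lnK ?posrE// -[X in _ <= X * _]lnK ?posrE//.
  rewrite -expRD ler_expR; move: h; lra.
- by rewrite mulr0 oppr0 expR0 mulr1.
Qed.

End logconcave_tail.

(** * Means of nonnegative functions *)

Section mean_ge0.
Context d (T : measurableType d) (R : realType) (P : probability T R).

(** Bundled with measurability, nonnegativity and finiteness, means of nonnegative combinations are
    computed without integrability side conditions. *)
Definition mean_ge0 (f : T -> R) (r : R) :=
  [/\ measurable_fun setT f, forall x, 0 <= f x &
      (\int[P]_x (f x)%:E = r%:E)%E].

Lemma mean_ge0_cst (r : R) : 0 <= r -> mean_ge0 (cst r) r.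
Proof.
move=> r0; split => //.
by rewrite (eq_integral (cst r%:E))// integral_cst//= probability_setT mule1.
Qed.

Lemma mean_ge0D f g r s : mean_ge0 f r -> mean_ge0 g s ->
  mean_ge0 (fun x => f x + g x) (r + s).
Proof.
move=> [mf f0 fr] [mg g0 gs]; split => [|x|]; first exact: measurable_funD.
  by rewrite addr_ge0.
under eq_integral do rewrite EFinD.
rewrite ge0_integralD//; first by rewrite fr gs.
- by move=> x _; rewrite lee_fin.
- exact/measurable_EFinP.
- by move=> x _; rewrite lee_fin.
- exact/measurable_EFinP.
Qed.

Lemma mean_ge0Z k f r : 0 <= k -> mean_ge0 f r ->
  mean_ge0 (fun x => k * f x) (k * r).
Proof.
move=> k0 [mf f0 fr]; split => [|x|]; first exact: measurable_funM.
  by rewrite mulr_ge0.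
under eq_integral do rewrite EFinM.
rewrite ge0_integralZl//; first by rewrite fr.
- exact/measurable_EFinP.
- by move=> x _; rewrite lee_fin.
Qed.

Lemma eq_mean_ge0 f g r : f =1 g -> mean_ge0 f r -> mean_ge0 g r.
Proof. by move=> /funext ->. Qed.

Lemma ae_mean_ge0_le f g r s : mean_ge0 f r -> mean_ge0 g s ->
  {ae P, forall x, f x <= g x} -> r <= s.
Proof.
move=> [mf f0 fr] [mg g0 gs] fg; rewrite -lee_fin -fr -gs.
apply: ae_ge0_le_integral => //.
- by move=> x _; rewrite lee_fin.
- exact/measurable_EFinP.
- by move=> x _; rewrite lee_fin.
- exact/measurable_EFinP.
by apply: filterS fg => x fgx _; rewrite lee_fin.
Qed.

End mean_ge0.

Section exp_law_means.
Context {R : realType}.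
Local Notation Exp := (@exp_law R).

Lemma exp_law_mean_id : mean_ge0 Exp (fun t => `|t|) 1.
Proof. by split => //; exact: exp_law_moment1. Qed.

Lemma exp_law_mean_expNM (k : R) : 0 <= k ->
  mean_ge0 Exp (fun t => expR (- (k * t))) (k + 1)^-1.
Proof.
move=> k0; split => [|x|]; [by meas|exact: expR_ge0|].
rewrite integral_exp_law//; last first.
  by meas.
have k1 : 0 < k + 1 by rewrite ltr_wpDl.
have := integral_expNM 0 k1; rewrite mulr0 oppr0 expR0 div1r => <-.
by apply: eq_integral => x _; rewrite -EFinM -expRD; congr ((expR _)%:E); ring.
Qed.

Lemma exp_law_mean_xexpN :
  mean_ge0 Exp (fun t => `|t| * expR (- t)) 4^-1.
Proof.
split => [|x|]; [by meas|by rewrite mulr_ge0 ?expR_ge0|].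
rewrite integral_exp_law//; last first.
  by meas.
have k1 : 0 < 2 :> R by [].
have -> : 4^-1 = 2^-1 ^+ 2 :> R by field.
rewrite -(integral_x_expNM k1).
apply: eq_integral => x; rewrite inE/= in_itv/= andbT => x0.
rewrite -EFinM ger0_norm// -mulrA -expRD; congr ((x * expR _)%:E); ring.
Qed.

End exp_law_means.

(** * The probability integral transform for an atomless law *)

Section ccdf_law.
Context {R : realType} (Q : probability R R).
Hypothesis Q1 : forall x : R, Q [set x] = 0%E.

Definition tail (x : R) : R := fine (Q `]x, +oo[%classic).
Local Notation G := tail.

Lemma tailE x : Q `]x, +oo[%classic = (G x)%:E.
Proof. by rewrite /tail fineK// fin_num_measure. Qed.

Lemma tail_ge0 x : 0 <= G x.
Proof. by rewrite -lee_fin -tailE. Qed.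

Lemma tail_le1 x : G x <= 1.
Proof. by rewrite -lee_fin -tailE probability_le1. Qed.

Lemma tail_nincr x y : x <= y -> G y <= G x.
Proof.
move=> xy; rewrite -lee_fin -!tailE le_measure ?inE//.
by apply: subset_itvr; rewrite bnd_simp.
Qed.

Lemma measurable_tail : measurable_fun setT G.
Proof.
by apply: nonincreasing_measurable => // x y /tail_nincr.
Qed.

Let X : {mfun R >-> R} := HB.pack_for {mfun R >-> R} (id : R -> R)
  (@isMeasurableFun.Build _ _ R R id (@measurable_id _ R setT)).

Let ccdfE x : ccdf (X : {RV Q >-> R}) x = (G x)%:E.
Proof. by rewrite -tailE. Qed.

Lemma tail_right x : G y @[y --> x^'+] --> G x.
Proof.
have := @ccdf_right_continuous _ _ _ _ (X : {RV Q >-> R}) x.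
rewrite ccdfE.
rewrite (_ : ccdf (X : {RV Q >-> R}) = EFin \o G); last exact/funext.
by move=> /fine_cvg.
Qed.

Let tail_y : G y @[y --> +oo%R] --> (0 : R).
Proof.
have := @cvg_ccdfy0 _ _ _ _ (X : {RV Q >-> R}).
rewrite (_ : ccdf (X : {RV Q >-> R}) = EFin \o G); last exact/funext.
by move=> /fine_cvg.
Qed.

Let tail_Ny : G y @[y --> -oo%R] --> (1 : R).
Proof.
have := @cvg_ccdfNy1 _ _ _ _ (X : {RV Q >-> R}).
rewrite (_ : ccdf (X : {RV Q >-> R}) = EFin \o G); last exact/funext.
by move=> /fine_cvg.
Qed.

Let tail_left x u : (forall y, y < x -> u <= G y) -> u <= G x.
Proof.
move=> h.
have -> : G x = fine (Q `[x, +oo[%classic).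
  have -> : `[x, +oo[%classic = [set x] `|` `]x, +oo[%classic.
    apply/seteqP; split => y /=; rewrite !in_itv/= !andbT.
      by rewrite le_eqVlt => /predU1P[->|]; [left|right].
    by move=> [->//|/ltW].
  rewrite measureU//; first by rewrite /= Q1 add0e.
  by apply/seteqP; split => // y [/= ->]; rewrite in_itv/= ltxx.
have : Q (`]x - n.+1%:R^-1, +oo[%classic) @[n --> \oo] -->
    Q (\bigcap_n `]x - n.+1%:R^-1, +oo[%classic).
  apply: nonincreasing_cvg_mu => //.
  - by rewrite (le_lt_trans (probability_le1 _ _)) ?ltry.
  - by apply: bigcapT_measurable.
  - move=> m n mn; apply/subsetPset/subset_itvr; rewrite bnd_simp.
    by rewrite lerD2l lerN2 lef_pV2 ?posrE ?ltr0n// ler_nat.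
rewrite -itvcyEbigcap => cv.
rewrite -lee_fin fineK ?fin_num_measure// -(cvg_lim _ cv)//.
apply: lime_ge; first by apply/cvg_ex; eexists; exact: cv.
by apply: nearW => n; rewrite tailE lee_fin h// ltrBlDr ltrDl invr_gt0 ltr0n.
Qed.

Let tail_lt_set u : 0 < u <= 1 -> [set x | u <= G x] !=set0 ->
  exists2 x, G x = u & [set y | G y < u] = `]x, +oo[%classic.
Proof.
move=> /andP[u0 u1] S0; pose S := [set x | u <= G x].
have [M SM] : has_ubound S.
  have : \forall y \near +oo, G y < u by exact: (cvgr_lt _ tail_y).
  move=> [M [_ MG]]; exists (M + 1) => x /= ux.
  rewrite leNgt; apply/negP => Mx.
  have := MG x (le_lt_trans _ Mx); rewrite lerDl ler01 => /(_ isT).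
  by rewrite ltNge ux.
have supS : has_sup S by split => //; exists M.
have Gsup : u <= G (sup S).
  apply: tail_left => y ys.
  have [z Sz yz] := sup_gt S0 ys.
  by rewrite (le_trans Sz)// tail_nincr// ltW.
have ltS y : sup S < y -> G y < u.
  move=> sy; rewrite ltNge; apply/negP => uy.
  have := ub_le_sup (ex_intro _ M SM) uy.
  by rewrite leNgt sy.
exists (sup S).
  apply/eqP; rewrite eq_le Gsup andbT.
  apply: (cvgr_to_le (@tail_right (sup S))).
  near=> y; apply/ltW/ltS.
  by near: y; exact: nbhs_right_gt.
apply/seteqP; split => y /=; rewrite in_itv/= andbT; last exact: ltS.
rewrite ltNge => Gy; rewrite ltNge; apply/negP => ys; move: Gy.
by rewrite (le_trans Gsup)// tail_nincr.
Unshelve. all: by end_near. Qed.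

(** The set where [u <= G x] is bounded above. At its supremum, right continuity of the tail and the
    absence of atoms give [G = u], so [G < u] defines a half line of measure [u]. If the set is
    empty, [u] must be 1. *)
Lemma tail_uniform u : 0 < u <= 1 -> Q [set x | G x < u] = u%:E.
Proof.
move=> u01; have [S0|/set0P/negP] := pselect ([set x | u <= G x] !=set0).
  by have [x Gx ->] := tail_lt_set u01 S0; rewrite tailE Gx.
rewrite negbK => /eqP S0.
have ltu x : G x < u.
  rewrite ltNge; apply/negP => ux.
  by have : [set x | u <= G x] x by []; rewrite S0.
have u1 : u = 1.
  apply/eqP; rewrite eq_le; case/andP: u01 => _ ->/=.
  apply: (cvgr_to_le tail_Ny).
  by apply: nearW => x; exact: ltW.
have -> : [set x | G x < u] = setT by apply/seteqP; split => // x _; exact: ltu.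
by rewrite probability_setT u1.
Qed.

Lemma measurable_tail_preimage (B : set R) : measurable B ->
  measurable (G @^-1` B).
Proof.
by move=> mB; rewrite -[X in measurable X]setTI; exact: measurable_tail.
Qed.

Lemma tail_eq0 : Q [set x | G x = 0] = 0%E.
Proof.
apply/eqP; rewrite eq_le measure_ge0 andbT.
apply/lee_addgt0Pr => e e0; rewrite add0e.
pose u := Num.min e 1.
have u01 : 0 < u <= 1 by rewrite /u lt_min e0 ltr01 ge_min lexx orbT.
apply: (@le_trans _ _ u%:E); last by rewrite lee_fin ge_min lexx.
rewrite -(tail_uniform u01) le_measure// ?inE.
- exact: (measurable_tail_preimage (measurable_set1 0)).
- rewrite (_ : [set _ | _] = G @^-1` `]-oo, u[%classic).
    exact: measurable_tail_preimage.
  by apply/seteqP; split => x /=; rewrite in_itv.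
- by move=> x /= ->; case/andP: u01.
Qed.

(** As [ln 0 = 0], this is 0 where the tail vanishes; by [tail_eq0] such points are negligible. *)
Definition logtail (x : R) : R := - ln (G x).

Lemma measurable_logtail : measurable_fun setT logtail.
Proof.
apply: measurable_funN; apply: (measurableT_comp (@measurable_ln R)).
exact: measurable_tail.
Qed.

Lemma logtail_ge0 x : 0 <= logtail x.
Proof. by rewrite /logtail oppr_ge0 ln_le0// tail_le1. Qed.

Lemma logtailK x : 0 < G x -> G x = expR (- logtail x).
Proof. by move=> Gx; rewrite /logtail opprK lnK. Qed.

(** The tail is uniform under [Q], and minus the logarithm of a uniform variable is exponential;
    means of functions of the tail thus become exponential integrals. *)
Lemma integral_logtail (f : R -> \bar R) : measurable_fun setT f ->
  (forall x, 0 <= f x)%E ->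
  (\int[Q]_x f (logtail x) = \int[exp_law]_t f t)%E.
Proof.
move=> mf f0; rewrite -(ge0_integral_pushp Q measurable_logtail)//.
apply: eq_measure_integral => A mA _.
apply: probability_eq_ccdf => // t.
rewrite exp_law_ccdf pushpE; have [t0|t0] := ltP t 0.
  rewrite oppr0 expR0 (_ : _ @^-1` _ = setT) ?probability_setT//.
  apply/seteqP; split => // x _ /=; rewrite in_itv/= andbT.
  by rewrite (lt_le_trans t0)// logtail_ge0.
have u01 : 0 < expR (- t) <= 1 by rewrite expR_gt0 expR_le1 oppr_le0.
rewrite -(tail_uniform u01).
have m0 : measurable [set x | G x = 0].
  exact: (measurable_tail_preimage (measurable_set1 0)).
have mL : measurable (logtail @^-1` `]t, +oo[%classic).
  by rewrite -[X in measurable X]setTI; exact: measurable_logtail.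
have -> : [set x | G x < expR (- t)] =
    (logtail @^-1` `]t, +oo[%classic) `|` [set x | G x = 0].
  apply/seteqP; split => x /=; rewrite in_itv/= andbT.
    have [Gx0|Gx0] := eqVneq (G x) 0; first by right.
    have Gx : 0 < G x by rewrite lt_neqAle eq_sym Gx0 tail_ge0.
    by rewrite (logtailK Gx) ltr_expR ltrN2; left.
  move=> [tx|->]; last exact: expR_gt0.
  have [Gx0|Gx0] := eqVneq (G x) 0; first by rewrite Gx0 expR_gt0.
  have Gx : 0 < G x by rewrite lt_neqAle eq_sym Gx0 tail_ge0.
  by rewrite (logtailK Gx) ltr_expR ltrN2.
by rewrite measureU0//; exact: tail_eq0.
Qed.

Lemma mean_ge0_logtail f r : mean_ge0 exp_law f r ->
  mean_ge0 Q (fun x => f (logtail x)) r.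
Proof.
move=> [mf f0 fr]; split => //.
  exact: (measurableT_comp mf measurable_logtail).
rewrite -fr; apply: (integral_logtail (f := fun t => (f t)%:E)) => //.
exact/measurable_EFinP.
Qed.

End ccdf_law.

(** * Lower bound for a log-concave tail at 0 *)

Section tail_bound.
Context {R : realType} (Q : probability R R).
Hypothesis Q1 : forall x : R, Q [set x] = 0%E.
Local Notation G := (tail Q).
Hypothesis QLC : forall x y d : R, x <= y -> 0 <= d ->
  G x * G (y + d) <= G (x + d) * G y.
Variables (m v : R).
(** Expresses that the mean is [m] and the variance [v], with nonnegative integrands only. *)
Hypothesis Qm : forall r : R, mean_ge0 Q (fun x => (x - r) ^+ 2) (v + (m - r) ^+ 2).
Hypothesis m0 : 0 <= m.

(** If the tail vanished at 0, the law would live on the nonpositive reals. Comparing the second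
    moments about 1 and 0 would give [E |x| = - m <= 0], so the law would be the point mass at 0,
    which [Q1] excludes. *)
Let tail0_gt0 : 0 < G 0.
Proof.
rewrite lt_neqAle tail_ge0 andbT eq_sym; apply/eqP => G00.
have Q0 : Q `]0, +oo[%classic = 0%E by rewrite tailE G00.
have ae0 : {ae Q, forall x, x <= 0}.
  exists `]0, +oo[%classic; split => // x /=.
  by move=> /negP; rewrite -ltNge in_itv/= andbT.
have mabs : measurable_fun setT (fun x : R => `|x|%:E : \bar R) by meas.
have h : (\int[Q]_x (`|x|%:E) = 0)%E.
  have h2 : (\int[Q]_x ((x - 1) ^+ 2)%:E = \int[Q]_x ((x - 0) ^+ 2)%:E + 1 +
      2%:E * \int[Q]_x (`|x|%:E))%E.
    have mx2 : measurable_fun setT (fun x : R => ((x - 0) ^+ 2)%:E : \bar R) by meas.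
    have m2x : measurable_fun setT (fun x : R => 2%:E * `|x|%:E : \bar R)%E.
      by apply: emeasurable_funM.
    transitivity (\int[Q]_x (((x - 0) ^+ 2)%:E + 1 + 2%:E * `|x|%:E))%E.
      apply: ae_eq_integral => //.
      - by meas.
      - by apply: emeasurable_funD => //; apply: emeasurable_funD.
      - apply: filterS ae0 => x x0 _.
        rewrite -EFinM -!EFinD ler0_norm//; congr EFin; ring.
    rewrite ge0_integralD//; last 2 first.
    - by move=> x _; rewrite adde_ge0// lee_fin sqr_ge0.
    - by apply: emeasurable_funD.
    rewrite ge0_integralD//; last first.
      by move=> x _; rewrite lee_fin sqr_ge0.
    rewrite ge0_integralZl//; congr (_ + _ + _)%E.
    by rewrite integral_cst//= probability_setT mule1.
  have [_ _ q1] := Qm 1; have [_ _ q0] := Qm 0.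
  move: h2; rewrite q1 q0.
  have : (0 <= \int[Q]_x (`|x|%:E))%E by apply: integral_ge0.
  case: (\int[Q]_x (`|x|%:E))%E => [r| |]//=.
    rewrite lee_fin => r0; rewrite -EFinM -!EFinD => -[e]; congr EFin.
    have aux (a w s : R) : 0 <= a -> 0 <= s ->
      w + (a - 1) ^+ 2 = w + (a - 0) ^+ 2 + 1 + 2 * s -> s = 0.
      by move=> a0 s0 ws; apply/eqP; rewrite eq_le s0 andbT; nra.
    exact: aux m0 r0 e.
  by rewrite mulry gtr0_sg// mul1e.
have : Q [set 0] = 1%E.
  have : ae_eq Q setT (fun x : R => `|x|%:E) (cst 0%E).
    apply/ae_eq_integral_abs => //.
    by rewrite -[RHS]h; apply: eq_integral => x _; rewrite gee0_abs.
  move=> ae1.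
  have : Q [set~ 0] = 0%E.
    apply: (@negligibleP _ _ _ Q _ _).1; first exact: measurableC.
    apply: negligibleS ae1 => x /= x0 /(_ I) [] /normr0_eq0 //.
  rewrite probability_setC//.
  rewrite Q1 sube0 => /eqP; rewrite onee_eq0//.
by rewrite Q1 => /esym/eqP; rewrite onee_eq0.
Qed.

(* Jensen's inequality for the concave function [ln \o G] at [0], under the law
   [Q] reweighted by [1 + c * (2 * G - 1)], whose mean is still nonnegative;
   [G] is uniformly distributed on [0, 1] under [Q]. *)
Lemma tail_lower_bound (c b : R) : 0 <= c <= 1 -> 0 < b ->
  c * (b / 6 + v / (2 * b)) <= m -> expR (- 1 + c / 2) <= G 0.
Proof.
move=> /andP[c0 c1] b0 cm.
have [y y0 Gy] : exists2 y : R, 0 < y & 0 < G y.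
  have h1 : \forall y \near (0 : R)^'+, 0 < G y by exact: (cvgr_gt _ (@tail_right _ Q 0) _ tail0_gt0).
  have h2 : \forall y \near (0 : R)^'+, 0 < y := nbhs_right_gt (0 : R).
  by case: (@filter_ex R _ (at_right_proper_filter (0 : R)) _ (filterI h1 h2)) => y [Gy y0]; exists y.
have [h h0 hG] := logconcave_tangent (tail_ge0 Q) (@tail_nincr _ Q) QLC tail0_gt0 y0 Gy.
pose T0 := logtail Q 0.
(* [hA] and [hB] are the two sides of an inequality between nonnegative functions. With [U = G x],
   [T = - ln U] and the weight [w = 1 - c + 2 c U], their difference is [w (T - T0 - h x)],
   nonnegative by the tangent line, plus [h c / (2 b)] times the square of [b (2 U - 1) + (x - m)],
   an inequality of means with free parameter [b]. The signed term [- h x] is split into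
   [h / 2 * (x - 1) ^+ 2] and [h / 2 * (x ^+ 2 + 1)]. The [b / 6] of the hypothesis is [b / 2] times
   the mean 1/3 of [(2 U - 1) ^+ 2]. *)
have hA : mean_ge0 Q (fun x =>
  (1 - c) * `|logtail Q x| + 2 * c * (`|logtail Q x| * expR (- logtail Q x)) +
  h * c * b / 2 * (4 * expR (- (2 * logtail Q x)) + 1) +
  h * c / (2 * b) * (x - m) ^+ 2 + h / 2 * (x - 1) ^+ 2 + h * c * m)
  ((1 - c) * 1 + 2 * c * 4^-1 + h * c * b / 2 * (4 * (2 + 1)^-1 + 1) +
   h * c / (2 * b) * (v + (m - m) ^+ 2) + h / 2 * (v + (m - 1) ^+ 2) + h * c * m).
  have p1 : 0 <= h * c * b / 2 by rewrite divr_ge0// !mulr_ge0// ltW.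
  have p2 : 0 <= h * c / (2 * b) by rewrite divr_ge0// !mulr_ge0// ltW.
  have p3 : 0 <= h / 2 by rewrite divr_ge0.
  have p4 : 0 <= h * c * m by rewrite !mulr_ge0.
  have p5 : 0 <= 1 - c by rewrite subr_ge0.
  have p6 : 0 <= 2 * c by rewrite mulr_ge0.
  apply: mean_ge0D; last exact: (mean_ge0_cst Q p4).
  apply: mean_ge0D; last exact: mean_ge0Z.
  apply: mean_ge0D; last exact: mean_ge0Z.
  apply: (@mean_ge0_logtail _ Q Q1 (fun t => (1 - c) * `|t| + 2 * c * (`|t| * expR (- t)) +
    h * c * b / 2 * (4 * expR (- (2 * t)) + 1)) _).
  apply: mean_ge0D; last first.
    apply: mean_ge0Z => //; apply: mean_ge0D; last exact: (mean_ge0_cst _ ler01).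
    by apply: mean_ge0Z => //; exact: exp_law_mean_expNM.
  apply: mean_ge0D.
    by apply: mean_ge0Z => //; exact: exp_law_mean_id.
  by apply: mean_ge0Z => //; exact: exp_law_mean_xexpN.
have T00 : 0 <= T0 := logtail_ge0 Q 0.
have hB : mean_ge0 Q (fun x =>
  (T0 * (2 * c) + 2 * h * c * m + 2 * h * c * b) * expR (- (1 * logtail Q x)) +
  T0 * (1 - c) + h / 2 * (x - 0) ^+ 2 + h / 2)
  ((T0 * (2 * c) + 2 * h * c * m + 2 * h * c * b) * (1 + 1)^-1 + T0 * (1 - c) +
   h / 2 * (v + (m - 0) ^+ 2) + h / 2).
  have p3 : 0 <= h / 2 by rewrite divr_ge0.
  have p5 : 0 <= T0 * (1 - c) by rewrite mulr_ge0// subr_ge0.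
  have p6 : 0 <= T0 * (2 * c) + 2 * h * c * m + 2 * h * c * b.
    by rewrite !addr_ge0// !mulr_ge0// ltW.
  apply: mean_ge0D; last exact: (mean_ge0_cst Q p3).
  apply: mean_ge0D; last exact: mean_ge0Z.
  apply: mean_ge0D; last exact: (mean_ge0_cst Q p5).
  apply: mean_ge0Z => //.
  apply: (@mean_ge0_logtail _ Q Q1 (fun t => expR (- (1 * t))) _).
  exact: exp_law_mean_expNM.
have BA : {ae Q, forall x,
  (T0 * (2 * c) + 2 * h * c * m + 2 * h * c * b) * expR (- (1 * logtail Q x)) +
  T0 * (1 - c) + h / 2 * (x - 0) ^+ 2 + h / 2 <=
  (1 - c) * `|logtail Q x| + 2 * c * (`|logtail Q x| * expR (- logtail Q x)) +
  h * c * b / 2 * (4 * expR (- (2 * logtail Q x)) + 1) +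
  h * c / (2 * b) * (x - m) ^+ 2 + h / 2 * (x - 1) ^+ 2 + h * c * m}.
  exists [set x | G x = 0]; split; last 2 first.
  - exact: tail_eq0.
  - move=> x /= Bx; apply: contrapT => /eqP Gx0; apply: Bx.
    have Gx : 0 < G x by rewrite lt_neqAle eq_sym Gx0 tail_ge0.
    rewrite mul1r ger0_norm ?logtail_ge0//.
    have -> : expR (- (2 * logtail Q x)) = expR (- logtail Q x) ^+ 2.
      by rewrite expr2 -expRD; congr expR; ring.
    have : T0 + h * x <= logtail Q x.
      rewrite -lerN2 -ler_expR -(logtailK Gx) (le_trans (hG x))//.
      by rewrite (logtailK tail0_gt0) -expRD ler_expR /T0 opprD.
    have := expR_gt0 (- logtail Q x).
    have : expR (- logtail Q x) <= 1 by rewrite expR_le1 oppr_le0 logtail_ge0.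
    move: (expR (- logtail Q x)) => U; move: (logtail Q x) => T U1 U0 hT.
    have hk : 0 <= 1 - c + 2 * c * U by rewrite addr_ge0 ?subr_ge0// !mulr_ge0// ltW.
    have q1 : 0 <= (1 - c + 2 * c * U) * (T - T0 - h * x).
      by rewrite mulr_ge0//; lra.
    have q2 : 0 <= h * c / (2 * b) * (b * (2 * U - 1) + (x - m)) ^+ 2.
      by rewrite mulr_ge0 ?sqr_ge0// divr_ge0// ?mulr_ge0// ltW.
    rewrite -subr_ge0.
    rewrite [leRHS](_ : _ = (1 - c + 2 * c * U) * (T - T0 - h * x) +
      h * c / (2 * b) * (b * (2 * U - 1) + (x - m)) ^+ 2); last by field; rewrite gt_eqF.
    exact: addr_ge0.
  - exact: (measurable_tail_preimage Q (measurable_set1 0)).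
have := ae_mean_ge0_le hB hA BA => main.
have hm : h * (c * (b / 6 + v / (2 * b))) <= h * m by rewrite ler_wpM2l.
rewrite (logtailK tail0_gt0) ler_expR -/T0.
rewrite -subr_ge0 in main.
rewrite (_ : _ - _ = 1 - c / 2 - T0 + (h * (c * (b / 6 + v / (2 * b))) - h * m)) in main; last first.
  by field; rewrite gt_eqF.
have aux (a r s w : R) : 0 <= 1 - r - s + (a - w) -> a <= w -> - 1 + r <= - s.
  by move=> *; lra.
exact: aux main hm.
Qed.

End tail_bound.

(** * Linear combinations of independent exponentials *)

Section tuples.
Context (T : Type).

Lemma tcons_ind (P : forall n, n.-tuple T -> Prop) : P 0%N [tuple] ->
  (forall n x (a : n.-tuple T), P n a -> P n.+1 [tuple of x :: a]) ->
  forall n (a : n.-tuple T), P n a.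
Proof.
move=> P0 PS; elim=> [|n IH] a; first by rewrite tuple0.
by case/tupleP: a => x a; exact: PS.
Qed.

End tuples.

Section dot_product.
Context {R : realType}.

Definition dot n (a e : n.-tuple R) : R := \sum_(i < n) tnth a i * tnth e i.

Lemma dot0 (a e : 0.-tuple R) : dot a e = 0.
Proof. by rewrite /dot big_ord0. Qed.

Lemma dotS n x (a : n.-tuple R) y (e : n.-tuple R) :
  dot [tuple of x :: a] (tcons (y, e)) = x * y + dot a e.
Proof.
rewrite /dot big_ord_recl !tnth0; congr (_ + _).
by apply: eq_bigr => i _; rewrite !tnthS.
Qed.

Lemma measurable_dot n (a : n.-tuple R) : measurable_fun setT (dot a).
Proof.
apply: measurable_sum => i; apply: measurable_funM => //.
exact: measurable_tnth.
Qed.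

Lemma sum_tcons n (f : R -> R) x (a : n.-tuple R) :
  \sum_(i < n.+1) f (tnth [tuple of x :: a] i) = f x + \sum_(i < n) f (tnth a i).
Proof.
by rewrite big_ord_recl tnth0; congr (_ + _); apply: eq_bigr => i _; rewrite tnthS.
Qed.

End dot_product.

Section exp_combination.
Context {R : realType}.
Local Notation mu := (@lebesgue_measure R).
Local Notation Exp := (@exp_law R).

Definition logconcave_translates (G : R -> \bar R) :=
  forall x y d : R, x <= y -> 0 <= d -> (G x * G (y + d)%R <= G (x + d)%R * G y)%E.

Let measurable_shift (G : R -> \bar R) (f : R -> R) :
  measurable_fun setT G -> measurable_fun setT f ->
  measurable_fun setT (fun x => G (f x)).
Proof. by move=> mG mf; exact: (measurableT_comp mG mf). Qed.

Let integral_le_cross d (T : measurableType d) (m : {measure set T -> \bar R})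
    (D : set T) (f g : T -> \bar R) (c c' : \bar R) : measurable D ->
  measurable_fun D f -> measurable_fun D g ->
  (forall x, 0 <= f x)%E -> (forall x, 0 <= g x)%E ->
  (0 <= c)%E -> (0 <= c')%E -> (forall x, D x -> c * f x <= c' * g x)%E ->
  (c * \int[m]_(x in D) f x <= c' * \int[m]_(x in D) g x)%E.
Proof.
move=> mD mf mg f0 g0 c0 c'0 fg; rewrite -!ge0_integralZl//.
apply: ge0_le_integral => //.
- by move=> x _; rewrite mule_ge0.
- by apply: emeasurable_funM => //; exact: measurable_cst.
- by apply: emeasurable_funM => //; exact: measurable_cst.
Qed.

(** For [k > 0], memorylessness with [z = d / k] gives [H (t + d) = A (t + d) + exp (- z) H t],
    where [A] integrates over [[0, z[] only. The common product [exp (- z) H x H y] cancels, and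
    [H x A (y + d) <= A (x + d) H y] remains. This is the hypothesis on [G] integrated over pairs
    [(u, e)]: for [e < z] the shift [d - k e + k u] is nonnegative. *)
Lemma logconcave_translates_exp (k : R) (G : R -> \bar R) :
  measurable_fun setT G -> (forall x, 0 <= G x)%E ->
  logconcave_translates G ->
  logconcave_translates (fun x => \int[Exp]_e G (x - k * e)%R)%E.
Proof.
move=> mG G0 lcG x y d xy d0.
set H := fun x => (\int[Exp]_e G (x - k * e)%R)%E.
have H0 z : (0 <= H z)%E by apply: integral_ge0.
have mGk z : measurable_fun setT (fun e : R => G (z - k * e)).
  by apply: measurable_shift => //; meas.
have [->|k0] := eqVneq k 0.
  have HE z : (\int[Exp]_e G (z - 0 * e)%R = G z)%E.
    under eq_integral do rewrite mul0r subr0.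
    by rewrite integral_cst//= probability_setT mule1.
  by rewrite !HE; exact: lcG.
have mE (D : set (measurableTypeR R)) : measurable_fun D (fun e : measurableTypeR R => (expR (- e))%:E : \bar R).
  by apply: measurable_funTS; meas.
have mGE (D : set (measurableTypeR R)) z : measurable_fun D (fun e : measurableTypeR R => (G (z - k * e)%R * (expR (- e))%:E)%E).
  apply: emeasurable_funM; last exact: mE.
  by apply: measurable_funTS; exact: mGk.
have GE0 z e : (0 <= G (z - k * e)%R * (expR (- e))%:E)%E.
  by rewrite mule_ge0// lee_fin expR_ge0.
have EZ z : (0 <= (expR (- z))%:E :> \bar R)%E by rewrite lee_fin expR_ge0.
have Hlaw t : H t = (\int[mu]_(u in `[0%R, +oo[) (G (t - k * u)%R * (expR (- u))%:E))%E.
  by rewrite /H integral_exp_law.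
rewrite -/(H x) -/(H (x + d)) -/(H (y + d)) -/(H y).
have cross (a b s t : R) (D : set (measurableTypeR R)) : measurable D ->
    D `<=` `[0%R, +oo[%classic -> 
    (forall u e : R, (0 <= u)%R -> D e -> G (a - k * u)%R * G (t - k * e)%R <= G (s - k * e)%R * G (b - k * u)%R)%E ->
    (H a * \int[mu]_(e in D) (G (t - k * e)%R * (expR (- e))%:E) <=
     (\int[mu]_(e in D) (G (s - k * e)%R * (expR (- e))%:E)) * H b)%E.
  move=> mD D0 h; rewrite [leRHS]muleC. apply: integral_le_cross; [exact: mD|exact: mGE|exact: mGE|by []..|] => e De.
  rewrite !muleA; apply: lee_wpmul2r => //.
  rewrite muleC [leRHS]muleC !Hlaw; apply: integral_le_cross; [by []|exact: mGE|exact: mGE|by []..|] => u.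
  rewrite /= in_itv/= andbT => u0.
  rewrite !muleA; apply: lee_wpmul2r => //.
  by rewrite muleC; exact: h.
have alg (h1 h2 A1 A2 E : \bar R) : (0 <= h1 -> 0 <= h2 -> 0 <= A1 -> 0 <= A2 -> 0 <= E ->
    h1 * A2 <= A1 * h2 -> h1 * (A2 + E * h2) <= (A1 + E * h1) * h2)%E.
  move=> h10 h20 A10 A20 E0 hA; rewrite ge0_muleDr ?mule_ge0// ge0_muleDl ?mule_ge0//.
  by apply: leeD => //; rewrite muleCA muleA.
have [kp|kn] := ltP 0 k.
  pose z := d / k; have z0 : 0 <= z by rewrite divr_ge0// ltW.
  pose A t := (\int[mu]_(e in `[0%R, z[) (G (t - k * e)%R * (expR (- e))%:E))%E.
  have A0 t : (0 <= A t)%E by apply: integral_ge0.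
  have Hd t : H (t + d) = (A (t + d)%R + (expR (- z))%:E * H t)%E.
    rewrite /H (integral_exp_law_shift z0)//; congr (_ + _ * _)%E.
    apply: eq_integral => e _; congr G.
    by rewrite /z mulrDr mulrCA divff// mulr1; ring.
  rewrite (Hd x) (Hd y); apply: alg => //; apply: cross => // [e|u e u0]; rewrite /= !in_itv/=; first by case/andP=> ->.
  move=> /andP[e0 ez].
  have de : 0 <= d - k * e by rewrite subr_ge0 mulrC -ler_pdivlMr// ltW.
  have -> : y + d - k * e = y - k * u + (d - k * e + k * u) by ring.
  have -> : x + d - k * e = x - k * u + (d - k * e + k * u) by ring.
  apply: lcG; first by rewrite lerB.
  by rewrite addr_ge0// mulr_ge0// ltW.
(* For [k < 0] the translates move the other way, and the recursion expresses [H t] through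
   [H (t + d)]. *)
pose z := d / - k.
have k0' : 0 < - k by rewrite oppr_gt0 lt_neqAle k0.
have z0 : 0 <= z by rewrite divr_ge0// ltW.
pose B t := (\int[mu]_(e in `[0%R, z[) (G (t - k * e)%R * (expR (- e))%:E))%E.
have B0 t : (0 <= B t)%E by apply: integral_ge0.
have Hd t : H t = (B t + (expR (- z))%:E * H (t + d)%R)%E.
  rewrite {1}/H (integral_exp_law_shift z0)//; congr (_ + _ * _)%E.
  apply: eq_integral => e _; congr G.
  by rewrite /z invrN mulrN mulrBr mulrCA divff// mulr1; ring.
rewrite (Hd x) (Hd y) muleC [leRHS]muleC; apply: alg => //.
apply: cross => // [e|u e u0]; rewrite /= !in_itv/=; first by case/andP=> ->.
move=> /andP[e0 ez].
have de : 0 <= d + k * e.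
  by rewrite -[k]opprK mulNr subr_ge0 mulrC -ler_pdivlMr// ltW.
rewrite muleC [leRHS]muleC.
have -> : y + d - k * u = y - k * e + (d + k * e - k * u) by ring.
have -> : x + d - k * u = x - k * e + (d + k * e - k * u) by ring.
apply: lcG; first by rewrite lerB.
by rewrite addr_ge0// oppr_ge0 mulr_le0_ge0.
Qed.

Lemma eq_integral_exp_law (f g : R -> \bar R) :
  measurable_fun setT f -> measurable_fun setT g ->
  (forall x, 0 <= f x)%E -> (forall x, 0 <= g x)%E ->
  (forall x, (0 <= x)%R -> f x = g x) ->
  (\int[Exp]_x f x = \int[Exp]_x g x)%E.
Proof.
move=> mf mg f0 g0 fg; rewrite !integral_exp_law//.
by apply: eq_integral => x; rewrite inE/= in_itv/= andbT => /fg ->.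
Qed.

Lemma exp_law_mean_sq (k s : R) :
  mean_ge0 Exp (fun e => (k * e + s) ^+ 2) (k ^+ 2 + (k + s) ^+ 2).
Proof.
split => [|x|]; [by meas|exact: sqr_ge0|].
(* The cross term [b e] may be negative; adding [(|b| - b) |e|] to the square turns it into
   [|b| |e|] for [e >= 0], so that every mean involved is nonnegative. *)
pose b := 2 * (k * s).
have p1 : 0 <= `|b| - b by rewrite subr_ge0 ler_norm.
have p2 : 0 <= `|b| := normr_ge0 b.
have k20 := sqr_ge0 k.
have [mh h0 hE] : mean_ge0 Exp (fun e => k ^+ 2 * e ^+ 2 + `|b| * `|e| + s ^+ 2)
    (k ^+ 2 * 2 + `|b| * 1 + s ^+ 2).
  apply: mean_ge0D; last exact: (mean_ge0_cst Exp (sqr_ge0 s)).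
  apply: mean_ge0D; apply: mean_ge0Z => //; last exact: exp_law_mean_id.
  by split => [|e|]; [by meas|exact: sqr_ge0|exact: exp_law_moment2].
have [mg _ gE] : mean_ge0 Exp (fun e => (`|b| - b) * `|e|) ((`|b| - b) * 1).
  by apply: mean_ge0Z => //; exact: exp_law_mean_id.
have mf : measurable_fun setT (fun e : R => ((k * e + s) ^+ 2)%:E : \bar R) by meas.
have f0 (e : R) : (0 <= ((k * e + s) ^+ 2)%:E :> \bar R)%E by rewrite lee_fin sqr_ge0.
have g0 (e : R) : (0 <= ((`|b| - b) * `|e|)%:E :> \bar R)%E by rewrite lee_fin mulr_ge0.
have mgE : measurable_fun setT (fun e : R => ((`|b| - b) * `|e|)%:E : \bar R).
  exact/measurable_EFinP.
have : (\int[Exp]_e (((k * e + s) ^+ 2)%:E + ((`|b| - b) * `|e|)%:E) =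
    (k ^+ 2 * 2 + `|b| * 1 + s ^+ 2)%:E)%E.
  rewrite -hE; apply: eq_integral_exp_law.
  - exact: emeasurable_funD.
  - exact/measurable_EFinP.
  - by move=> e; rewrite adde_ge0.
  - by move=> e; rewrite lee_fin; exact: h0.
  - by move=> e e0; rewrite -EFinD (ger0_norm e0) /b; congr EFin; ring.
rewrite ge0_integralD// gE.
case: (\int[Exp]_x _)%E => [r| |]//; rewrite -EFinD => -[h]; congr EFin.
by rewrite -[r](addrK ((`|b| - b) * 1)) h /b; ring.
Qed.

Lemma exp_law_set1 (x : R) : Exp [set x] = 0%E.
Proof.
rewrite -(@setIT _ [set x]) -integral_indic// integral_exp_law//; last first.
  exact/measurable_EFinP/measurable_indic.
rewrite -(@integral_setD1 _ _ x)//=; last 2 first.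
- exact: measurableD.
- by apply: measurable_funTS; apply: emeasurable_funM;
    [exact/measurable_EFinP/measurable_indic|meas].
by apply: integral0_eq => y [_ /= yx]; rewrite indicE memNset// mul0e.
Qed.

End exp_combination.

Section iterated_exp.
Context {R : realType}.
Local Notation Exp := (@exp_law R).

Lemma iproS_set d (T : measurableType d) (P : probability T R) n
    (A : set (n.+1.-tuple T)) : measurable A ->
  (ipro P n.+1 A = \int[P]_x ipro P n [set t : n.-tuple T | A [tuple of x :: t]])%E.
Proof.
move=> mA; rewrite [LHS]pushpE.
transitivity (\int[P]_x ipro P n (xsection (@tcons d T n @^-1` A) x))%E => //.
apply: eq_integral => x _; congr (ipro P n _); apply/seteqP; split => t; rewrite /xsection/= inE//.
Qed.

Lemma mean_ge0_iproS d (T : measurableType d) (P : probability T R) n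
    (f : n.+1.-tuple T -> R) (g : T -> R) (r : R) :
  measurable_fun setT f ->
  (forall x, mean_ge0 (ipro P n) (fun t : n.-tuple T => f [tuple of x :: t]) (g x)) ->
  mean_ge0 P g r -> mean_ge0 (ipro P n.+1) f r.
Proof.
move=> mf fg [mg _ gr].
have f0 t : 0 <= f t by case/tupleP: t => x t; have [_ + _] := fg x; exact.
split => //; rewrite ge0_integral_iproS//; last exact/measurable_EFinP.
by rewrite -gr; apply: eq_integral => x _; have [] := fg x.
Qed.

Lemma dot_mean_sq n (a : n.-tuple R) (r : R) :
  mean_ge0 (ipro Exp n) (fun e => (dot a e - r) ^+ 2)
    (\sum_(i < n) tnth a i ^+ 2 + (\sum_(i < n) tnth a i - r) ^+ 2).
Proof.
elim/tcons_ind: n / a r => [|n k a IH] r.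
  rewrite !big_ord0 add0r; split => //.
  - apply: measurable_funX; apply: measurable_funB => //.
    exact: measurable_dot.
  - by move=> e; exact: sqr_ge0.
  - rewrite ge0_integral_ipro0 ?dot0//.
    apply/measurable_EFinP/measurable_funX/measurable_funB => //.
    exact: measurable_dot.
rewrite (sum_tcons (fun x => x ^+ 2)) (sum_tcons id).
pose S := \sum_(i < n) tnth a i.
apply: (mean_ge0_iproS (g := fun x => \sum_(i < n) tnth a i ^+ 2 +
    (k * x + (S - r)) ^+ 2)).
- apply: measurable_funX; apply: measurable_funB => //.
  exact: measurable_dot.
- move=> x; have := IH (r - k * x).
  rewrite -/S (_ : S - (r - k * x) = k * x + (S - r)); last by ring.
  apply: eq_mean_ge0 => e; rewrite dotS; congr (_ ^+ 2); ring.
- rewrite -/S [X in mean_ge0 _ _ X](_ : _ = \sum_(i < n) tnth a i ^+ 2 +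
    (k ^+ 2 + (k + (S - r)) ^+ 2)); last by ring.
  apply: mean_ge0D; last exact: exp_law_mean_sq.
  by apply: (mean_ge0_cst Exp); apply: sumr_ge0 => i _; exact: sqr_ge0.
Qed.

Lemma measurable_dot_preimage n (a : n.-tuple R) (B : set R) : measurable B ->
  measurable [set e | B (dot a e)].
Proof.
by move=> mB; rewrite -[X in measurable X]setTI; exact: (measurable_dot a).
Qed.

(** Conditionally on the first coordinate: if another coefficient is nonzero, the induction
    hypothesis applies to every fibre; otherwise the sum is [k] times a single exponential. *)
Lemma dot_atomless n (a : n.-tuple R) (x : R) :
  (exists i, tnth a i != 0) -> ipro Exp n [set e | dot a e = x] = 0%E.
Proof.
elim/tcons_ind: n / a x => [x [[]]//|n k a IH x [i ai]].
rewrite iproS_set; last exact: (measurable_dot_preimage _ (measurable_set1 x)).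
have [[j aj]|a0] := pselect (exists j, tnth a j != 0).
  apply: integral0_eq => e _.
  rewrite -(IH (x - k * e)); last by exists j.
  congr (ipro Exp n _); apply/seteqP; split => t /=; rewrite dotS.
    by move=> <-; rewrite addrAC subrr add0r.
  by move=> ->; rewrite addrC subrK.
have da t : dot a t = 0.
  rewrite /dot big1// => j _; have [->|aj] := eqVneq (tnth a j) 0; first by rewrite mul0r.
  by case: a0; exists j.
have k0 : k != 0.
  case: (unliftP ord0 i) ai => [j ->|->]; last by rewrite tnth0.
  by rewrite tnthS => aj; case: a0; exists j.
rewrite -(exp_law_set1 (x / k)) -(@setIT _ [set x / k]) -integral_indic//.
apply: eq_integral => e _; rewrite indicE.
have [->|ex] := eqVneq e (x / k).
  rewrite mem_set//= (_ : [set _ | _] = setT) ?probability_setT//.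
  by apply/seteqP; split => // t _ /=; rewrite dotS da addr0 mulrC divfK.
rewrite memNset/=; last exact/eqP.
rewrite (_ : [set _ | _] = set0) ?measure0//.
apply/seteqP; split => // t /=; rewrite dotS da addr0 => kx.
by move/eqP: ex; apply; rewrite -kx mulrC mulKf.
Qed.

Definition dot_tail n (a : n.-tuple R) (x : R) : \bar R :=
  ipro Exp n [set e | x < dot a e].

Lemma dot_tailS n k (a : n.-tuple R) x :
  dot_tail [tuple of k :: a] x = (\int[Exp]_e dot_tail a (x - k * e)%R)%E.
Proof.
rewrite /dot_tail iproS_set; last first.
  have := measurable_dot_preimage [tuple of k :: a] (measurable_itv `]x, +oo[).
  by congr measurable; apply/seteqP; split => t /=; rewrite in_itv/= andbT.
apply: eq_integral => e _; congr (ipro Exp n _).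
by apply/seteqP; split => t /=; rewrite dotS ltrBlDl.
Qed.

(** The tail of the empty sum is the indicator of the negative half line, which is log-concave; each
    further exponential is one convolution. *)
Lemma dot_tail_logconcave n (a : n.-tuple R) :
  measurable_fun setT (dot_tail a) /\ logconcave_translates (dot_tail a).
Proof.
have ge0 m (b : m.-tuple R) x : (0 <= dot_tail b x)%E by exact: measure_ge0.
elim/tcons_ind: n / a => [|n k a [mF lcF]].
  have E x : dot_tail [tuple] x = (\1_(`]-oo, 0[%classic) x)%:E :> \bar R.
    rewrite /dot_tail /= diracE indicE; congr ((_ : bool)%:R%:E).
    by apply/idP/idP; rewrite !inE/= dot0 in_itv.
  split.
    rewrite (_ : dot_tail _ = EFin \o \1_(`]-oo, 0[%classic)); last exact/funext.
    exact/measurable_EFinP/measurable_indic.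
  move=> x y d xy d0; rewrite !E -!EFinM lee_fin !indicE !mem_setE !in_itv/=.
  have [yd|_] := ltP (y + d) 0; last by rewrite mulr0 mulr_ge0// ler0n.
  have -> : x + d < 0 by apply: (le_lt_trans _ yd); rewrite lerD2r.
  have -> : y < 0 by apply: (le_lt_trans _ yd); rewrite lerDl.
  by rewrite !mulr1 lern1 leq_b1.
have -> : dot_tail [tuple of k :: a] = (fun x => \int[Exp]_e dot_tail a (x - k * e)%R)%E.
  by apply/funext => x; exact: dot_tailS.
split; last exact: logconcave_translates_exp.
have mf : measurable_fun setT (fun z : R * R => dot_tail a (z.1 - k * z.2)).
  by apply: (measurableT_comp mF); meas.
exact: (@measurable_fun_fubini_tonelli_F _ _ _ _ _ Exp _ mf).
Qed.

(** This is [tail_lower_bound] for the law of [dot a e - r], whose mean is [\sum_i a_i - r] and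
    whose variance is [\sum_i a_i ^+ 2], for coefficients of any signs. *)
Lemma exp_combination_tail n (a : n.-tuple R) (r c b : R) :
  (exists i, tnth a i != 0) -> 0 <= c <= 1 -> 0 < b ->
  r <= \sum_(i < n) tnth a i ->
  c * (b / 6 + (\sum_(i < n) tnth a i ^+ 2) / (2 * b)) <= \sum_(i < n) tnth a i - r ->
  ((expR (- 1 + c / 2))%:E <= ipro Exp n [set e | (r < dot a e)%R])%E.
Proof.
move=> a0 c01 b0 ra ca.
have mL : measurable_fun setT (fun e : n.-tuple R => dot a e - r).
  by apply: measurable_funB => //; exact: measurable_dot.
pose Q := pushp (ipro Exp n) mL.
have QE x : (tail Q x)%:E = dot_tail a (x + r).
  rewrite -tailE [LHS]pushpE; congr (ipro Exp n _).
  by apply/seteqP; split => e /=; rewrite in_itv/= andbT ltrBrDr.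
have -> : ipro Exp n [set e | (r < dot a e)%R] = (tail Q 0)%:E by rewrite QE add0r.
rewrite lee_fin; apply: (@tail_lower_bound _ _ _ _ (\sum_(i < n) tnth a i - r)
    (\sum_(i < n) tnth a i ^+ 2) _ _ c b) => //.
- move=> x; rewrite [LHS]pushpE -(dot_atomless (x + r) a0); congr (ipro Exp n _).
  by apply/seteqP; split => e /=; [move=> <-; rewrite subrK|move=> ->; rewrite addrK].
- move=> x y d xy d0; rewrite -lee_fin !EFinM !QE ![_ + d + r]addrAC.
  by apply: (dot_tail_logconcave a).2 => //; rewrite lerD2r.
- move=> s; rewrite -addrA -opprD.
  have [mf f0 fE] := dot_mean_sq a (r + s).
  split; [by meas|by move=> x; exact: sqr_ge0|].
  rewrite -fE ge0_integral_pushp//; last 2 first.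
  - by meas.
  - by move=> x; rewrite lee_fin sqr_ge0.
  by apply: eq_integral => e _; rewrite opprD addrA.
- by rewrite subr_ge0.
Qed.

End iterated_exp.

(** * Numerical bounds on the exponential *)

Section numeric.
Context {R : realType}.

Lemma expR_ge_quadratic (y : R) : 0 <= y -> 1 + y + y ^+ 2 / 2 <= expR y.
Proof.
move=> y0.
have -> : 1 + y + y ^+ 2 / 2 = series (exp_coeff y) 3.
  by rewrite /series/= !big_nat_recr//= big_nil /exp_coeff/= add0r expr0 expr1 !divr1.
apply: nondecreasing_cvgn_le; last exact: is_cvg_series_exp_coeff.
by apply: nondecreasing_series => n _ _; exact: exp_coeff_ge0.
Qed.

(** Just enough for the end of [gauss_quadratic_le], which needs [(7 / 16) / 1.195 = 0.36610...],
    while [67 / 183 = 0.36612...]. It follows from [exp (- 1 / 128) >= 127 / 128] by seven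
    squarings, rounded down each time. *)
Lemma expRN1_ge : 67 / 183 <= expR (-1 : R).
Proof.
have step (a b u : R) : 0 <= a -> b <= a ^+ 2 -> a <= u -> b <= u ^+ 2.
  by move=> a0 ba au; rewrite (le_trans ba)// lerXn2r ?nnegrE// (le_trans a0).
have s0 : 127 / 128 <= expR (- 128^-1 : R).
  by apply: (le_trans _ (expR_ge1Dx _)); lra.
have -> : expR (-1 : R) = expR (- 128^-1) ^+ 2 ^+ 2 ^+ 2 ^+ 2 ^+ 2 ^+ 2 ^+ 2.
  by rewrite -!exprM -expRM_natl; congr expR; field.
move: (expR _) s0 => u s0.
have {}s0 : 253 / 257 <= u ^+ 2 by apply: (step (127 / 128)) s0; lra.
have {}s0 : 251 / 259 <= u ^+ 2 ^+ 2 by apply: (step (253 / 257)) s0; lra.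
have {}s0 : 247 / 263 <= u ^+ 2 ^+ 2 ^+ 2 by apply: (step (251 / 259)) s0; lra.
have {}s0 : 441 / 500 <= u ^+ 2 ^+ 2 ^+ 2 ^+ 2 by apply: (step (247 / 263)) s0; lra.
have {}s0 : 7779 / 10000 <= u ^+ 2 ^+ 2 ^+ 2 ^+ 2 ^+ 2 by apply: (step (441 / 500)) s0; lra.
have {}s0 : 6051 / 10000 <= u ^+ 2 ^+ 2 ^+ 2 ^+ 2 ^+ 2 ^+ 2 by apply: (step (7779 / 10000)) s0; lra.
by apply: (step (6051 / 10000)) s0; lra.
Qed.

(* The bound of [exp_combination_tail] at [b = 7 / 2] and [c = min(1, 0.865 x)]. *)
Lemma tail_exponent_bound (x : R) : 0 <= x -> exists2 c : R,
  0 <= c <= 1 & c * (7 / 12 + 4 / 7) <= x /\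
  1 + (78 / 100) * x ^+ 2 - (26 / 100) * x ^+ 4 <= expR (c / 2).
Proof.
move=> x0; have [x1|x1] := leP ((865 / 1000) * x) 1.
  exists ((865 / 1000) * x); first by rewrite x1 andbT; lra.
  split; first by lra.
  apply: le_trans (expR_ge_quadratic _); last by lra.
  have -> : x ^+ 4 = x * x ^+ 3 by rewrite exprS.
  (* As [c / 2 = 0.4325 x], this is the quadratic minorant of [exp] minus the target, divided by
     [x], with one coefficient rounded. The cubic is smallest near [15 / 16], hence the double root
     in [h1]. *)
  have h : 0 <= (4325 / 10000) - (6865 / 10000) * x + (26 / 100) * x ^+ 3.
    have h1 : 0 <= (x - 15/16) ^+ 2 * (x + 15/8).
      by rewrite mulr_ge0 ?sqr_ge0//; lra.
    by nra.
  by have := mulr_ge0 x0 h; nra.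
exists 1; first by rewrite lexx ler01.
split; first by lra.
apply: le_trans (expR_ge_quadratic _); last by lra.
(* [u = 3 / 2] maximises [0.78 u - 0.26 u ^+ 2], and the maximum 0.585 is below [1 / 2 + 1 / 8]. *)
have := sqr_ge0 (x ^+ 2 - 3 / 2).
have -> : x ^+ 4 = (x ^+ 2) ^+ 2 by rewrite -exprM.
by move: (x ^+ 2) => u; nra.
Qed.

End numeric.

Section measurable_comparison.
Context d (T : measurableType d) (R : realType).

Lemma measurable_set_le (f g : T -> R) : measurable_fun setT f ->
  measurable_fun setT g -> measurable [set x | f x <= g x].
Proof.
move=> mf mg; have := measurable_fun_ler mf mg => /(_ measurableT [set true] I).
by rewrite setTI.
Qed.

Lemma measurable_set_lt (f g : T -> R) : measurable_fun setT f ->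
  measurable_fun setT g -> measurable [set x | f x < g x].
Proof.
move=> mf mg.
have := measurable_fun_ltr mf mg => /(_ measurableT [set true] I).
by rewrite setTI.
Qed.

End measurable_comparison.

(** * Moments of weighted sums of cosines *)

Section clamped_cosines.
Context {R : realType}.
Local Notation Cos := (@cos2_law R).

(** Removes odd powers of the cosine without signed integrals: by symmetry both summands have the
    same mean, while their sum is even. *)
Lemma cos2_symmetrize (h : R -> \bar R) (r : \bar R) : measurable_fun setT h ->
  (forall x, 0 <= h x)%E ->
  (\int[Cos]_c (h (clamp1 c) + h (- clamp1 c)%R) =
   \int[Cos]_c h (clamp1 c) + \int[Cos]_c h (clamp1 c))%E.
Proof.
move=> mh h0.
have mhN : measurable_fun setT (fun c : R => h (- c)).
  by apply: (measurableT_comp mh); meas.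
rewrite ge0_integralD//; last 2 first.
- exact: (measurableT_comp mh measurable_clamp1).
- exact: (measurableT_comp mhN measurable_clamp1).
congr (_ + _)%E; rewrite (integral_cos2_clamp1 mh h0).
rewrite -(integral_cos2_sym mh h0).
exact: (integral_cos2_clamp1 (h := fun c => h (- c))).
Qed.

Lemma cos2_mean_clamp_sq : mean_ge0 Cos (fun c => clamp1 c ^+ 2) 2^-1.
Proof.
split => [|x|]; [|exact: sqr_ge0|].
  by apply: measurable_funX; exact: measurable_clamp1.
rewrite (integral_cos2_clamp1 (h := fun c => (c ^+ 2)%:E)).
- exact: cos2_moment2.
- by meas.
- by move=> x; rewrite lee_fin sqr_ge0.
Qed.

Lemma double_inj (x : \bar R) (r : R) : (0 <= x -> x + x = (2 * r)%:E -> x = r%:E)%E.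
Proof.
by case: x => [x| |]// _; rewrite -EFinD => -[h]; congr EFin; lra.
Qed.

Lemma double_le (x : \bar R) (r : R) : (0 <= x -> x + x <= (2 * r)%:E -> x <= r%:E)%E.
Proof.
by case: x => [x| |]// _; rewrite -EFinD !lee_fin => h; lra.
Qed.

Lemma cos2_mean_sq (k s : R) :
  mean_ge0 Cos (fun c => (k * clamp1 c + s) ^+ 2) (k ^+ 2 / 2 + s ^+ 2).
Proof.
split => [|x|]; [|exact: sqr_ge0|].
  by apply: (measurableT_comp (f := fun c => (k * c + s) ^+ 2) _ measurable_clamp1); meas.
apply: double_inj; first by apply: integral_ge0 => x _; rewrite lee_fin sqr_ge0.
rewrite -(@cos2_symmetrize (fun c => ((k * c + s) ^+ 2)%:E) 0%E).
- have [_ _ ] : mean_ge0 Cos (fun c => 2 * k ^+ 2 * clamp1 c ^+ 2 + 2 * s ^+ 2)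
    (2 * k ^+ 2 * 2^-1 + 2 * s ^+ 2).
    apply: mean_ge0D; last by apply: (mean_ge0_cst Cos); rewrite mulr_ge0 ?sqr_ge0.
    by apply: mean_ge0Z; [rewrite mulr_ge0 ?sqr_ge0|exact: cos2_mean_clamp_sq].
  rewrite (_ : 2 * k ^+ 2 / 2 + _ = 2 * (k ^+ 2 / 2 + s ^+ 2)); last by field.
  move=> <-; apply: eq_integral => x _.
  by rewrite -EFinD; congr EFin; ring.
- by meas.
- by move=> x; rewrite lee_fin sqr_ge0.
Qed.

(** The inductive step of [cos_sum_mean_quartic], with [v] the sum of the squares of the other
    coefficients. Bounding [c ^+ 4] by [c ^+ 2], of mean 1/2, gives [k ^+ 4 / 2], within the
    [3 / 4 * k ^+ 4] available on the right. There [3 / 4 * V ^+ 2] is the fourth moment of a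
    centered Gaussian of variance [V / 2]. *)
Lemma cos2_mean_quartic (k s v : R) : 0 <= v ->
  (\int[Cos]_c ((k * clamp1 c + s) ^+ 4 + 3 * (k * clamp1 c + s) ^+ 2 * v +
     3 / 4 * v ^+ 2)%:E <=
   (s ^+ 4 + 3 * s ^+ 2 * (v + k ^+ 2) + 3 / 4 * (v + k ^+ 2) ^+ 2)%:E)%E.
Proof.
move=> v0.
pose h c := (k * c + s) ^+ 4 + 3 * (k * c + s) ^+ 2 * v + 3 / 4 * v ^+ 2.
have h0 c : 0 <= h c.
  rewrite /h; apply: addr_ge0; first apply: addr_ge0.
  - exact: exprn_even_ge0.
  - by apply: mulr_ge0 => //; apply: mulr_ge0 => //; exact: sqr_ge0.
  - by apply: mulr_ge0; [rewrite divr_ge0|exact: sqr_ge0].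
apply: double_le; first by apply: integral_ge0 => x _; rewrite lee_fin; exact: h0.
rewrite -(@cos2_symmetrize (fun c => (h c)%:E) 0%E); last 2 first.
- by rewrite /h; meas.
- by move=> x; rewrite lee_fin.
pose b := 2 * k ^+ 4 + 12 * (k ^+ 2 * s ^+ 2) + 6 * v * k ^+ 2.
pose a := 2 * s ^+ 4 + 6 * s ^+ 2 * v + 3 / 2 * v ^+ 2.
have b0 : 0 <= b.
  rewrite /b; apply: addr_ge0; first apply: addr_ge0.
  - by apply: mulr_ge0 => //; exact: exprn_even_ge0.
  - by apply: mulr_ge0 => //; apply: mulr_ge0; exact: sqr_ge0.
  - by apply: mulr_ge0; [rewrite mulr_ge0|exact: sqr_ge0].
have a0 : 0 <= a.
  rewrite /a; apply: addr_ge0; first apply: addr_ge0.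
  - by apply: mulr_ge0 => //; exact: exprn_even_ge0.
  - by apply: mulr_ge0 => //; apply: mulr_ge0 => //; exact: sqr_ge0.
  - by apply: mulr_ge0; [rewrite divr_ge0|exact: sqr_ge0].
have [mg g0 gE] : mean_ge0 Cos (fun c => b * clamp1 c ^+ 2 + a) (b * 2^-1 + a).
  apply: mean_ge0D; last exact: (mean_ge0_cst Cos a0).
  by apply: mean_ge0Z => //; exact: cos2_mean_clamp_sq.
apply: (@le_trans _ _ (b / 2 + a)%:E).
  rewrite -gE; apply: ge0_le_integral => //.
  - by move=> x _; rewrite adde_ge0 ?lee_fin ?h0.
  - have mH : measurable_fun setT (fun c : R => (h c)%:E + (h (- c)%R)%:E)%E.
      have mh : measurable_fun setT h by rewrite /h; meas.
      apply: emeasurable_funD; apply/measurable_EFinP => //.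
      by apply: (measurableT_comp mh); meas.
    exact: (measurableT_comp mH measurable_clamp1).
  - exact/measurable_EFinP.
  - move=> x _; rewrite -EFinD lee_fin.
    have /andP[x1 x2] := clamp1_itv x.
    move: (clamp1 x) x1 x2 => c c1 c2.
    have hc : k ^+ 4 * (c ^+ 2 * (1 - c ^+ 2)) >= 0.
      rewrite mulr_ge0 ?exprn_even_ge0// mulr_ge0 ?sqr_ge0//; nra.
    rewrite -subr_ge0 [leRHS](_ : _ = 2 * (k ^+ 4 * (c ^+ 2 * (1 - c ^+ 2)))).
      by rewrite mulr_ge0.
    by rewrite /h /a /b; field.
rewrite lee_fin -subr_ge0 [leRHS](_ : _ = k ^+ 4 / 2); last by rewrite /a /b; field.
by rewrite divr_ge0 ?exprn_even_ge0.
Qed.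

Definition cos_sum n (l c : n.-tuple R) : R := \sum_(i < n) tnth l i * clamp1 (tnth c i).

Lemma cos_sumS n k (l : n.-tuple R) x (c : n.-tuple R) :
  cos_sum [tuple of k :: l] (tcons (x, c)) = k * clamp1 x + cos_sum l c.
Proof.
rewrite /cos_sum big_ord_recl !tnth0; congr (_ + _).
by apply: eq_bigr => i _; rewrite !tnthS.
Qed.

Lemma measurable_cos_sum n (l : n.-tuple R) : measurable_fun setT (cos_sum l).
Proof.
apply: measurable_sum => i; apply: measurable_funM => //.
exact: (measurableT_comp measurable_clamp1 (measurable_tnth i)).
Qed.

Local Notation sqn l := (\sum_(i < _) tnth l i ^+ 2).

Lemma cos_sum_mean_sq n (l : n.-tuple R) (s : R) :
  mean_ge0 (ipro Cos n) (fun c => (cos_sum l c + s) ^+ 2) (sqn l / 2 + s ^+ 2).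
Proof.
have mf m (a : m.-tuple R) t : measurable_fun setT (fun c => (cos_sum a c + t) ^+ 2).
  by apply: measurable_funX; apply: measurable_funD => //; exact: measurable_cos_sum.
elim/tcons_ind: n / l s => [|n k l IH] s.
  split => [|c|]; [exact: mf|exact: sqr_ge0|].
  rewrite ge0_integral_ipro0; last by apply/measurable_EFinP; exact: mf.
  by rewrite /cos_sum !big_ord0 mul0r !add0r.
rewrite (sum_tcons (fun x => x ^+ 2)).
apply: (mean_ge0_iproS (g := fun x => sqn l / 2 + (k * clamp1 x + s) ^+ 2)) => //.
- move=> x; apply: eq_mean_ge0 (IH (k * clamp1 x + s)) => c.
  by rewrite cos_sumS; congr (_ ^+ 2); ring.
- rewrite [X in mean_ge0 _ _ X](_ : _ = sqn l / 2 + (k ^+ 2 / 2 + s ^+ 2)); last by ring.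
  apply: mean_ge0D; last exact: cos2_mean_sq.
  apply: (mean_ge0_cst Cos); rewrite divr_ge0//; apply: sumr_ge0 => i _; exact: sqr_ge0.
Qed.

Lemma cos_sum_mean_quartic n (l : n.-tuple R) (s : R) :
  (\int[ipro Cos n]_c ((cos_sum l c + s) ^+ 4)%:E <=
   (s ^+ 4 + 3 * s ^+ 2 * sqn l + 3 / 4 * (sqn l) ^+ 2)%:E)%E.
Proof.
have mf m (a : m.-tuple R) t : measurable_fun setT (fun c => ((cos_sum a c + t) ^+ 4)%:E).
  apply/measurable_EFinP; apply: measurable_funX; apply: measurable_funD => //.
  exact: measurable_cos_sum.
have f0 m (a : m.-tuple R) t c : (0 <= ((cos_sum a c + t) ^+ 4)%:E)%E.
  by rewrite lee_fin exprn_even_ge0.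
elim/tcons_ind: n / l s => [|n k l IH] s.
  by rewrite ge0_integral_ipro0// /cos_sum !big_ord0 lee_fin; lra.
rewrite (sum_tcons (fun x => x ^+ 2)) ge0_integral_iproS//.
rewrite [k ^+ 2 + _]addrC; apply: le_trans (cos2_mean_quartic k s _); last first.
  by apply: sumr_ge0 => i _; exact: sqr_ge0.
apply: ge0_le_integral => //.
- by move=> x _; exact: integral_ge0.
- exact: (@measurable_integral_tcons _ _ _ Cos n (fun c => ((cos_sum [tuple of k :: l] c + s) ^+ 4)%:E)
    (mf _ _ _) (f0 _ _ _)).
- have mH : measurable_fun setT (fun c : R => ((k * c + s) ^+ 4 +
      3 * (k * c + s) ^+ 2 * sqn l + 3 / 4 * (sqn l) ^+ 2)%:E : \bar R) by meas.
  exact: (measurableT_comp mH measurable_clamp1).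
- move=> x _; apply: le_trans (IH (k * clamp1 x + s)).
  rewrite le_eqVlt; apply/orP; left; apply/eqP.
  by apply: eq_integral => c _; rewrite cos_sumS; congr ((_ ^+ 4)%:E); ring.
Qed.

End clamped_cosines.

(** * Gaussian quadratic forms below their mean *)

Section gaussian_quadratic_form.
Context {R : realType}.
Local Notation gamma := (@gauss1 R).
Local Notation Exp := (@exp_law R).
Local Notation Cos := (@cos2_law R).

Lemma measurable_section_prob d d' (X : measurableType d) (Y : measurableType d')
    (P : probability Y R) (A : set (X * Y)) : measurable A ->
  measurable_fun setT (fun x => P [set y | A (x, y)]).
Proof.
move=> mA; have := @measurable_fun_xsection _ _ _ _ _ P A mA.
by apply: eq_measurable_fun => x _; congr (P _); apply/seteqP; split => y;
  rewrite /xsection/= inE.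
Qed.

Definition sq_sum n (l g : n.-tuple R) : R := \sum_(i < n) tnth l i * tnth g i ^+ 2.

Lemma sq_sumS n k (l : n.-tuple R) x (g : n.-tuple R) :
  sq_sum [tuple of k :: l] (tcons (x, g)) = k * x ^+ 2 + sq_sum l g.
Proof.
rewrite /sq_sum big_ord_recl !tnth0; congr (_ + _).
by apply: eq_bigr => i _; rewrite !tnthS.
Qed.

Lemma measurable_sq_sum n (l : n.-tuple R) : measurable_fun setT (sq_sum l).
Proof.
apply: measurable_sum => i; apply: measurable_funM => //.
by apply: measurable_funX; exact: measurable_tnth.
Qed.

Definition sq_cdf n (l : n.-tuple R) (t : R) : \bar R :=
  ipro gamma n [set g | sq_sum l g <= t].

Lemma measurable_sq_cdf n (l : n.-tuple R) : measurable_fun setT (sq_cdf l).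
Proof.
apply: (@measurable_section_prob _ _ _ _ _ [set tg : R * n.-tuple R | sq_sum l tg.2 <= tg.1]).
apply: measurable_set_le => //.
exact: (measurableT_comp (measurable_sq_sum l) (@measurable_snd _ _ _ _)).
Qed.

Lemma sq_cdf_ge0 n (l : n.-tuple R) t : (0 <= sq_cdf l t)%E.
Proof. exact: measure_ge0. Qed.

Lemma sq_cdfS n k (l : n.-tuple R) t :
  sq_cdf [tuple of k :: l] t = (\int[gamma]_x sq_cdf l (t - k * x ^+ 2)%R)%E.
Proof.
rewrite /sq_cdf iproS_set; last first.
  by apply: measurable_set_le => //; exact: measurable_sq_sum.
apply: eq_integral => x _; congr (ipro gamma n _).
by apply/seteqP; split => g /=; rewrite sq_sumS lerBrDl.
Qed.

(** Given the cosines [c], the two copies of the quadratic form are sums of exponentials with these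
    coefficients, for [s = 1] and [s = -1]. *)
Definition tilt n (s : R) (l c : n.-tuple R) : n.-tuple R :=
  [tuple tnth l i * (1 + s * clamp1 (tnth c i)) | i < n].

Lemma tilt_cons n s k (l : n.-tuple R) x (c : n.-tuple R) :
  tilt s [tuple of k :: l] [tuple of x :: c] =
  [tuple of k * (1 + s * clamp1 x) :: tilt s l c].
Proof.
apply: eq_from_tnth => i; case: (unliftP ord0 i) => [j ->|->].
  by rewrite tnthS !tnth_mktuple !tnthS.
by rewrite tnth_mktuple !tnth0.
Qed.

Lemma measurable_dot_tilt n s (l : n.-tuple R) :
  measurable_fun setT (fun ce : n.-tuple R * n.-tuple R => dot (tilt s l ce.1) ce.2).
Proof.
apply: measurable_sum => i; under eq_fun do rewrite tnth_mktuple.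
apply: measurable_funM; last first.
  exact: (measurableT_comp (measurable_tnth i) (@measurable_snd _ _ _ _)).
apply: measurable_funM => //; apply: measurable_funD => //; apply: measurable_funM => //.
apply: (measurableT_comp measurable_clamp1).
exact: (measurableT_comp (measurable_tnth i) (@measurable_fst _ _ _ _)).
Qed.

Definition tilt_cdf n (l : n.-tuple R) (z : n.-tuple R * (R * R)) : \bar R :=
  ipro Exp n [set e | dot (tilt 1 l z.1) e <= z.2.1 /\ dot (tilt (-1) l z.1) e <= z.2.2].

Lemma tilt_cdf_ge0 n (l : n.-tuple R) z : (0 <= tilt_cdf l z)%E.
Proof. exact: measure_ge0. Qed.

Lemma measurable_tilt_cdf n (l : n.-tuple R) : measurable_fun setT (tilt_cdf l).
Proof.
apply: (@measurable_section_prob _ _ _ _ _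
  [set ze : (n.-tuple R * (R * R)) * n.-tuple R |
    dot (tilt 1 l ze.1.1) ze.2 <= ze.1.2.1 /\ dot (tilt (-1) l ze.1.1) ze.2 <= ze.1.2.2]).
have mz : measurable_fun setT
    (fun ze : (n.-tuple R * (R * R)) * n.-tuple R => (ze.1.1, ze.2)).
  apply: measurable_fun_pair => //.
  by apply: measurableT_comp => //; exact: measurable_fst.
have m2 : measurable_fun setT
    (fun ze : (n.-tuple R * (R * R)) * n.-tuple R => ze.1.2).
  by apply: measurableT_comp => //; exact: measurable_snd.
apply: measurableI; apply: measurable_set_le.
- exact: (measurableT_comp (measurable_dot_tilt 1 l) mz).
- exact: (measurableT_comp (@measurable_fst _ _ _ _) m2).
- exact: (measurableT_comp (measurable_dot_tilt (-1) l) mz).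
- exact: (measurableT_comp (@measurable_snd _ _ _ _) m2).
Qed.

Lemma tilt_cdfS n k (l : n.-tuple R) x (c : n.-tuple R) (t1 t2 : R) :
  tilt_cdf [tuple of k :: l] ([tuple of x :: c], (t1, t2)) =
  (\int[Exp]_e tilt_cdf l (c, (t1 - k * (e * (1 + clamp1 x)),
                               t2 - k * (e * (1 - clamp1 x))))%R)%E.
Proof.
rewrite /tilt_cdf iproS_set/=; last first.
  apply: measurableI; apply: measurable_set_le => //; exact: measurable_dot.
apply: eq_integral => e _; congr (ipro Exp n _).
rewrite !tilt_cons; apply/seteqP; split => g /=; rewrite !dotS !lerBrDl mul1r mulN1r.
  by rewrite [e * _]mulrC [e * (1 - _)]mulrC !mulrA.
by rewrite [e * _]mulrC [e * (1 - _)]mulrC !mulrA.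
Qed.

(* Two independent copies of the quadratic form in polar coordinates: the pair
   [(g_i ^+ 2, g'_i ^+ 2)] is [(e_i * (1 + c_i), e_i * (1 - c_i))]. *)
Lemma sq_cdf_tilt n (l : n.-tuple R) (t1 t2 : R) :
  (sq_cdf l t1 * sq_cdf l t2 = \int[ipro Cos n]_c tilt_cdf l (c, (t1, t2)))%E.
Proof.
have mT m (a : m.-tuple R) u v : measurable_fun setT (fun c => tilt_cdf a (c, (u, v))).
  exact: (measurableT_comp (measurable_tilt_cdf a) (measurable_pair2 (u, v))).
elim/tcons_ind: n / l t1 t2 => [|n k l IH] t1 t2.
  rewrite ge0_integral_ipro0// /sq_cdf /tilt_cdf/= !diracE.
  rewrite -EFinM -natrM mulnb; congr ((_ : bool)%:R%:E).
  by apply/andP/idP; rewrite !inE/= /sq_sum /dot !big_ord0.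
rewrite !sq_cdfS.
have mG (t : R) : measurable_fun setT (fun x : R => sq_cdf l (t - k * x ^+ 2)).
  by apply: (measurableT_comp (measurable_sq_cdf l)); meas.
pose F (z : R * R) : \bar R := (sq_cdf l (t1 - k * z.1) * sq_cdf l (t2 - k * z.2)%R)%E.
have mF : measurable_fun setT F.
  by apply: emeasurable_funM; apply: (measurableT_comp (measurable_sq_cdf l)); meas.
have F0 z : (0 <= F z)%E by rewrite mule_ge0// sq_cdf_ge0.
transitivity (\int[gamma]_x \int[gamma]_y F (x ^+ 2, y ^+ 2)%R)%E.
  rewrite -ge0_integralZr//; last by apply: integral_ge0 => x _; exact: sq_cdf_ge0.
  by apply: eq_integral => x _; rewrite -ge0_integralZl.
apply: (etrans (gauss_polar_clamp mF F0)).
rewrite ge0_integral_iproS//.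
apply: eq_integral => x _.
pose H (ec : R * n.-tuple R) : \bar R :=
  tilt_cdf l (ec.2, (t1 - k * (ec.1 * (1 + clamp1 x)), t2 - k * (ec.1 * (1 - clamp1 x)))).
have mH : measurable_fun setT H by apply: (measurableT_comp (measurable_tilt_cdf l)); meas.
have H0 z : (0 <= H z)%E by exact: tilt_cdf_ge0.
transitivity (\int[Exp]_e \int[ipro Cos n]_c H (e, c))%E.
  by apply: eq_integral => e _; exact: IH.
apply: (etrans (@fubini_tonelli _ _ _ _ _ Exp (ipro Cos n) H mH H0)).
by apply: eq_integral => c _; rewrite tilt_cdfS.
Qed.

Local Notation sqn l := (\sum_(i < _) tnth l i ^+ 2).

(** The sign of [cos_sum l c] selects the copy whose conditional mean is at least [t]; dropping the
    condition on the other copy leaves one minus a tail, which [exp_combination_tail] controls. The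
    quadratic and quartic terms stand on opposite sides, so that both sides are nonnegative and can
    be integrated. *)
Lemma tilt_cdf_le n (l c : n.-tuple R) (t := \sum_(i < n) tnth l i)
    (x := cos_sum l c / Num.sqrt (sqn l)) : (exists i, tnth l i != 0) ->
  (tilt_cdf l (c, (t, t)) + (expR (-1) * (1 + 78 / 100 * x ^+ 2))%:E <=
   (1 + expR (-1) * (26 / 100 * x ^+ 4))%:E)%E.
Proof.
move=> [i li].
have V0 : 0 < sqn l.
  rewrite (bigD1 i)//= ltr_pwDl ?exprn_even_gt0//.
  by apply: sumr_ge0 => j _; exact: sqr_ge0.
pose r := Num.sqrt (sqn l).
have r0 : 0 < r by rewrite sqrtr_gt0.
have r2 : r ^+ 2 = sqn l by rewrite sqr_sqrtr// ltW.
have main (s : R) : (s == 1) || (s == -1) -> 0 <= s * cos_sum l c ->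
    (tilt_cdf l (c, (t, t)) <= ipro Exp n [set e | (dot (tilt s l c) e <= t)%R])%E ->
  (tilt_cdf l (c, (t, t)) + (expR (-1) * (1 + 78 / 100 * x ^+ 2))%:E <=
   (1 + expR (-1) * (26 / 100 * x ^+ 4))%:E)%E.
  move=> s1 sc0 tle.
  have cE : cos_sum l c = x * r by rewrite /x -/r divfK// gt_eqF.
  have sx0 : 0 <= s * x by move: sc0; rewrite cE mulrA pmulr_lge0.
  have s2 : s ^+ 2 = 1 by case/orP: s1 => /eqP ->; rewrite ?sqrrN expr1n.
  have s4 : s ^+ 4 = 1 by rewrite -[X in _ ^+ X]/(2 * 2)%N exprM s2 expr1n.
  have x2 : x ^+ 2 = (s * x) ^+ 2 by rewrite [RHS]exprMn s2 mul1r.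
  have x4 : x ^+ 4 = (s * x) ^+ 4 by rewrite [RHS]exprMn s4 mul1r.
  have [k k01 [kx kE]] := tail_exponent_bound sx0.
  (* Since [|1 + s c_i| < 2], the squares of the tilted coefficients add up to at most [4 r ^+ 2].
     The minimum of [b / 6 + 4 r ^+ 2 / (2 b)] is at [b = sqrt 12 * r]; the nearby value [7 / 2 * r]
     gives [(7 / 12 + 4 / 7) r]. *)
  have b0 : 0 < 7 / 2 * r by rewrite mulr_gt0// divr_gt0.
  have tilt_sum : \sum_(j < n) tnth (tilt s l c) j - t = s * cos_sum l c.
    rewrite /t -sumrB /cos_sum mulr_sumr; apply: eq_bigr => j _.
    by rewrite tnth_mktuple; ring.
  have tilt_sqn : sqn (tilt s l c) <= 4 * sqn l.
    rewrite mulr_sumr; apply: ler_sum => j _; rewrite tnth_mktuple exprMn mulrC.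
    rewrite ler_wpM2r ?sqr_ge0//.
    have /andP[y1 y2] := clamp1_itv (tnth c j).
    by case/orP: s1 => /eqP ->; nra.
  have tilt_neq0 : exists j, tnth (tilt s l c) j != 0.
    exists i; rewrite tnth_mktuple mulf_neq0//.
    have /andP[y1 y2] := clamp1_itv (tnth c i).
    by rewrite gt_eqF//; case/orP: s1 => /eqP ->; lra.
  have := @exp_combination_tail _ _ (tilt s l c) t k (7 / 2 * r) tilt_neq0 k01 b0.
  rewrite -subr_ge0 tilt_sum => /(_ sc0) tail_ge.
  have {}tail_ge : ((expR (-1 + k / 2))%:E <= ipro Exp n [set e | (t < dot (tilt s l c) e)%R])%E.
    apply: tail_ge; rewrite cE mulrA.
    have -> : k * (7 / 2 * r / 6 + sqn (tilt s l c) / (2 * (7 / 2 * r))) =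
        k * (7 / 12 + 4 / 7) * r - k * (4 * r ^+ 2 - sqn (tilt s l c)) / (7 * r).
      by field; rewrite gt_eqF.
    have h1 : k * (7 / 12 + 4 / 7) * r <= s * x * r by rewrite ler_wpM2r// ltW.
    have h2 : 0 <= k * (4 * r ^+ 2 - sqn (tilt s l c)) / (7 * r).
      case/andP: k01 => k0 _.
      by rewrite divr_ge0 ?mulr_ge0 ?r2 ?subr_ge0// ltW.
    lra.
  have split1 : (ipro Exp n [set e | (dot (tilt s l c) e <= t)%R] +
      ipro Exp n [set e | (t < dot (tilt s l c) e)%R] = 1)%E.
    have m1 : measurable [set e | dot (tilt s l c) e <= t].
      by apply: measurable_set_le => //; exact: measurable_dot.
    have -> : [set e | t < dot (tilt s l c) e] = ~` [set e | dot (tilt s l c) e <= t].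
      by apply/seteqP; split => e /=; rewrite ltNge => /negP.
    rewrite probability_setC// addeC subeK//.
    by rewrite fin_num_measure.
  apply: (@le_trans _ _ (tilt_cdf l (c, (t, t)) + (expR (-1 + k / 2) + expR (-1) * (26 / 100 * x ^+ 4))%:E)%E).
    rewrite leeD2l// lee_fin expRD x2 x4 -mulrDr ler_wpM2l ?expR_ge0//; lra.
  rewrite [X in (_ <= X)%E]EFinD [X in (_ + X <= _)%E]EFinD addeA.
  apply: leeD => //; rewrite -split1; exact: leeD.
have sub s' : measurable [set e : n.-tuple R | dot (tilt s' l c) e <= t].
  by apply: measurable_set_le => //; exact: measurable_dot.
have [c0|c0] := leP 0 (cos_sum l c).
  apply: (main 1); rewrite ?eqxx ?mul1r//.
  apply: le_measure; rewrite ?inE//; first exact: measurableI (sub 1) (sub (-1)).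
  by move=> e [].
apply: (main (-1)); [by rewrite eqxx orbT|by rewrite mulN1r oppr_ge0 ltW|].
apply: le_measure; rewrite ?inE//; first exact: measurableI (sub 1) (sub (-1)).
by move=> e [].
Qed.

(** In [tilt_cdf_le] the variable [x] has second moment 1/2 and fourth moment at most 3/4, so the
    square of the probability is at most [1 - 1.195 * exp (-1)], just under [9 / 16]. *)
Theorem gauss_quadratic_le n (l : n.-tuple R) : (exists i, tnth l i != 0) ->
  (ipro gamma n [set g | (sq_sum l g <= \sum_(i < n) tnth l i)%R] <= (3 / 4)%:E)%E.
Proof.
move=> l0; set t := \sum_(i < n) tnth l i.
rewrite -/(sq_cdf l t).
have [i li] := l0.
have V0 : 0 < sqn l.
  rewrite (bigD1 i)//= ltr_pwDl ?exprn_even_gt0//.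
  by apply: sumr_ge0 => j _; exact: sqr_ge0.
pose r := Num.sqrt (sqn l).
have r0 : 0 < r by rewrite sqrtr_gt0.
have r2 : r ^+ 2 = sqn l by rewrite sqr_sqrtr// ltW.
have e0 : 0 <= expR (-1) :> R := expR_ge0 _.
pose x c := cos_sum l c / r.
have mx : measurable_fun setT x by apply: measurable_funM => //; exact: measurable_cos_sum.
have [mf f0 fE] : mean_ge0 (ipro Cos n) (fun c => expR (-1) * (1 + 78 / 100 * x c ^+ 2))
    (expR (-1) * (1 + 78 / 100 * 2^-1)).
  apply: mean_ge0Z => //; apply: mean_ge0D.
    exact: (mean_ge0_cst (ipro Cos n) ler01).
  apply: mean_ge0Z => //.
  have h := mean_ge0Z (_ : 0 <= r ^- 2) (cos_sum_mean_sq l 0).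
  rewrite (_ : 2^-1 = r ^- 2 * (sqn l / 2 + 0 ^+ 2)).
    apply: eq_mean_ge0 (h _); last by rewrite invr_ge0 sqr_ge0.
    by move=> c; rewrite addr0 /x exprMn exprVn mulrC.
  by rewrite -r2 expr0n addr0; field; rewrite gt_eqF.
have mt : measurable_fun setT (fun c : n.-tuple R => tilt_cdf l (c, (t, t))).
  exact: (measurableT_comp (measurable_tilt_cdf l) (measurable_pair2 (t, t))).
have x40 c : 0 <= expR (-1) * (26 / 100 * x c ^+ 4).
  by apply: mulr_ge0 => //; apply: mulr_ge0; [rewrite divr_ge0|exact: exprn_even_ge0].
have mx4 : measurable_fun setT (fun c : n.-tuple R => (expR (-1) * (26 / 100 * x c ^+ 4))%:E).
  by apply/measurable_EFinP; apply: measurable_funM => //; apply: measurable_funM => //;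
    exact: measurable_funX.
have key : (sq_cdf l t * sq_cdf l t + (expR (-1) * (1 + 78 / 100 * 2^-1))%:E <=
    (1 + expR (-1) * (26 / 100 * (3 / 4)))%:E)%E.
  rewrite sq_cdf_tilt -fE -ge0_integralD//; last 2 first.
  - by move=> c _; rewrite lee_fin.
  - exact/measurable_EFinP.
  apply: (@le_trans _ _ (\int[ipro Cos n]_c (1 + (expR (-1) * (26 / 100 * x c ^+ 4))%:E)%E)%E).
    apply: ge0_le_integral => //.
    - by move=> c _; rewrite adde_ge0 ?tilt_cdf_ge0 ?lee_fin.
    - by apply: emeasurable_funD => //; exact/measurable_EFinP.
    - exact: emeasurable_funD.
    - by move=> c _; exact: tilt_cdf_le.
  rewrite ge0_integralD//; last by move=> c _; rewrite lee_fin.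
  rewrite integral_cst//= probability_setT mule1 EFinD leeD2l//.
  have -> : (\int[ipro Cos n]_c (expR (-1) * (26 / 100 * x c ^+ 4))%:E =
      (expR (-1) * (26 / 100) * r ^- 4)%:E * \int[ipro Cos n]_c ((cos_sum l c + 0) ^+ 4)%:E)%E.
    rewrite -ge0_integralZl//; last 3 first.
    - apply/measurable_EFinP; apply: measurable_funX; apply: measurable_funD => //.
      exact: measurable_cos_sum.
    - by move=> c _; rewrite lee_fin exprn_even_ge0.
    - by rewrite lee_fin !mulr_ge0// invr_ge0 exprn_even_ge0.
    apply: eq_integral => c _; rewrite -EFinM addr0 /x exprMn exprVn; congr EFin; ring.
  apply: (@le_trans _ _ ((expR (-1) * (26 / 100) * r ^- 4)%:E * (3 / 4 * sqn l ^+ 2)%:E)%E).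
    rewrite lee_wpmul2l ?lee_fin ?mulr_ge0 ?invr_ge0 ?exprn_even_ge0//.
    apply: le_trans (cos_sum_mean_quartic l 0) _.
    by rewrite lee_fin !expr0n/= !(mulr0, mul0r, add0r).
  rewrite -EFinM lee_fin -r2 le_eqVlt; apply/orP; left; apply/eqP.
  by field; rewrite gt_eqF.
have := sq_cdf_ge0 l t; have E1 := @expRN1_ge R.
have : (sq_cdf l t <= 1)%E.
  by apply: probability_le1; apply: measurable_set_le => //; exact: measurable_sq_sum.
move: key; case: (sq_cdf l t) => [q| |]//.
rewrite -EFinM -EFinD !lee_fin => h q1 q0.
by nra.
Qed.

End gaussian_quadratic_form.

(** * Linear forms of independent Gaussians *)

Section gauss_rotation.
Context {R : realType}.
Local Notation mu := (@lebesgue_measure R).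
Local Notation gamma := (@gauss1 R).
Local Notation K := (normal_peak (1 : R)).

Lemma integral_gauss1_oppr (f : R -> \bar R) : measurable_fun setT f ->
  (forall x, 0 <= f x)%E -> (\int[gamma]_x f (- x)%R = \int[gamma]_x f x)%E.
Proof.
move=> mf f0.
have mfN : measurable_fun setT (fun x : R => f (- x)) by apply: (measurableT_comp mf); meas.
have K0 : 0 <= K by exact: normal_peak_ge0.
have mp : measurable_fun setT (fun x : R => (K * expR (- x ^+ 2 / 2))%:E : \bar R) by meas.
have p0 (x : R) : (0 <= (K * expR (- x ^+ 2 / 2))%:E)%E by rewrite lee_fin mulr_ge0// expR_ge0.
rewrite !gauss1E// [LHS]ge0_integral_fold; last 2 first.
- exact: emeasurable_funM.
- by move=> x; rewrite mule_ge0.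
rewrite [RHS]ge0_integral_fold; last 2 first.
- exact: emeasurable_funM.
- by move=> x; rewrite mule_ge0.
rewrite [LHS]addeC; apply: f_equal2; apply: eq_integral => x _.
  by rewrite opprK sqrrN.
by rewrite sqrrN.
Qed.

(* Completing the square. *)
Let integral_gauss1_sum_gt0 (a b : R) (f : R -> \bar R) : 0 < b ->
  measurable_fun setT f -> (forall x, 0 <= f x)%E ->
  (\int[gamma]_x \int[gamma]_y f (a * x + b * y)%R =
   \int[gamma]_z f (Num.sqrt (a ^+ 2 + b ^+ 2) * z)%R)%E.
Proof.
move=> b0 mf f0; pose c := Num.sqrt (a ^+ 2 + b ^+ 2).
have ab0 : 0 < a ^+ 2 + b ^+ 2 by rewrite ltr_wpDl ?sqr_ge0// exprn_gt0.
have c0 : 0 < c by rewrite sqrtr_gt0.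
have c2 : c ^+ 2 = a ^+ 2 + b ^+ 2 by rewrite sqr_sqrtr// ltW.
have bn0 : b != 0 by rewrite gt_eqF.
have cb0 : 0 < c / b by rewrite divr_gt0.
have K0 : 0 <= K by exact: normal_peak_ge0.
pose p (x : R) := K * expR (- x ^+ 2 / 2).
have p0 x : 0 <= p x by rewrite mulr_ge0// expR_ge0.
have mp : measurable_fun setT (fun x : R => (p x)%:E : \bar R) by rewrite /p; meas.
have mpf (g : R -> R) : measurable_fun setT g -> measurable_fun setT (fun x : R => (p (g x))%:E : \bar R).
  by move=> mg; exact: (measurableT_comp mp mg).
have mfab x : measurable_fun setT (fun y : R => f (a * x + b * y)).
  by apply: (measurableT_comp mf); meas.
(* The integrand after [y] is replaced by [z] with [c z = a x + b y]. For fixed [z], its last factor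
   is the density in [x] of a Gaussian of mean [a z / c] and deviation [b / c], and integrates to
   1. *)
pose H (xz : R * R) : \bar R :=
  (f (c * xz.2)%R * (p xz.2)%:E * (p ((c * xz.1 - a * xz.2) / b) * (c / b))%:E)%E.
have mH : measurable_fun setT H.
  apply: emeasurable_funM; first apply: emeasurable_funM.
  - by apply: (measurableT_comp mf); meas.
  - by apply: (measurableT_comp mp); meas.
  - apply/measurable_EFinP; apply: measurable_funM => //; apply/measurable_EFinP.
    by apply: (measurableT_comp mp); meas.
have H0 z : (0 <= H z)%E.
  by rewrite /H !mule_ge0// lee_fin// mulr_ge0// ltW.
transitivity (\int[mu]_x \int[mu]_z H (x, z))%E.
  rewrite gauss1E//; last 2 first.
  - apply: (@measurable_fun_fubini_tonelli_F _ _ _ _ _ gamma (fun z : R * R => f (a * z.1 + b * z.2))) => //.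
    by apply: (measurableT_comp mf); meas.
  - by move=> x; exact: integral_ge0.
  apply: eq_integral => x _; rewrite gauss1E// -ge0_integralZr//; last 3 first.
  - by apply: emeasurable_funM; [exact: mfab|exact: mp].
  - by move=> y _; rewrite mule_ge0// lee_fin; exact: p0.
  - by rewrite lee_fin; exact: p0.
  rewrite -[LHS](@ge0_integral_affine _ (- (a / b * x)) (c / b))//; last 2 first.
  - by apply: emeasurable_funM => //; apply: emeasurable_funM; [exact: mfab|exact: mp].
  - by move=> y; rewrite !mule_ge0// lee_fin; exact: p0.
  apply: eq_integral => z _.
  rewrite /H/=.
  have -> : a * x + b * (- (a / b * x) + c / b * z) = c * z by field.
  rewrite -!muleA; congr (_ * _)%E; rewrite -!EFinM; congr EFin.
  rewrite /p; set E1 := expR _; set E2 := expR _; set E3 := expR _; set E4 := expR _.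
  have EE : E1 * E2 = E3 * E4.
    rewrite -!expRD; congr expR; apply/eqP; rewrite -subr_eq0; apply/eqP.
    transitivity ((c ^+ 2 - a ^+ 2 - b ^+ 2) * (x ^+ 2 - z ^+ 2) / (2 * b ^+ 2)).
      by field.
    by rewrite c2; field.
  by rewrite mulrA [K * E1 * _]mulrACA EE; ring.
have -> : (\int[mu]_x \int[mu]_z H (x, z) = \int[mu]_z \int[mu]_x H (x, z))%E.
  exact: (@fubini_tonelli _ _ _ _ _ mu mu H mH H0).
rewrite gauss1E//; last by apply: (measurableT_comp mf); meas.
apply: eq_integral => z _; rewrite /H/= ge0_integralZl//; last 3 first.
- apply/measurable_EFinP; apply: measurable_funM => //; apply/measurable_EFinP.
  by apply: (measurableT_comp mp); meas.
- by move=> x _; rewrite lee_fin mulr_ge0// ltW.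
- by rewrite mule_ge0// lee_fin.
rewrite -[RHS]mule1; congr (_ * _)%E.
have -> : (1 = \int[gamma]_x (1 : \bar R))%E by rewrite integral_cst//= probability_setT mule1.
rewrite gauss1E// -[RHS](@ge0_integral_affine _ (- (a * z / b)) (c / b))//; last 2 first.
- by apply: emeasurable_funM => //; exact: mp.
- by move=> x; rewrite mul1e lee_fin; exact: p0.
apply: eq_integral => x _; rewrite mul1e EFinM; congr ((p _)%:E * _)%E.
by field.
Qed.

(** In the induction of [integral_dot_gauss], [b] is the deviation of the remaining sum, while [a]
    has any sign; at [b = 0] the symmetry of the Gaussian replaces [a] by [|a|]. *)
Lemma integral_gauss1_sum (a b : R) (f : R -> \bar R) : 0 <= b ->
  measurable_fun setT f -> (forall x, 0 <= f x)%E ->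
  (\int[gamma]_x \int[gamma]_y f (a * x + b * y)%R =
   \int[gamma]_z f (Num.sqrt (a ^+ 2 + b ^+ 2) * z)%R)%E.
Proof.
rewrite le_eqVlt => /predU1P[<-|b0]; last exact: integral_gauss1_sum_gt0.
move=> mf f0.
have cst0 x : (\int[gamma]_y f (a * x + 0 * y)%R = f (a * x)%R)%E.
  under eq_integral do rewrite mul0r addr0.
  by rewrite integral_cst//= probability_setT mule1.
under eq_integral do rewrite cst0.
rewrite (expr0n R 2) addr0 sqrtr_sqr; have [a0|a0] := leP 0 a; first by rewrite ger0_norm.
rewrite ltr0_norm//.
rewrite -[LHS]integral_gauss1_oppr//; last by apply: (measurableT_comp mf); meas.
by apply: eq_integral => x _; rewrite mulrN mulNr.
Qed.

Lemma integral_dot_gauss n (v : n.-tuple R) (f : R -> \bar R) :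
  measurable_fun setT f -> (forall x, 0 <= f x)%E ->
  (\int[ipro gamma n]_g f (dot v g) =
   \int[gamma]_z f (Num.sqrt (\sum_(i < n) tnth v i ^+ 2) * z)%R)%E.
Proof.
elim/tcons_ind: n / v f => [|n k v IH] f mf f0.
  rewrite ge0_integral_ipro0; last exact: (measurableT_comp mf (measurable_dot _)).
  rewrite dot0 big_ord0 sqrtr0; under eq_integral do rewrite mul0r.
  by rewrite integral_cst//= probability_setT mule1.
rewrite (sum_tcons (fun x => x ^+ 2)) ge0_integral_iproS//; last first.
  exact: (measurableT_comp mf (measurable_dot _)).
have s0 : 0 <= \sum_(i < n) tnth v i ^+ 2 by apply: sumr_ge0 => i _; exact: sqr_ge0.
rewrite -{1}(sqr_sqrtr s0).
apply: (etrans _ (integral_gauss1_sum k (sqrtr_ge0 _) mf f0)).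
apply: eq_integral => x _.
rewrite -(IH (fun t => f (k * x + t)))//; last by apply: (measurableT_comp mf); meas.
by apply: eq_integral => g _; rewrite dotS.
Qed.

End gauss_rotation.

(** * From cosines to half lines *)

Section cos_determines.
Context {R : realType}.
Local Notation mu := (@lebesgue_measure R).
Local Notation Exp := (@exp_law R).

Lemma measurable_cos_fun d (T : measurableType d) (f : T -> R) :
  measurable_fun setT f -> measurable_fun setT (fun x => cos (f x)).
Proof.
move=> mf; apply: (measurableT_comp (f := cos)) => //.
exact: continuous_measurable_fun (@continuous_cos R).
Qed.

Lemma adde_fin_inj (r : R) (x y : \bar R) : (r%:E + x = r%:E + y -> x = y)%E.
Proof. by case: x y => [x| |] [y| |]// -[] /addrI ->. Qed.

Lemma cosD1_ge0 (x : R) : 0 <= 1 + cos x.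
Proof. by have := cos_geN1 x; lra. Qed.

Lemma cosD1_le2 (x : R) : 1 + cos x <= 2.
Proof. by have := cos_le1 x; lra. Qed.

(** [p x * exp (- x)] is an antiderivative of [(1 + cos (w x)) exp (- x)]; the constant 1 keeps the
    integrand nonnegative. *)
Lemma integral_exp_law_cos (w : R) :
  (\int[Exp]_e (1 + cos (w * e))%:E = (1 + (1 + w ^+ 2)^-1)%:E)%E.
Proof.
have w0 : 0 < 1 + w ^+ 2 by rewrite ltr_pwDl// sqr_ge0.
pose p (x : R) := - 1 + (w * sin (w * x) - cos (w * x)) / (1 + w ^+ 2).
have dwx (x : R) : is_derive x 1 (fun z : R => w * z) w.
  by apply: is_derive_eq; rewrite /GRing.scale/= mulr1.
have dp (x : R) : is_derive x 1 p ((w * (cos (w * x) * w) + sin (w * x) * w) / (1 + w ^+ 2)).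
  have ds : is_derive x 1 (fun z => sin (w * z)) (cos (w * x) * w).
    exact: (is_derive1_comp (is_derive_sin (w * x)) (dwx x)).
  have dc : is_derive x 1 (fun z => cos (w * z)) (- sin (w * x) * w).
    exact: (is_derive1_comp (is_derive_cos (w * x)) (dwx x)).
  by rewrite /p; apply: is_derive_eq; rewrite /GRing.scale/=; field; rewrite gt_eqF.
rewrite integral_exp_law; last 2 first.
- by apply/measurable_EFinP; apply: measurable_funD => //; apply: measurable_cos_fun; meas.
- by move=> x; rewrite lee_fin cosD1_ge0.
transitivity (\int[mu]_(x in `[0%R, +oo[) ((1 + cos (w * x)) * expR (- (1 * x)))%:E)%E.
  by apply: eq_integral => x _; rewrite mul1r -EFinM.
rewrite (integral_pol_exp (F := fun x => p x * expR (- (1 * x))) (l := 0)).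
- rewrite sub0e -EFinN /p !mulr0 sin0 cos0 oppr0 expR0 mulr0; congr EFin.
  by field; rewrite gt_eqF.
- by move=> x _; rewrite mulr_ge0 ?expR_ge0 ?cosD1_ge0.
- move=> x; apply: cvgM; last exact: continuous_expNM.
  apply: cvgD; first exact: cvg_cst.
  apply: (@continuous_comp _ _ _ (fun z => w * z) cos x); last exact: continuous_cos.
  by apply: cvgM; [exact: cvg_cst|exact: cvg_id].
- move=> x; have := is_deriveM (dp x) (is_derive_expNM 1 x).
  rewrite /GRing.scale/= => -[dF FE]; split => //; rewrite FE /p.
  by field; rewrite gt_eqF.
- apply: norm_cvg0; apply: (@cvgy_squeeze_invr _ _ (2 + `|w|)) => x x0.
  rewrite normr_ge0/= normrM (ger0_norm (expR_ge0 _)) mul1r.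
  apply: ler_pM => //; last by have := expRN_le 0 x0; rewrite expr1 div1r.
  rewrite /p (le_trans (ler_normD _ _))// normrN1 -addrA lerD2l.
  rewrite normrM normfV (ger0_norm (ltW w0)) ler_pdivrMr//.
  have h : `|w * sin (w * x) - cos (w * x)| <= `|w| + 1.
    rewrite (le_trans (ler_normB _ _))// lerD// ?normrM.
      by rewrite ler_piMr// ler_norml sin_geN1 sin_le1.
    by rewrite ler_norml cos_geN1 cos_le1.
  rewrite (le_trans h)// addrC ler_peMr ?lerDl ?sqr_ge0//.
Qed.

Section halfline.
Context d (T : measurableType d).
Variables (P Q : probability T R) (W X : T -> R).
Hypotheses (mW : measurable_fun setT W) (mX : measurable_fun setT X).
Hypothesis W0 : forall x, 0 <= W x.
Hypothesis W2 : forall x, W x <= 2.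
Hypothesis WX : forall v r,
  (\int[P]_x (W x * (1 + cos (v * X x - r)))%:E =
   \int[Q]_x (W x * (1 + cos (v * X x - r)))%:E)%E.

Let mWE : measurable_fun setT (fun x => (W x)%:E : \bar R).
Proof. exact/measurable_EFinP. Qed.

Let W_fin (S : probability T R) : (\int[S]_x (W x)%:E)%E \is a fin_num.
Proof.
rewrite ge0_fin_numE; last by apply: integral_ge0 => x _; rewrite lee_fin.
apply: (@le_lt_trans _ _ (\int[S]_x 2%:E)%E); last first.
  by rewrite integral_cst//= probability_setT mule1 ltry.
apply: ge0_le_integral => //; first by move=> x _; rewrite lee_fin.
by move=> x _; rewrite lee_fin.
Qed.

Let WE : (\int[P]_x (W x)%:E = \int[Q]_x (W x)%:E)%E.
Proof.
have h (S : probability T R) :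
    (\int[S]_x (W x * (1 + cos (0 * X x - 0)))%:E = 2%:E * \int[S]_x (W x)%:E)%E.
  rewrite -ge0_integralZl//; last by move=> x _; rewrite lee_fin.
  by apply: eq_integral => x _; rewrite mul0r subr0 cos0 -EFinM mulrC.
have := WX 0 0; rewrite !h.
rewrite -(fineK (W_fin P)) -(fineK (W_fin Q)) -!EFinM => -[e]; congr EFin; lra.
Qed.

(* Since [\int cos (w * e) dExp(e) = (1 + w ^+ 2)^-1], averaging the cosines over
   the frequency turns them into a Cauchy kernel. *)
Let kernelE (N a : R) :
  (\int[P]_x (W x * polar_weight (N * (X x - a)))%:E =
   \int[Q]_x (W x * polar_weight (N * (X x - a)))%:E)%E.
Proof.
have mc (v r : R) : measurable_fun setT (fun x => (1 + cos (v * X x - r))).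
  apply: measurable_funD => //; apply: measurable_cos_fun.
  by apply: measurable_funB => //; exact: measurable_funM.
pose k (x : T) := (1 + (N * (X x - a)) ^+ 2)^-1.
have mk : measurable_fun setT k.
  apply: (measurableT_comp measurable_fun_inv); apply: measurable_funD => //.
  by apply: measurable_funX; apply: measurable_funM => //; exact: measurable_funB.
have k0 x : 0 <= k x by rewrite invr_ge0 addr_ge0 ?sqr_ge0.
have h1 (S : probability T R) : (\int[S]_x (W x * (1 + k x))%:E =
    \int[Exp]_e \int[S]_x (W x * (1 + cos ((N * e) * X x - N * e * a)))%:E)%E.
  pose H (xe : T * R) : \bar R := (W xe.1 * (1 + cos ((N * xe.2) * X xe.1 - N * xe.2 * a)))%:E.
  have mH : measurable_fun setT H.
    have m1 : measurable_fun setT (fun xe : T * R => X xe.1).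
      exact: (measurableT_comp mX (@measurable_fst _ _ _ _)).
    have m2 : measurable_fun setT (fun xe : T * R => W xe.1).
      exact: (measurableT_comp mW (@measurable_fst _ _ _ _)).
    apply/measurable_EFinP; apply: measurable_funM => //.
    by apply: measurable_funD => //; apply: measurable_cos_fun; meas.
  have H0 z : (0 <= H z)%E by rewrite lee_fin mulr_ge0 ?cosD1_ge0.
  rewrite -[RHS](@fubini_tonelli _ _ _ _ _ S Exp H mH H0).
  apply: eq_integral => x _.
  transitivity (\int[Exp]_e ((W x)%:E * (1 + cos (N * (X x - a) * e))%:E))%E; last first.
    by apply: eq_integral => e _; rewrite /H/= -EFinM; congr ((_ * (1 + cos _))%:E); ring.
  rewrite ge0_integralZl//; last 2 first.
  - by apply/measurable_EFinP; apply: measurable_funD => //; apply: measurable_cos_fun; meas.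
  - by rewrite lee_fin.
  by rewrite integral_exp_law_cos -EFinM.
have h2 (S : probability T R) : (\int[S]_x (W x * (1 + k x))%:E =
    \int[S]_x (W x)%:E + \int[S]_x (W x * k x)%:E)%E.
  rewrite -ge0_integralD//; last 3 first.
  - by move=> x _; rewrite lee_fin.
  - by move=> x _; rewrite lee_fin mulr_ge0.
  - by apply/measurable_EFinP; exact: measurable_funM.
  by apply: eq_integral => x _; rewrite mulrDr mulr1 EFinD.
have h3 : (\int[P]_x (W x * k x)%:E = \int[Q]_x (W x * k x)%:E)%E.
  have : (\int[P]_x (W x * (1 + k x))%:E = \int[Q]_x (W x * (1 + k x))%:E)%E.
    by rewrite !h1; apply: eq_integral => e _; exact: WX.
  by rewrite !h2 WE -(fineK (W_fin Q)) => /adde_fin_inj.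
have h4 (S : probability T R) : (\int[S]_x (W x * polar_weight (N * (X x - a)))%:E =
    (2 * normal_peak (1 : R) ^+ 2)%:E * \int[S]_x (W x * k x)%:E)%E.
  rewrite -ge0_integralZl//; last 3 first.
  - by apply/measurable_EFinP; exact: measurable_funM.
  - by move=> x _; rewrite lee_fin mulr_ge0.
  - by rewrite lee_fin mulr_ge0 ?sqr_ge0.
  apply: eq_integral => x _; rewrite -EFinM /polar_weight /k; congr EFin; ring.
by rewrite !h4 h3.
Qed.

(** Integrating the kernels of [kernelE] over the centres [a > b] smooths the half line above [b] at
    scale [1 / N]: the inner integral is the probability that [X x] plus a scaled Cauchy error
    exceeds [b]. *)
Let smoothE (N b : R) : 0 < N ->
  (\int[P]_x ((W x)%:E * \int[mu]_s (polar_weight s * (b < X x + s / N)%R%:R)%:E) =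
   \int[Q]_x ((W x)%:E * \int[mu]_s (polar_weight s * (b < X x + s / N)%R%:R)%:E))%E.
Proof.
move=> N0.
have N1 : 0 < N^-1 by rewrite invr_gt0.
have mind (d' : measure_display) (T' : measurableType d') (f : T' -> R) : measurable_fun setT f ->
    measurable_fun setT (fun z => (b < f z)%R%:R : R).
  move=> mf; apply: measurableT_comp => //; exact: measurable_fun_ltr.
have main (S : probability T R) :
    (\int[S]_x ((W x)%:E * \int[mu]_s (polar_weight s * (b < X x + s / N)%R%:R)%:E) =
     \int[mu]_a ((N * (b < a)%R%:R)%:E * \int[S]_x (W x * polar_weight (N * (X x - a)))%:E))%E.
  pose H (xa : T * measurableTypeR R) : \bar R :=
    (W xa.1 * (N * (b < xa.2)%R%:R * polar_weight (N * (X xa.1 - xa.2))))%:E.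
  have m1 : measurable_fun setT (fun xa : T * measurableTypeR R => X xa.1).
    exact: (measurableT_comp mX (@measurable_fst _ _ _ _)).
  have m2 : measurable_fun setT (fun xa : T * measurableTypeR R => W xa.1).
    exact: (measurableT_comp mW (@measurable_fst _ _ _ _)).
  have mH : measurable_fun setT H.
    apply/measurable_EFinP; apply: measurable_funM => //; apply: measurable_funM.
      by apply: measurable_funM => //; apply: mind; exact: measurable_snd.
    by apply: (measurableT_comp measurable_polar_weight); meas.
  have H0 z : (0 <= H z)%E by rewrite lee_fin mulr_ge0// mulr_ge0 ?polar_weight_ge0// mulr_ge0 ?(ltW N0).
  transitivity (\int[S]_x \int[mu]_a H (x, a))%E.
    apply: eq_integral => x _.
    rewrite -[in RHS](@ge0_integral_affine _ (X x) N^-1)//; last first.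
      exact: (measurableT_comp mH (measurable_pair1 x)).
    rewrite -ge0_integralZl//; last 3 first.
    - apply/measurable_EFinP; apply: measurable_funM; first exact: measurable_polar_weight.
      by apply: mind; meas.
    - by move=> s _; rewrite lee_fin mulr_ge0// polar_weight_ge0.
    - by rewrite lee_fin.
    apply: eq_integral => s _; rewrite /H/= -!EFinM; congr EFin.
    rewrite [N^-1 * s]mulrC (_ : N * (X x - (X x + s / N)) = - s); last by field; rewrite gt_eqF.
    by rewrite /polar_weight sqrrN; field; rewrite gt_eqF// gt_eqF// ltr_pwDl// sqr_ge0.
  rewrite (@fubini_tonelli _ _ _ _ _ S mu H mH H0).
  apply: eq_integral => a _; rewrite -ge0_integralZl//; last 3 first.
  - apply/measurable_EFinP; apply: measurable_funM => //.
    apply: (measurableT_comp measurable_polar_weight); apply: measurable_funM => //.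
    exact: measurable_funB.
  - by move=> x _; rewrite lee_fin mulr_ge0// polar_weight_ge0.
  - by rewrite lee_fin mulr_ge0// ltW.
  by apply: eq_integral => x _; rewrite -EFinM /H/=; congr EFin; ring.
by rewrite !main; apply: eq_integral => a _; rewrite kernelE.
Qed.

(* The half line is the limit of its Cauchy smoothings at scale [k.+1^-2], with the
   end point shifted to [b + k.+1^-1] so that the limit at [b] is [0]. *)
Lemma halfline_determined (b : R) :
  (\int[P]_x (W x * (b < X x)%R%:R)%:E = \int[Q]_x (W x * (b < X x)%R%:R)%:E)%E.
Proof.
pose N (k : nat) : R := k.+1%:R ^+ 2.
pose c (k : nat) : R := b + k.+1%:R^-1.
have N0 k : 0 < N k by rewrite exprn_gt0.
have mind (d' : measure_display) (T' : measurableType d') (f : T' -> R) t : measurable_fun setT f ->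
    measurable_fun setT (fun z => (t < f z)%R%:R : R).
  move=> mf; apply: measurableT_comp => //; exact: measurable_fun_ltr.
have pw1 : (\int[mu]_s (polar_weight s)%:E = 1)%E := integral_polar_weight.
have mpw : measurable_fun [set: measurableTypeR R] (fun s : measurableTypeR R => (polar_weight s)%:E).
  by apply/measurable_EFinP; exact: measurable_polar_weight.
have pw0 (s : R) : 0 <= polar_weight s := polar_weight_ge0 s.
have ipw : mu.-integrable setT (fun s => (polar_weight s)%:E).
  apply/integrableP; split => //.
  under eq_integral do rewrite gee0_abs ?lee_fin//.
  by rewrite pw1 ltry.
pose G (x : R) (k : nat) : \bar R :=
  (\int[mu]_s (polar_weight s * (c k < x + s / N k)%R%:R)%:E)%E.
have mGs x k : measurable_fun [set: measurableTypeR R]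
    (fun s : measurableTypeR R => (polar_weight s * (c k < x + s / N k)%R%:R)%:E).
  apply/measurable_EFinP; apply: measurable_funM; first exact: measurable_polar_weight.
  by apply: mind; meas.
have G0 x k : (0 <= G x k)%E.
  by apply: integral_ge0 => s _; rewrite lee_fin mulr_ge0.
have ev (x s : R) : \forall k \near \oo, (c k < x + s / N k) = (b < x).
  have cE k : (c k < x + s / N k) = (k.+1%:R^-1 - s / N k < x - b).
    have aux (u i y q : R) : (u + i < y + q) = (i - q < y - u) by apply/idP/idP; lra.
    exact: aux.
  have NE k : s / N k = k.+1%:R^-1 * (s * k.+1%:R^-1) by rewrite /N expr2 invfM mulrCA.
  have [bx|xb] := ltP b x.
    have e0 : 0 < (x - b) / (1 + `|s|).
      by rewrite divr_gt0 ?subr_gt0// ltr_pwDl.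
    near=> k; rewrite cE NE.
    have k1 : 0 <= k.+1%:R^-1 :> R by rewrite invr_ge0.
    have k2 : k.+1%:R^-1 <= 1 :> R by rewrite invf_le1// ler1n.
    have : k.+1%:R^-1 < (x - b) / (1 + `|s|).
      by near: k; exact: (near_infty_natSinv_lt (PosNum e0)).
    have s1 : 0 < 1 + `|s| by rewrite ltr_pwDl.
    move: (k.+1%:R^-1) k1 k2 => i i0 i1; rewrite ltr_pdivlMr// => h.
    apply: le_lt_trans h.
    rewrite (_ : i - i * (s * i) = i * (1 + - (s * i))); last by ring.
    rewrite ler_wpM2l// lerD2l (le_trans (ler_norm _))// normrN normrM (ger0_norm i0).
    by rewrite ler_piMr.
  near=> k; rewrite cE NE; apply/negbTE; rewrite -leNgt.
  have k1 : 0 <= k.+1%:R^-1 :> R by rewrite invr_ge0.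
  have sk : s <= k.+1%:R.
    have : s <= k%:R by near: k; exact: nbhs_infty_ger.
    by move=> /le_trans; apply; rewrite ler_nat.
  rewrite (@le_trans _ _ 0)// ?subr_le0// subr_ge0 ler_piMr//.
  by rewrite ler_pdivrMr// mul1r.
have Gcvg x : G x k @[k --> \oo] --> ((b < x)%R%:R%:E : \bar R).
  have -> : (b < x)%R%:R%:E = (\int[mu]_s (polar_weight s * (b < x)%R%:R)%:E)%E :> \bar R.
    case: (b < x); first by under eq_integral do rewrite mulr1; rewrite pw1.
    by under eq_integral do rewrite mulr0; rewrite integral0.
  refine (@dominated_cvg _ _ R mu setT measurableT
    (fun k s => (polar_weight s * (c k < x + s / N k)%R%:R)%:E)
    (fun s => (polar_weight s * (b < x)%R%:R)%:E)
    (fun s => (polar_weight s)%:E) _ _ _ _ _) => //.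
  - move=> s _; apply: cvg_near_cst.
    by apply: filterS (ev x s) => k ->.
  - move=> k s _; have h : 0 <= polar_weight s * (c k < x + s / N k)%R%:R.
      exact: (mulr_ge0 (pw0 s) (ler0n _ _)).
    by rewrite gee0_abs lee_fin// ler_piMr// lern1 leq_b1.
have lim (S : probability T R) : (\int[S]_x ((W x)%:E * G (X x) k))%E @[k --> \oo] -->
    (\int[S]_x (W x * (b < X x)%R%:R)%:E)%E.
  refine (@dominated_cvg _ _ R S setT measurableT (fun k x => ((W x)%:E * G (X x) k)%E)
    (fun x => (W x * (b < X x)%R%:R)%:E) (cst 2%:E) _ _ _ _ _) => //.
  - move=> k; apply: emeasurable_funM => //.
    pose H (xs : R * measurableTypeR R) : \bar R := (polar_weight xs.2 * (c k < xs.1 + xs.2 / N k)%R%:R)%:E.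
    have mH : measurable_fun setT H.
      apply/measurable_EFinP; apply: measurable_funM.
        exact: (measurableT_comp measurable_polar_weight (@measurable_snd _ _ _ _)).
      by apply: mind; meas.
    have mG : measurable_fun setT (G ^~ k).
      apply: (@measurable_fun_fubini_tonelli_F _ _ _ _ _ mu H mH) => z.
      by rewrite lee_fin mulr_ge0.
    exact: (measurableT_comp mG mX).
  - move=> x _; rewrite EFinM; apply: cvgeZl => //.
  - exact: finite_measure_integrable_cst.
  - move=> k x _; rewrite gee0_abs ?mule_ge0 ?lee_fin//.
    rewrite -[leRHS]mule1; apply: lee_pmul; rewrite ?lee_fin//.
    rewrite -pw1; apply: ge0_le_integral => //.
    + by move=> s _; rewrite lee_fin mulr_ge0.
    + by move=> s _; rewrite lee_fin ler_piMr// lern1 leq_b1.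
rewrite -(cvg_lim _ (lim P))// -(cvg_lim _ (lim Q))//.
by congr (limn _); apply/funext => k; exact: smoothE.
Unshelve. all: by end_near. Qed.

End halfline.

End cos_determines.

(** * The Cramer-Wold theorem *)

Section same_mean.
Context d (T : measurableType d) (R : realType) (P Q : probability T R).

(** The bound [M] makes the means finite, which is what allows the subtraction in [same_meanB]. *)
Definition same_mean (f : T -> R) := [/\ measurable_fun setT f, forall x, 0 <= f x,
  exists M, forall x, f x <= M & (\int[P]_x (f x)%:E = \int[Q]_x (f x)%:E)%E].

Lemma eq_same_mean f g : f =1 g -> same_mean f -> same_mean g.
Proof. by move=> /funext ->. Qed.

Lemma same_meanD f g : same_mean f -> same_mean g -> same_mean (fun x => f x + g x).
Proof.
move=> [mf f0 [M fM] fE] [mg g0 [N gN] gE]; split.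
- exact: measurable_funD.
- by move=> x; rewrite addr_ge0.
- by exists (M + N) => x; rewrite lerD.
- have h (S : probability T R) : (\int[S]_x (f x + g x)%:E =
      \int[S]_x (f x)%:E + \int[S]_x (g x)%:E)%E.
    rewrite -ge0_integralD//; try exact/measurable_EFinP.
    - by move=> x _; rewrite lee_fin.
    - by move=> x _; rewrite lee_fin.
  by rewrite !h fE gE.
Qed.

Lemma same_meanZ k f : 0 <= k -> same_mean f -> same_mean (fun x => k * f x).
Proof.
move=> k0 [mf f0 [M fM] fE]; split.
- exact: measurable_funM.
- by move=> x; rewrite mulr_ge0.
- by exists (k * M) => x; rewrite ler_wpM2l.
- have h (S : probability T R) : (\int[S]_x (k * f x)%:E = k%:E * \int[S]_x (f x)%:E)%E.
    rewrite -ge0_integralZl//; try exact/measurable_EFinP.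
    by move=> x _; rewrite lee_fin.
  by rewrite !h fE.
Qed.

Lemma same_meanB (f g : T -> R) : measurable_fun setT f -> (forall x, 0 <= f x) ->
  same_mean g -> same_mean (fun x => f x + g x) -> same_mean f.
Proof.
move=> mf f0 [mg g0 [N gN] gE] [_ _ [M fgM] fgE]; split => //.
  by exists M => x; rewrite (le_trans _ (fgM x))// lerDl.
have h (S : probability T R) : (\int[S]_x (f x + g x)%:E =
    \int[S]_x (g x)%:E + \int[S]_x (f x)%:E)%E.
  rewrite -ge0_integralD//; try exact/measurable_EFinP.
  - by apply: eq_integral => x _; rewrite addrC EFinD.
  - by move=> x _; rewrite lee_fin.
  - by move=> x _; rewrite lee_fin.
have gfin : (\int[Q]_x (g x)%:E)%E \is a fin_num.
  rewrite ge0_fin_numE; last by apply: integral_ge0 => x _; rewrite lee_fin.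
  apply: (@le_lt_trans _ _ (\int[Q]_x N%:E)%E).
    by apply: ge0_le_integral => //; [move=> x _; rewrite lee_fin|exact/measurable_EFinP|
      move=> x _; rewrite lee_fin].
  by rewrite integral_cst//= probability_setT mule1 ltry.
by move: fgE; rewrite !h gE -(fineK gfin) => /adde_fin_inj.
Qed.

End same_mean.

Section cramer_wold.
Context {R : realType} (n : nat) (P Q : probability (n.-tuple R) R).
Hypothesis PQ : forall (u : n.-tuple R) (r : R),
  (\int[P]_x (1 + cos (dot u x - r))%:E = \int[Q]_x (1 + cos (dot u x - r))%:E)%E.

Let addk (u : n.-tuple R) (v : R) (k : 'I_n) : n.-tuple R :=
  [tuple tnth u i + v * (i == k)%:R | i < n].

Let dot_addk u v k x : dot (addk u v k) x = dot u x + v * tnth x k.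
Proof.
rewrite /dot; under eq_bigr do rewrite tnth_mktuple mulrDl.
rewrite big_split/=; congr (_ + _); rewrite (bigD1 k)//= eqxx mulr1 big1 ?addr0//.
by move=> i /negbTE ->; rewrite mulr0 mul0r.
Qed.

Let zero : n.-tuple R := [tuple 0 | i < n].

Let dot_zero x : dot zero x = 0.
Proof. by rewrite /dot big1// => i _; rewrite tnth_mktuple mul0r. Qed.

Let box (b : n.-tuple R) (k : nat) : set (n.-tuple R) :=
  [set x | forall i : 'I_n, (i < k)%N -> tnth b i < tnth x i].

Let measurable_box b k : measurable (box b k).
Proof.
rewrite (_ : box b k = \bigcap_(i in [set: 'I_n]) [set x | (i < k)%N -> tnth b i < tnth x i]).
  apply: fin_bigcap_measurable => //.
  move=> i _; case: (ltnP i k) => ik.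
    rewrite (_ : [set _ | _] = [set x | tnth b i < tnth x i]).
      by apply: measurable_set_lt => //; exact: measurable_tnth.
    by apply/seteqP; split => x /=; [apply|].
  by rewrite (_ : [set _ | _] = setT)//; apply/seteqP; split.
by apply/seteqP; split => [x xb i _|x xb i]; [exact: xb|exact: (xb i I)].
Qed.

Let H b k : n.-tuple R -> R := \1_(box b k).

Let H0 b k x : 0 <= H b k x.
Proof. by rewrite /H indicE ler0n. Qed.

Let H1 b k x : H b k x <= 1.
Proof. by rewrite /H indicE lern1 leq_b1. Qed.

Let mH b k : measurable_fun setT (H b k).
Proof. exact: measurable_indic. Qed.

Let HS b (k : 'I_n) x : H b k.+1 x = H b k x * (tnth b k < tnth x k)%R%:R.
Proof.
rewrite /H !indicE -natrM mulnb; congr (_%:R); congr nat_of_bool.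
apply/idP/andP.
  rewrite !inE => xb; split; last exact: xb.
  by move=> i ik; apply: xb; rewrite ltnS ltnW.
move=> []; rewrite !inE => xb bk i; rewrite ltnS leq_eqVlt => /predU1P[ik|]; last exact: xb.
by rewrite (_ : i = k)//; exact/val_inj.
Qed.

Let mcos (u : n.-tuple R) r : measurable_fun setT (fun x => 1 + cos (dot u x - r)).
Proof.
apply: measurable_funD => //; apply: measurable_cos_fun.
by apply: measurable_funB => //; exact: measurable_dot.
Qed.

(* Half lines replace the characters one coordinate at a time: a product of two
   cosines is again a combination of cosines of linear forms. *)
Let box_cos b k : (k <= n)%N ->
  forall u r, same_mean P Q (fun x => H b k x * (1 + cos (dot u x - r))).
Proof.
elim: k => [_ u r|k IH kn u r].
  apply: (@eq_same_mean _ _ _ _ _ (fun x => 1 + cos (dot u x - r))).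
    by move=> x; rewrite /H indicE mem_set ?mul1r.
  split; [exact: mcos|by move=> x; exact: cosD1_ge0|by exists 2 => x; exact: cosD1_le2|].
  exact: PQ.
pose k' := Ordinal kn.
have {}IH := IH (ltnW kn).
pose W x := H b k x * (1 + cos (dot u x - r)).
have W0 x : 0 <= W x by rewrite mulr_ge0// cosD1_ge0.
have W2 x : W x <= 2.
  by rewrite -[leRHS]mul1r ler_pM ?cosD1_ge0 ?cosD1_le2.
have mW : measurable_fun setT W by apply: measurable_funM; [exact: mH|exact: mcos].
have WX v s : same_mean P Q (fun x => W x * (1 + cos (v * tnth x k' - s))).
  have I1 : same_mean P Q (fun x => 2 * (H b k x * (1 + cos (dot zero x - 0)))).
    by apply: same_meanZ => //; exact: IH.
  have I2 : same_mean P Q (fun x => 2 * (H b k x * (1 + cos (dot u x - r)))).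
    by apply: same_meanZ => //; exact: IH.
  have I3 : same_mean P Q (fun x => 2 * (H b k x * (1 + cos (dot (addk zero v k') x - s)))).
    by apply: same_meanZ => //; exact: IH.
  have I4 := same_meanD (IH (addk u v k') (r + s)) (IH (addk u (- v) k') (r - s)).
  have mWc : measurable_fun setT (fun x => W x * (1 + cos (v * tnth x k' - s))).
    apply: measurable_funM => //; apply: measurable_funD => //.
    apply: measurable_cos_fun; apply: measurable_funB => //; apply: measurable_funM => //.
    exact: measurable_tnth.
  have Wc0 x : 0 <= W x * (1 + cos (v * tnth x k' - s)) by rewrite mulr_ge0// cosD1_ge0.
  (* For the two phases [y] and [z], [2 (1 + cos y) (1 + cos z) + 4] equals [2 (1 + cos y) + 2 (1 +
     cos z) + (1 + cos (y + z)) + (1 + cos (y - z))]; the 4 is supplied by [I1]. *)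
  have h : same_mean P Q (fun x => 2 * (W x * (1 + cos (v * tnth x k' - s)))).
    apply: (same_meanB _ _ I1).
    - exact: measurable_funM.
    - by move=> x; rewrite mulr_ge0.
    - apply: eq_same_mean (same_meanD (same_meanD I2 I3) I4) => x.
      rewrite !dot_addk dot_zero add0r subr0 cos0 /W.
      rewrite (_ : dot u x + v * tnth x k' - (r + s) = (dot u x - r) + (v * tnth x k' - s)); last by ring.
      rewrite (_ : dot u x + - v * tnth x k' - (r - s) = (dot u x - r) - (v * tnth x k' - s)); last by ring.
      move: (dot u x - r) (v * tnth x k' - s) => y z.
      by rewrite cosD cosB; ring.
  apply: eq_same_mean (same_meanZ (_ : 0 <= 2^-1) h) => [x|]; last by rewrite invr_ge0.
  by rewrite mulKf.
apply: (@eq_same_mean _ _ _ _ _ (fun x => W x * (tnth b k' < tnth x k')%R%:R)).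
  by move=> x; rewrite (HS b k') /W mulrAC.
have mX : measurable_fun setT (fun x : n.-tuple R => tnth x k') by exact: measurable_tnth.
split.
- apply: measurable_funM => //; apply: measurableT_comp => //.
  exact: measurable_fun_ltr.
- by move=> x; rewrite mulr_ge0.
- by exists 2 => x; rewrite (le_trans _ (W2 x))// ler_piMr// lern1 leq_b1.
- by apply: (halfline_determined mW mX W0 W2) => v s; have [] := WX v s.
Qed.

Let box_eq b : P (box b n) = Q (box b n).
Proof.
have [_ _ _] := box_cos b (leqnn n) zero 0.
have h (S : probability (n.-tuple R) R) :
    (\int[S]_x (H b n x * (1 + cos (dot zero x - 0)))%:E = 2%:E * S (box b n))%E.
  rewrite -[box b n]setIT -integral_indic// -ge0_integralZl//; last first.
    by apply/measurable_EFinP; exact: mH.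
  apply: eq_integral => x _; rewrite dot_zero subr0 cos0 mulrC EFinM.
  by congr (_ * _)%E; congr EFin; ring.
rewrite !h -(fineK (fin_num_measure P _ (measurable_box b n))).
rewrite -(fineK (fin_num_measure Q _ (measurable_box b n))) -!EFinM => -[e].
by congr EFin; lra.
Qed.

Let boxes : set (set (n.-tuple R)) := [set A | exists b, A = box b n].

Let measurable_boxes : @measurable _ (n.-tuple R) = <<s boxes >>.
Proof.
apply/seteqP; split; last first.
  apply: smallest_sub; first exact: sigma_algebra_measurable.
  by move=> _ [b ->]; exact: measurable_box.
apply: smallest_sub; first exact: smallest_sigma_algebra.
have sub (i : 'I_n) : preimage_set_system setT (fun x : n.-tuple R => tnth x i) measurable
    `<=` <<s boxes >>.
  pose aT := g_sigma_algebraType boxes.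
  have mt : measurable_fun [set: aT] (fun x : aT => tnth (x : n.-tuple R) i).
    apply: (@measurability _ _ aT R setT _ (@RGenOInfty.G R)).
      exact: (RGenOInfty.measurableE R).
    move=> _ [_ [t ->] <-]; rewrite setTI.
    rewrite (_ : _ @^-1` _ = \bigcup_m
      box [tuple if j == i then t else - m%:R | j < n] n).
      apply: bigcupT_measurable => m; apply: sub_sigma_algebra.
      by eexists; reflexivity.
    apply/seteqP; split => x /=; rewrite in_itv/= andbT.
      move=> tx; exists (Num.bound (\sum_(j < n) `|tnth x j|)) => //= j _.
      rewrite tnth_mktuple; case: eqP => [->//|_].
      rewrite ltrNl (@le_lt_trans _ _ (\sum_(j < n) `|tnth x j|))//; last first.
        by apply: archi_boundP; exact: sumr_ge0.
      rewrite (bigD1 j)//= (le_trans (ler_norm _))// normrN lerDl.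
      exact: sumr_ge0.
    by move=> [m _ /(_ i (ltn_ord i))]; rewrite tnth_mktuple eqxx.
  by move=> B [A mA <-]; exact: mt.
elim/big_ind: _ => //.
by move=> A B hA hB x [/hA|/hB].
Qed.

(** The orthants [box b n] are closed under intersection, exhaust the space and generate the
    measurable sets: the half space [t < x_i] is the union over [m] of the orthants with corner [t]
    in coordinate [i] and [- m] elsewhere. *)
Theorem cramer_wold A : measurable A -> P A = Q A.
Proof.
apply: (measure_unique boxes (fun m => box [tuple - m%:R | j < n] n)).
- exact: measurable_boxes.
- move=> _ _ [b ->] [c ->]; exists [tuple Num.max (tnth b i) (tnth c i) | i < n].
  apply/seteqP; split => x.
    by move=> [xb xc] i _; rewrite tnth_mktuple gt_max xb ?xc.
  by move=> xbc; split => i _; have := xbc i (ltn_ord i); rewrite tnth_mktuple gt_max => /andP[].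
- by move=> m; eexists; reflexivity.
- rewrite -subTset => x _; exists (Num.bound (\sum_(j < n) `|tnth x j|)) => //= j _.
  rewrite tnth_mktuple ltrNl (@le_lt_trans _ _ (\sum_(j < n) `|tnth x j|))//; last first.
    by apply: archi_boundP; exact: sumr_ge0.
  by rewrite (bigD1 j)//= (le_trans (ler_norm _))// normrN lerDl; exact: sumr_ge0.
- by move=> _ [b ->]; exact: box_eq.
- by move=> m; rewrite (le_lt_trans (probability_le1 _ _)) ?ltry.
Qed.

End cramer_wold.

(** * The law of a Gaussian vector *)

Section has_mean.
Context d (T : measurableType d) (R : realType) (P : probability T R).

(** The signed counterpart of [mean_ge0], for the coordinates of a Gaussian vector and their
    products. *)
Definition has_mean (f : T -> R) (r : R) :=
  P.-integrable setT (EFin \o f) /\ (\int[P]_x (f x)%:E = r%:E)%E.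

Lemma has_mean_ge0 f r : mean_ge0 P f r -> has_mean f r.
Proof.
move=> [mf f0 fr]; split=> //; apply/integrableP; split; first exact/measurable_EFinP.
under eq_integral do rewrite gee0_abs ?lee_fin//=.
by rewrite fr ltry.
Qed.

Lemma has_meanD f g r s : has_mean f r -> has_mean g s ->
  has_mean (fun x => f x + g x) (r + s).
Proof.
move=> [fi fr] [gi gs]; split; first exact: (integrableD measurableT fi gi).
by rewrite EFinD -fr -gs -(integralD measurableT fi gi).
Qed.

Lemma has_meanZ k f r : has_mean f r -> has_mean (fun x => k * f x) (k * r).
Proof.
move=> [fi fr]; split; first exact: (integrableZl measurableT k fi).
by rewrite EFinM -fr -(integralZl measurableT fi).
Qed.

Lemma has_mean_sum n (f : 'I_n -> T -> R) (r : 'I_n -> R) :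
  (forall i, has_mean (f i) (r i)) ->
  has_mean (fun x => \sum_(i < n) f i x) (\sum_(i < n) r i).
Proof.
elim: n f r => [|n IH] f r fr.
  rewrite big_ord0 (_ : (fun x => _) = cst 0); last by apply/funext => x; rewrite big_ord0.
  by apply: has_mean_ge0; exact: mean_ge0_cst.
rewrite big_ord_recl (_ : (fun x => _) = fun x => f ord0 x + \sum_(i < n) f (lift ord0 i) x).
  by apply: has_meanD; [exact: fr|apply: IH => i; exact: fr].
by apply/funext => x; rewrite big_ord_recl.
Qed.

Lemma eq_has_mean f g r s : f =1 g -> r = s -> has_mean f r -> has_mean g s.
Proof. by move=> /funext -> ->. Qed.

Lemma has_mean_unique f r s : has_mean f r -> has_mean f s -> r = s.
Proof. by move=> [_ fr] [_]; rewrite fr => -[]. Qed.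

End has_mean.

Lemma gauss1_mean_sq {R : realType} (m s : R) :
  mean_ge0 (@gauss1 R) (fun x => (m + s * x) ^+ 2) (m ^+ 2 + s ^+ 2).
Proof.
have mf k : measurable_fun setT (fun x : R => (m + k * x) ^+ 2) by meas.
split; [exact: mf|by move=> x; exact: sqr_ge0|].
apply: double_inj; first by apply: integral_ge0 => x _; rewrite lee_fin sqr_ge0.
rewrite -{1}(@integral_gauss1_oppr R (fun x => ((m + s * x) ^+ 2)%:E)); last 2 first.
- exact/measurable_EFinP.
- by move=> x; rewrite lee_fin sqr_ge0.
rewrite -ge0_integralD//; last 4 first.
- by move=> x _; rewrite lee_fin sqr_ge0.
- by apply/measurable_EFinP; meas.
- by move=> x _; rewrite lee_fin sqr_ge0.
- by apply/measurable_EFinP; exact: mf.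
have [_ _] : mean_ge0 (@gauss1 R) (fun x => 2 * m ^+ 2 + 2 * s ^+ 2 * x ^+ 2)
    (2 * m ^+ 2 + 2 * s ^+ 2 * 1).
  apply: mean_ge0D; first by apply: mean_ge0_cst; rewrite mulr_ge0 ?sqr_ge0.
  apply: mean_ge0Z; first by rewrite mulr_ge0 ?sqr_ge0.
  by split; [meas|move=> x; exact: sqr_ge0|exact: gauss1_moment2].
rewrite mulr1 mulrDr => <-.
by apply: eq_integral => x _; rewrite -EFinD; congr EFin; ring.
Qed.

Section gaussian_vector.
Context {R : realType} {d : measure_display} {T : measurableType d}.
Variable P : probability T R.
Local Notation gamma := (@gauss1 R).

(** Normal laws and point masses are all affine images of the standard Gaussian, with [s = 0] in the
    degenerate case; no case distinction is left afterwards. *)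
Lemma gaussian_law_integral (Y : T -> R) : measurable_fun setT Y -> is_gaussian P Y ->
  exists m s : R, 0 <= s /\ forall f : R -> \bar R, measurable_fun setT f ->
    (forall x, 0 <= f x)%E -> (\int[P]_w f (Y w) = \int[gamma]_x f (m + s * x)%R)%E.
Proof.
move=> mY [m [s ms]]; exists m, `|s|; split => // f mf f0.
have maff : measurable_fun setT (fun x : R => m + `|s| * x) by meas.
rewrite -(ge0_integral_pushp P mY)// -(ge0_integral_pushp gamma maff)//.
apply: eq_measure_integral => A mA _.
rewrite [LHS]pushpE [LHS]ms// /gaussian_law [RHS]pushpE; case: eqVneq => [->|s0].
  rewrite normr0 diracE; have [mA'|mA'] := boolP (m \in A).
    rewrite (_ : _ @^-1` A = setT) ?probability_setT//; apply/seteqP; split => // x _ /=.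
    by rewrite mul0r addr0; exact/set_mem.
  rewrite (_ : _ @^-1` A = set0) ?measure0//; apply/seteqP; split => // x /=.
  by rewrite mul0r addr0 => Am; move: mA'; rewrite mem_set.
by rewrite normal_prob_affine.
Qed.

Variables (p : nat) (X : {RV P >-> p.-tuple R}).

Let mX : measurable_fun setT X. Proof. exact: measurable_funPT. Qed.

Let mdot u : measurable_fun setT (fun w => dot u (X w)).
Proof. exact: (measurableT_comp (measurable_dot u) mX). Qed.

Let unitv (i : 'I_p) : p.-tuple R := [tuple (j == i)%:R | j < p].

Let dot_unitv i x : dot (unitv i) x = tnth x i.
Proof.
rewrite /dot (bigD1 i)//= tnth_mktuple eqxx mul1r big1 ?addr0// => j /negbTE ji.
by rewrite tnth_mktuple ji mul0r.
Qed.

(** Each linear form has some Gaussian law, whose two parameters are read off the moments. Means of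
    squares come directly from that law; the others follow by polarisation, from
    [Y = ((1 + Y)^2 - Y^2 - 1) / 2] and from the squares of [X_i + X_j], [X_i] and [X_j]. *)
Lemma gaussian_vector_dot (S : 'M[R]_p) (u : p.-tuple R) : centered_gaussian X S ->
  forall f : R -> \bar R, measurable_fun setT f -> (forall x, 0 <= f x)%E ->
  (\int[P]_w f (dot u (X w)) = \int[gamma]_x
     f (Num.sqrt (\sum_i \sum_j tnth u i * tnth u j * S i j) * x)%R)%E.
Proof.
move=> [gX cX covX].
have law (a : p.-tuple R) : exists m s : R, 0 <= s /\
    forall f : R -> \bar R, measurable_fun setT f -> (forall x, 0 <= f x)%E ->
    (\int[P]_w f (dot a (X w)) = \int[gamma]_x f (m + s * x)%R)%E.
  apply: gaussian_law_integral => //.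
  have := gX (\col_i tnth a i); congr is_gaussian; apply/funext => w.
  by rewrite mxE; apply: eq_bigr => i _; rewrite !mxE.
have sq a t m s : (forall f : R -> \bar R, measurable_fun setT f -> (forall x, 0 <= f x)%E ->
    (\int[P]_w f (dot a (X w)) = \int[gamma]_x f (m + s * x)%R)%E) ->
    has_mean P (fun w => (t + dot a (X w)) ^+ 2) ((t + m) ^+ 2 + s ^+ 2).
  move=> lawa; apply: has_mean_ge0; split; last 2 first.
  - by move=> w; exact: sqr_ge0.
  - rewrite (lawa (fun y => ((t + y) ^+ 2)%:E)).
    + have [_ _ <-] := gauss1_mean_sq (t + m) s.
      by apply: eq_integral => x _; rewrite addrA.
    + by meas.
    + by move=> y; rewrite lee_fin sqr_ge0.
  - by apply: measurable_funX; apply: measurable_funD => //; exact: mdot.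
have sq0 a : exists q, has_mean P (fun w => dot a (X w) ^+ 2) q.
  have [m [s [_ /(sq a 0) h]]] := law a; exists (m ^+ 2 + s ^+ 2).
  by apply: eq_has_mean h => [w|]; rewrite add0r.
have mean1 a m s : (forall f : R -> \bar R, measurable_fun setT f -> (forall x, 0 <= f x)%E ->
    (\int[P]_w f (dot a (X w)) = \int[gamma]_x f (m + s * x)%R)%E) ->
    has_mean P (fun w => dot a (X w)) m.
  move=> lawa; have h1 := sq a 1 m s lawa; have h0 := sq a 0 m s lawa.
  have c1 := has_mean_ge0 (mean_ge0_cst P ler01).
  have := has_meanZ 2^-1 (has_meanD (has_meanD h1 (has_meanZ (-1) h0)) (has_meanZ (-1) c1)).
  by apply: eq_has_mean => [w|] /=; field.
have X0 i : has_mean P (fun w => tnth (X w) i) 0.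
  have [m [s [_ /mean1]]] := law (unitv i) => h.
  have {}h : has_mean P (fun w => tnth (X w) i) m.
    by apply: eq_has_mean h => // w; rewrite dot_unitv.
  have := cX i; rewrite unlock; case: (h) => _ -> [m0].
  by rewrite -m0.
have XX i j : has_mean P (fun w => tnth (X w) i * tnth (X w) j) (S i j).
  have [q1 h1] := sq0 (unitv i); have [q2 h2] := sq0 (unitv j).
  have [q3 h3] := sq0 [tuple tnth (unitv i) k + tnth (unitv j) k | k < p].
  have h : has_mean P (fun w => tnth (X w) i * tnth (X w) j) (2^-1 * (q3 + -1 * q1 + -1 * q2)).
    apply: eq_has_mean (has_meanZ 2^-1 (has_meanD (has_meanD h3 (has_meanZ (-1) h1)) (has_meanZ (-1) h2))) => // w.
    have -> : dot [tuple tnth (unitv i) k + tnth (unitv j) k | k < p] (X w) =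
        tnth (X w) i + tnth (X w) j.
      rewrite -!dot_unitv /dot -big_split/=; apply: eq_bigr => k _.
      by rewrite tnth_mktuple mulrDl.
    by rewrite !dot_unitv; field.
  have := covX i j; rewrite unlock !cX/= unlock.
  rewrite (eq_integral (fun w => (tnth (X w) i * tnth (X w) j)%:E)); last first.
    move=> w _; congr EFin.
    transitivity ((tnth (X w) i - 0) * (tnth (X w) j - 0)) => //.
    by rewrite !subr0.
  by case: (h) => _ -> [<-].
have [m [s [s0 lawu]]] := law u.
have m0 : m = 0.
  apply: has_mean_unique (mean1 _ _ _ lawu) _.
  have := has_mean_sum (fun i => has_meanZ (tnth u i) (X0 i)).
  by apply: eq_has_mean => //; rewrite big1// => i _; rewrite mulr0.
have s2 : s ^+ 2 = \sum_i \sum_j tnth u i * tnth u j * S i j.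
  have := sq u 0 m s lawu; rewrite m0 add0r expr0n add0r => /has_mean_unique; apply.
  have := has_mean_sum (fun i => has_mean_sum (fun j => has_meanZ (tnth u i * tnth u j) (XX i j))).
  apply: eq_has_mean => // w; rewrite add0r expr2 /dot mulr_suml; apply: eq_bigr => i _.
  by rewrite mulr_sumr; apply: eq_bigr => j _; ring.
move=> f mf f0; rewrite lawu// -s2 sqrtr_sqr ger0_norm// m0.
by apply: eq_integral => x _; rewrite add0r.
Qed.

Definition mxapp (B : 'M[R]_p) (g : p.-tuple R) : p.-tuple R :=
  [tuple \sum_j B i j * tnth g j | i < p].

Lemma col_of_mxapp B g : col_of_tuple (mxapp B g) = B *m col_of_tuple g.
Proof.
apply/colP => i; rewrite !mxE tnth_mktuple; apply: eq_bigr => j _.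
by rewrite mxE.
Qed.

Lemma measurable_mxapp B : measurable_fun setT (mxapp B).
Proof.
apply/measurable_fun_tnthP => i.
rewrite (_ : _ \o _ = fun g : p.-tuple R => \sum_j B i j * tnth g j); last first.
  by apply/funext => g /=; rewrite tnth_mktuple.
by apply: measurable_sum => j; apply: measurable_funM => //; exact: measurable_tnth.
Qed.

(** By [cramer_wold] only linear forms matter, and on both sides the form [u] is a centered Gaussian
    of variance [|u B|^2]. Any factor [B] of the covariance will do: a common one, up to a diagonal
    matrix, serves [x0] and [x1], and a rotation serves [y]. *)
Theorem gaussian_vector_law (B : 'M[R]_p) : centered_gaussian X (B *m B^T) ->
  forall A, measurable A -> P (X @^-1` A) = ipro gamma p (mxapp B @^-1` A).
Proof.
move=> cg A mA.
rewrite -(pushpE P mX) -(pushpE (ipro gamma p) (measurable_mxapp B)).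
apply: cramer_wold => // u r.
have mc (a : p.-tuple R) : measurable_fun setT (fun x => (1 + cos (dot a x - r))%:E).
  apply/measurable_EFinP/measurable_funD => //; apply: measurable_cos_fun.
  by apply: measurable_funB => //; exact: measurable_dot.
have mc1 : measurable_fun setT (fun x : R => (1 + cos (x - r))%:E : \bar R).
  by apply/measurable_EFinP/measurable_funD => //; apply: measurable_cos_fun; meas.
have pos (a : p.-tuple R) (x : p.-tuple R) : (0 <= (1 + cos (dot a x - r))%:E)%E.
  by rewrite lee_fin cosD1_ge0.
apply: (etrans (ge0_integral_pushp P mX (mc u) (pos u))).
apply/esym; apply: (etrans (ge0_integral_pushp (ipro gamma p) (measurable_mxapp B) (mc u) (pos u))).
pose v : p.-tuple R := [tuple \sum_i tnth u i * B i j | j < p].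
have uBv g : dot u (mxapp B g) = dot v g.
  rewrite /dot; under eq_bigr do rewrite tnth_mktuple mulr_sumr.
  rewrite exchange_big/=; apply: eq_bigr => j _; rewrite tnth_mktuple mulr_suml.
  by apply: eq_bigr => i _; rewrite mulrA.
have vv : \sum_i \sum_j tnth u i * tnth u j * (B *m B^T) i j = \sum_i tnth v i ^+ 2.
  under eq_bigr => i _ do under eq_bigr => j _ do rewrite mxE mulr_sumr.
  under [RHS]eq_bigr => k _ do rewrite tnth_mktuple expr2 mulr_suml.
  under eq_bigr => i _ do rewrite exchange_big/=.
  rewrite exchange_big/=; apply: eq_bigr => k _; apply: eq_bigr => i _.
  by rewrite mulr_sumr; apply: eq_bigr => j _; rewrite mxE; ring.
have pos1 (x : R) : (0 <= (1 + cos (x - r))%:E)%E by rewrite lee_fin cosD1_ge0.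
have := gaussian_vector_dot u cg mc1 pos1; rewrite vv => h.
apply: (etrans _ (esym h)); apply: (etrans _ (integral_dot_gauss v mc1 pos1)).
by apply: eq_integral => g _; rewrite uBv.
Qed.

End gaussian_vector.

(** * Hellinger affinity and total variation *)

Section hellinger.
Context {R : realType}.
Local Notation mu := (@lebesgue_measure R).
Local Notation gamma := (@gauss1 R).
Local Notation K := (normal_peak (1 : R)).

Definition scale n (s g : n.-tuple R) : n.-tuple R := [tuple tnth s i * tnth g i | i < n].

Lemma scale_cons n k (s : n.-tuple R) x (g : n.-tuple R) :
  scale [tuple of k :: s] [tuple of x :: g] = [tuple of k * x :: scale s g].
Proof.
apply: eq_from_tnth => i; case: (unliftP ord0 i) => [j ->|->].
  by rewrite tnthS !tnth_mktuple !tnthS.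
by rewrite tnth_mktuple !tnth0.
Qed.

Lemma measurable_scale n (s : n.-tuple R) : measurable_fun setT (scale s).
Proof.
apply/measurable_fun_tnthP => i.
rewrite (_ : _ \o _ = fun g : n.-tuple R => tnth s i * tnth g i); last first.
  by apply/funext => g /=; rewrite tnth_mktuple.
by apply: measurable_funM => //; exact: measurable_tnth.
Qed.

(* The Hellinger affinity of the centered Gaussians with deviations [1] and [s]. *)
Definition affinity (s : R) : R := Num.sqrt (2 * s / (1 + s ^+ 2)).

Lemma affinity_gt0 s : 0 < s -> 0 < affinity s.
Proof.
by move=> s0; rewrite sqrtr_gt0 divr_gt0 ?mulr_gt0// ltr_pwDl// sqr_ge0.
Qed.

Lemma affinity_sq s : 0 < s -> affinity s ^+ 2 = 2 * s / (1 + s ^+ 2).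
Proof.
by move=> s0; rewrite sqr_sqrtr// divr_ge0 ?mulr_ge0 ?addr_ge0 ?sqr_ge0// ltW.
Qed.

Let p (x : R) : R := K * expR (- x ^+ 2 / 2).

Let K0 : 0 < K. Proof. by rewrite normal_peak_gt0// oner_neq0. Qed.

Let p0 x : 0 < p x. Proof. by rewrite mulr_gt0// expR_gt0. Qed.

Let mp : measurable_fun setT p. Proof. by rewrite /p; meas. Qed.

Let integral_p (c : R) : 0 < c -> (\int[mu]_x (p (x / c) / c)%:E = 1)%E.
Proof.
move=> c0; have c1 : 0 < c^-1 by rewrite invr_gt0.
transitivity (\int[mu]_x (p x)%:E)%E; last first.
  have -> : (1 = \int[gamma]_x (1 : \bar R))%E by rewrite integral_cst//= probability_setT mule1.
  by rewrite gauss1E//; apply: eq_integral => x _; rewrite mul1e.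
rewrite -[RHS](@ge0_integral_affine R 0 c^-1)//; last 2 first.
- by apply/measurable_EFinP; exact: mp.
- by move=> x; rewrite lee_fin ltW.
by apply: eq_integral => x _; rewrite EFinM add0r mulrC.
Qed.

Let gauss_scale (s : R) (f : R -> \bar R) : 0 < s -> measurable_fun setT f ->
  (forall x, 0 <= f x)%E ->
  (\int[gamma]_x f (s * x)%R = \int[mu]_x (f x * (p (x / s) / s)%:E))%E.
Proof.
move=> s0 mf f0; have s1 : 0 < s^-1 by rewrite invr_gt0.
have mfs : measurable_fun setT (fun x : R => f (s * x)) by apply: (measurableT_comp mf); meas.
rewrite gauss1E// -[LHS](@ge0_integral_affine R 0 s^-1)//; last 2 first.
- by apply: emeasurable_funM => //; apply/measurable_EFinP; exact: mp.
- by move=> x; rewrite mule_ge0// lee_fin ltW//; exact: p0.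
apply: eq_integral => x _; rewrite add0r mulVKf ?gt_eqF// -muleA -EFinM.
by rewrite [s^-1 * x]mulrC.
Qed.

Let measurable_tcons_l n (x : R) : measurable_fun setT (fun t : n.-tuple R => [tuple of x :: t]).
Proof. exact: measurable_tconsl. Qed.

Lemma two_le_add (a b : R) : 0 <= a -> 0 <= b -> 1 <= a * b -> 2 <= a + b.
Proof. by move=> a0 b0 ab; have := sqr_ge0 (a - b); nra. Qed.

(** A dual form of the affinity, without densities on the product space: where [u v >= 1], the
    inequality of means bounds the sum of the two integrals from below. In this form it tensorises,
    as the bound for the remaining coordinates is integrated over the first one. *)
Lemma hellinger_bound n (s : n.-tuple R) (u v : n.-tuple R -> R) :
  (forall i, 0 < tnth s i) -> measurable_fun setT u -> measurable_fun setT v ->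
  (forall x, 0 <= u x) -> (forall x, 0 <= v x) -> (forall x, 1 <= u x * v x) ->
  ((2 * \prod_(i < n) affinity (tnth s i))%:E <=
   \int[ipro gamma n]_x (u x)%:E + \int[ipro gamma n]_x (v (scale s x))%:E)%E.
Proof.
elim/tcons_ind: n / s u v => [|n k s IH] u v s0 mu' mv u0 v0 uv.
  have m1 : measurable_fun setT (fun x : 0.-tuple R => (u x)%:E) by exact/measurable_EFinP.
  have m2 : measurable_fun setT (fun x : 0.-tuple R => (v (scale [tuple] x))%:E).
    by apply/measurable_EFinP; exact: (measurableT_comp mv (measurable_scale _)).
  rewrite !ge0_integral_ipro0// big_ord0 mulr1 -EFinD lee_fin [scale _ _]tuple0.
  exact: two_le_add.
have k0 : 0 < k by have := s0 ord0; rewrite tnth0.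
have s0' i : 0 < tnth s i by have := s0 (lift ord0 i); rewrite tnthS.
have rE : \prod_(i < n.+1) affinity (tnth [tuple of k :: s] i) =
    affinity k * \prod_(i < n) affinity (tnth s i).
  by rewrite big_ord_recl tnth0; congr (_ * _); apply: eq_bigr => i _; rewrite tnthS.
pose r := affinity k; have r0 : 0 < r := affinity_gt0 k0.
(* The geometric mean [h] of the Gaussian densities of deviations 1 and [k] is [r] times a Gaussian
   density, of deviation [c] such that [2 / c ^+ 2 = 1 + 1 / k ^+ 2]. *)
pose c : R := Num.sqrt k * r; have c0 : 0 < c by rewrite mulr_gt0// sqrtr_gt0.
have c2 : c ^+ 2 = k * r ^+ 2 by rewrite exprMn sqr_sqrtr// ltW.
have c2' : c ^+ 2 = 2 * k ^+ 2 / (1 + k ^+ 2) by rewrite c2 affinity_sq//; ring.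
pose h (x : R) : R := r * (p (x / c) / c); have h0 x : 0 < h x by rewrite mulr_gt0// divr_gt0.
have pp x : p x * (p (x / k) / k) = h x ^+ 2.
  have kk : 1 + k ^+ 2 != 0 by rewrite gt_eqF// ltr_pwDl// sqr_ge0.
  have e1 : expR (- x ^+ 2 / 2) * expR (- (x / k) ^+ 2 / 2) = expR (- (x / c) ^+ 2 / 2) ^+ 2.
    rewrite [RHS]expr2 -!expRD; congr expR; rewrite !expr_div_n c2'.
    by field; rewrite kk gt_eqF.
  rewrite /h /p; move: (expR _) (expR _) (expR _) e1 => e e' e'' e1.
  rewrite (_ : (r * _) ^+ 2 = r ^+ 2 * K ^+ 2 * e ^+ 2 / c ^+ 2); last by field; rewrite gt_eqF.
  by rewrite c2 -e1; field; rewrite !gt_eqF.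
(* The two densities at [x] are [h q] and [h / q]. Moving [q] into [u] and its inverse into [v]
   keeps the product at least 1, so the induction hypothesis applies for each [x]. *)
pose q (x : R) : R := p x / h x; have q0 x : 0 < q x by rewrite divr_gt0.
have pE x : p x = h x * q x by rewrite /q mulrC divfK// gt_eqF.
have pkE x : p (x / k) / k = h x * (q x)^-1.
  apply: (mulfI (lt0r_neq0 (p0 x))); rewrite pp /q.
  by move: (p x) (h x) (p0 x) (h0 x) => a b a0 b0; field; rewrite !gt_eqF.
pose U x := (\int[ipro gamma n]_t (u [tuple of x :: t])%:E)%E.
pose V x := (\int[ipro gamma n]_t (v [tuple of x :: scale s t])%:E)%E.
have muE : measurable_fun setT (fun x => (u x)%:E) by exact/measurable_EFinP.
have u0E t : (0 <= (u t)%:E)%E by rewrite lee_fin.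
have mU : measurable_fun setT U := measurable_integral_tcons gamma muE u0E.
have U0 x : (0 <= U x)%E by apply: integral_ge0 => t _; rewrite lee_fin.
pose one_s := [tuple of 1 :: s].
have mvs : measurable_fun setT (fun x => (v (scale one_s x))%:E).
  by apply/measurable_EFinP; exact: (measurableT_comp mv (measurable_scale _)).
have v0E t : (0 <= (v (scale one_s t))%:E)%E by rewrite lee_fin.
have mV : measurable_fun setT V.
  rewrite (_ : V = fun x => \int[ipro gamma n]_t (v (scale one_s (tcons (x, t))))%:E)%E.
    exact: (@measurable_integral_tcons _ _ _ gamma n (fun x => (v (scale one_s x))%:E) mvs v0E).
  by apply/funext => x; apply: eq_integral => t _; rewrite scale_cons mul1r.
have V0 x : (0 <= V x)%E by apply: integral_ge0 => t _; rewrite lee_fin.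
have mh : measurable_fun setT h.
  apply: measurable_funM => //; apply: measurable_funM => //.
  by apply: (measurableT_comp mp); meas.
have mpx (g : R -> R) : measurable_fun setT g -> measurable_fun setT (fun x : R => p (g x)).
  by move=> mg; exact: (measurableT_comp mp mg).
have mq : measurable_fun setT q.
  by apply: measurable_funM => //; exact: (measurableT_comp measurable_fun_inv mh).
have m1 : measurable_fun setT (fun x : R => U x * (p x)%:E)%E.
  by apply: emeasurable_funM => //; exact/measurable_EFinP.
have m2 : measurable_fun setT (fun x : R => V x * (p (x / k) / k)%:E)%E.
  apply: emeasurable_funM => //; apply/measurable_EFinP; apply: measurable_funM => //.
  by apply: mpx; meas.
have mvk : measurable_fun setT (fun x => (v (scale [tuple of k :: s] x))%:E).
  by apply/measurable_EFinP; exact: (measurableT_comp mv (measurable_scale _)).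
have -> : (\int[ipro gamma n.+1]_x (u x)%:E = \int[mu]_x (U x * (p x)%:E))%E.
  by rewrite ge0_integral_iproS// gauss1E.
have -> : (\int[ipro gamma n.+1]_x (v (scale [tuple of k :: s] x))%:E =
    \int[mu]_x (V x * (p (x / k) / k)%:E))%E.
  rewrite ge0_integral_iproS//; last by move=> t; rewrite lee_fin.
  rewrite -gauss_scale//; apply: eq_integral => x _; apply: eq_integral => t _.
  by rewrite scale_cons.
rewrite -ge0_integralD//; last 2 first.
- by move=> x _; rewrite mule_ge0// lee_fin ltW.
- by move=> x _; rewrite mule_ge0// lee_fin -/p pkE mulr_ge0 ?invr_ge0// ltW.
rewrite rE; set pr := \prod_(i < n) _.
have pr0 : 0 <= pr by apply: prodr_ge0 => i _; rewrite ltW// affinity_gt0.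
have -> : ((2 * (affinity k * pr))%:E = \int[mu]_x ((2 * pr * h x)%:E))%E.
  transitivity (\int[mu]_x ((2 * pr * r)%:E * (p (x / c) / c)%:E))%E; last first.
    by apply: eq_integral => x _; rewrite -EFinM /h; congr EFin; ring.
  rewrite ge0_integralZl//; last 3 first.
  - apply/measurable_EFinP; apply: measurable_funM => //.
    by apply: mpx; meas.
  - by move=> x _; rewrite lee_fin divr_ge0// ltW.
  - by rewrite lee_fin !mulr_ge0// ltW.
  by rewrite integral_p// mule1; congr EFin; rewrite /r; ring.
apply: ge0_le_integral => //.
- by move=> x _; rewrite lee_fin; apply: mulr_ge0; [rewrite mulr_ge0|exact: ltW (h0 x)].
- by apply/measurable_EFinP; apply: measurable_funM => //; exact: mh.
- exact: emeasurable_funD.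
move=> x _; rewrite pkE [p x]pE (EFinM (h x) (q x)) (EFinM (h x) (q x)^-1) (EFinM (2 * pr) (h x)).
have := IH (fun t => q x * u [tuple of x :: t]) (fun t => (q x)^-1 * v [tuple of x :: t]) s0'.
have mux : measurable_fun setT (fun t : n.-tuple R => u [tuple of x :: t]).
  exact: (measurableT_comp mu' (measurable_tcons_l x)).
have mvx : measurable_fun setT (fun t : n.-tuple R => v [tuple of x :: t]).
  exact: (measurableT_comp mv (measurable_tcons_l x)).
have q1 : 0 <= (q x)^-1 by rewrite invr_ge0 ltW.
have q00 : 0 <= q x by rewrite ltW.
move=> /(_ (measurable_funM (measurable_cst _) mux) (measurable_funM (measurable_cst _) mvx)).
move=> /(_ (fun t => mulr_ge0 q00 (u0 _)) (fun t => mulr_ge0 q1 (v0 _))).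
have uvq (t : n.-tuple R) : 1 <= q x * u [tuple of x :: t] * ((q x)^-1 * v [tuple of x :: t]).
  have qn : q x != 0 by rewrite gt_eqF.
  by rewrite mulrACA mulfV// mul1r; exact: uv.
move=> /(_ uvq).
have -> : (\int[ipro gamma n]_t (q x * u [tuple of x :: t])%:E = (q x)%:E * U x)%E.
  under eq_integral do rewrite EFinM.
  by rewrite ge0_integralZl//; exact/measurable_EFinP.
have -> : (\int[ipro gamma n]_t ((q x)^-1 * v [tuple of x :: scale s t])%:E = (q x)^-1%:E * V x)%E.
  under eq_integral do rewrite EFinM.
  rewrite ge0_integralZl//.
  by apply/measurable_EFinP; exact: (measurableT_comp mvx (measurable_scale s)).
  by move=> t _; rewrite lee_fin.
move=> main.
have hx : (0 <= (h x)%:E)%E by rewrite lee_fin ltW.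
have := lee_wpmul2l hx main; rewrite ge0_muleDr ?mule_ge0 ?lee_fin//.
rewrite -/pr => main2.
rewrite [X in (_ <= X + _)%E]muleC [X in (_ <= _ + X)%E]muleC -!muleA [leLHS]muleC.
exact: main2.
Qed.

(* Half of the total variation distance to the Hellinger affinity: [u] and [v]
   are reciprocal up to the two values taken on [A] and its complement. *)
Lemma scale_gauss_tv n (s : n.-tuple R) (A : set (n.-tuple R)) :
  (forall i, 0 < tnth s i) -> measurable A ->
  (fine (ipro gamma n (scale s @^-1` A)) - fine (ipro gamma n A)) ^+ 2 <=
  1 - \prod_(i < n) affinity (tnth s i) ^+ 2.
Proof.
move=> s0 mA.
have mB : measurable (scale s @^-1` A).
  by rewrite -[X in measurable X]setTI; exact: (measurable_scale s).
set a := fine (ipro gamma n A); set b := fine (ipro gamma n (scale s @^-1` A)).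
have aE : ipro gamma n A = a%:E by rewrite fineK// fin_num_measure.
have bE : ipro gamma n (scale s @^-1` A) = b%:E by rewrite fineK// fin_num_measure.
have a01 : 0 <= a <= 1.
  by rewrite -!lee_fin -aE measure_ge0 probability_le1.
have b01 : 0 <= b <= 1.
  by rewrite -!lee_fin -bE measure_ge0 probability_le1.
pose w (x y : R) (t : n.-tuple R) := x * \1_A t + y * \1_(~` A) t.
have mw x y : measurable_fun setT (w x y).
  by apply: measurable_funD; apply: measurable_funM => //; apply: measurable_indic => //;
    exact: measurableC.
have wE x y t : w x y t = if t \in A then x else y.
  rewrite /w !indicE in_setC; case: (t \in A); by rewrite /= ?mulr1 ?mulr0 ?addr0 ?add0r.
set rho := \prod_(i < n) affinity (tnth s i).
have int_w x y : 0 <= x -> 0 <= y ->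
    (\int[ipro gamma n]_t (w x y t)%:E = (x * a + y * (1 - a))%:E)%E /\
    (\int[ipro gamma n]_t (w x y (scale s t))%:E = (x * b + y * (1 - b))%:E)%E.
  move=> x0 y0.
  have h (C : set (n.-tuple R)) (r : R) : measurable C -> ipro gamma n C = r%:E ->
      (\int[ipro gamma n]_t (x * \1_C t + y * \1_(~` C) t)%:E = (x * r + y * (1 - r))%:E)%E.
    move=> mC Cr.
    have m1 : mean_ge0 (ipro gamma n) (\1_C : _ -> R) r.
      split; [exact: measurable_indic|by move=> t; rewrite indicE|].
      by rewrite integral_indic// setIT.
    have m2 : mean_ge0 (ipro gamma n) (\1_(~` C) : _ -> R) (1 - r).
      split; [exact/measurable_indic/measurableC|by move=> t; rewrite indicE|].
      rewrite integral_indic//; last exact: measurableC.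
      rewrite setIT; apply: (etrans (probability_setC (ipro gamma n) mC)).
      by rewrite Cr EFinB.
    by have [_ _ ->] := mean_ge0D (mean_ge0Z x0 m1) (mean_ge0Z y0 m2).
  split; first exact: h.
  by rewrite -(h _ _ mB bE); apply: eq_integral => t _; rewrite /w !indicE.
have main x y : 0 < x -> 0 < y -> 2 * rho <= x * a + y * (1 - a) + (x^-1 * b + y^-1 * (1 - b)).
  move=> x0 y0; have x1 : 0 < x^-1 by rewrite invr_gt0.
  have y1 : 0 < y^-1 by rewrite invr_gt0.
  have [e1 _] := int_w x y (ltW x0) (ltW y0); have [_ e2] := int_w x^-1 y^-1 (ltW x1) (ltW y1).
  rewrite -lee_fin EFinD -e1 -e2; apply: hellinger_bound => //.
  - by move=> t; rewrite wE; case: ifP => _; exact: ltW.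
  - by move=> t; rewrite wE; case: ifP => _; exact: ltW.
  - by move=> t; rewrite !wE; case: ifP => _; rewrite mulfV// gt_eqF.
have rho0 : 0 <= rho by apply: prodr_ge0 => i _; rewrite ltW// affinity_gt0.
(* The best weights have [x ^+ 2 = b / a] on [A] and [y ^+ 2 = (1 - b) / (1 - a)] on its complement.
   Adding [e] to the four probabilities keeps these quotients defined and positive; [e] is taken
   small at the end. *)
have key e : 0 < e -> (b - a) ^+ 2 <= (1 + 2 * e) ^+ 2 - rho ^+ 2.
  move=> e0; case/andP: a01 => a0 a1; case/andP: b01 => b0 b1.
  have sq2 (X Y : R) : 0 < X -> 0 < Y -> exists2 z, 0 < z &
      z * X + z^-1 * Y = 2 * (Num.sqrt X * Num.sqrt Y).
    move=> X0 Y0; exists (Num.sqrt Y / Num.sqrt X); first by rewrite divr_gt0 ?sqrtr_gt0.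
    have X1 : 0 < Num.sqrt X by rewrite sqrtr_gt0.
    have Y1 : 0 < Num.sqrt Y by rewrite sqrtr_gt0.
    rewrite -{2}(sqr_sqrtr (ltW X0)) -{3}(sqr_sqrtr (ltW Y0)).
    by field; rewrite !gt_eqF.
  have A0 : 0 < a + e by rewrite ltr_wpDl.
  have A0' : 0 < 1 - a + e by rewrite ltr_wpDl// subr_ge0.
  have B0 : 0 < b + e by rewrite ltr_wpDl.
  have B0' : 0 < 1 - b + e by rewrite ltr_wpDl// subr_ge0.
  have [x x0 xE] := sq2 _ _ A0 B0; have [y y0 yE] := sq2 _ _ A0' B0'.
  have h := main x y x0 y0.
  have x1 : 0 < x^-1 by rewrite invr_gt0.
  have y1 : 0 < y^-1 by rewrite invr_gt0.
  have := sqr_sqrtr (ltW A0); have := sqr_sqrtr (ltW B0).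
  have := sqr_sqrtr (ltW A0'); have := sqr_sqrtr (ltW B0').
  have := sqrtr_ge0 (a + e); have := sqrtr_ge0 (b + e).
  have := sqrtr_ge0 (1 - a + e); have := sqrtr_ge0 (1 - b + e).
  move: (Num.sqrt (a + e)) (Num.sqrt (b + e)) (Num.sqrt (1 - a + e)) (Num.sqrt (1 - b + e)) xE yE.
  move=> X Y X' Y' xE yE Y'0 X'0 Y0 X0 Y'2 X'2 Y2 X2.
  have rle : rho <= X * Y + X' * Y'.
    have p1 := mulr_gt0 x0 e0; have p2 := mulr_gt0 y0 e0.
    have p3 := mulr_gt0 x1 e0; have p4 := mulr_gt0 y1 e0.
    by clear -h xE yE p1 p2 p3 p4; lra.
  have : rho ^+ 2 <= (X * Y + X' * Y') ^+ 2.
    by rewrite lerXn2r// nnegrE// addr_ge0// mulr_ge0.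
  have cs := sqr_ge0 (X * X' - Y * Y').
  have := sqr_ge0 (X * Y' - Y * X').
  move=> _ r2; apply: (@le_trans _ _ ((1 + 2 * e) ^+ 2 - (X * Y + X' * Y') ^+ 2)); last first.
    by rewrite lerD2l lerN2.
  (* Since [X ^+ 2 + X' ^+ 2 = Y ^+ 2 + Y' ^+ 2], the difference of the two sides is exactly a
     square. *)
  rewrite -subr_ge0 [leRHS](_ : _ = (X * X' - Y * Y') ^+ 2)//.
  have -> : b - a = Y ^+ 2 - X ^+ 2 by rewrite Y2 X2; ring.
  have e2 : 1 + 2 * e = X ^+ 2 + X' ^+ 2 by rewrite X2 X'2; ring.
  have e3 : Y' ^+ 2 = X ^+ 2 + X' ^+ 2 - Y ^+ 2 by rewrite X2 X'2 Y'2 Y2; ring.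
  rewrite e2; apply/eqP; rewrite -subr_eq0; apply/eqP.
  transitivity ((X ^+ 2 + X' ^+ 2) ^+ 2 - X ^+ 2 * Y ^+ 2 - X' ^+ 2 * Y' ^+ 2 -
      (Y ^+ 2 - X ^+ 2) ^+ 2 - X ^+ 2 * X' ^+ 2 - Y ^+ 2 * Y' ^+ 2); first by ring.
  by rewrite e3; ring.
rewrite prodrXl -/rho leNgt; apply/negP => lt1.
pose t := (b - a) ^+ 2 - (1 - rho ^+ 2); have t0 : 0 < t by rewrite subr_gt0.
have e0 : 0 < Num.min 1 (t / 16) by rewrite lt_min ltr01 divr_gt0.
have := key _ e0.
have : Num.min 1 (t / 16) <= 1 by rewrite ge_min lexx.
have : Num.min 1 (t / 16) <= t / 16 by rewrite ge_min lexx orbT.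
have tE : (b - a) ^+ 2 = t + (1 - rho ^+ 2) by rewrite /t subrK.
move: (Num.min _ _) e0 => e e0 e1 e2; rewrite tE => h.
by clear -t0 e0 e1 e2 h; nra.
Qed.

End hellinger.

(** * The logarithmic derivative of the determinant *)

Section logdet.
Context {R : realType}.

Lemma is_derive_prod_affine n (e : 'I_n -> R) (t : R) : (forall i, 1 + t * e i != 0) ->
  is_derive t 1 (fun r => \prod_(i < n) (1 + r * e i))
    ((\prod_(i < n) (1 + t * e i)) * \sum_(i < n) e i / (1 + t * e i)).
Proof.
elim: n e => [|n IH] e e0.
  rewrite !big_ord0 mulr0 (_ : (fun r => _) = cst 1); first exact: is_derive_cst.
  by apply/funext => r; rewrite big_ord0.
have h : is_derive t 1 (fun r : R => 1 + r * e ord0) (e ord0).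
  by apply: is_derive_eq; rewrite /GRing.scale/=; ring.
have := is_deriveM h (IH (fun i => e (lift ord0 i)) (fun i => e0 _)).
rewrite /GRing.scale/=.
rewrite (_ : (fun r => \prod_(i < n.+1) _) = (fun r => 1 + r * e ord0) *
    (fun r => \prod_(i < n) (1 + r * e (lift ord0 i)))); last first.
  by apply/funext => r; rewrite big_ord_recl.
move=> [dh hE]; split => //; rewrite hE !big_ord_recl.
move: (\prod_(i < n) _) (\sum_(i < n) _) => pr sm.
by field; exact: e0.
Qed.

Variables (p : nat) (B : 'M[R]_p) (d : 'rV[R]_p).
Hypothesis uB : B \in unitmx.
Hypothesis d0 : forall i, 0 < d 0 i.
Local Notation S0 := (B *m B^T).
Local Notation S1 := (B *m diag_mx d *m B^T).
Local Notation e i := (d 0 i - 1).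
Local Notation factors t := (\prod_(i < p) (1 + t * e i)).
Local Notation phi t := (\sum_(i < p) e i / (1 + t * e i)).

Lemma Sigma_diagE t : Sigma_ S0 S1 t = B *m diag_mx (\row_i (1 + t * e i)) *m B^T.
Proof.
have -> : diag_mx (\row_i (1 + t * e i)) = (1 - t) *: 1%:M + t *: diag_mx d.
  apply/matrixP => i j; rewrite !mxE; case: eqP => [->|_]; rewrite /= ?mulr1n ?mulr0n; ring.
by rewrite mulmxDr mulmxDl -!scalemxAr -!scalemxAl mulmx1.
Qed.

Lemma det_Sigma t : \det (Sigma_ S0 S1 t) = \det B ^+ 2 * factors t.
Proof.
rewrite Sigma_diagE !det_mulmx det_tr det_diag mulrAC -expr2; congr (_ * _).
by apply: eq_bigr => i _; rewrite mxE.
Qed.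

Lemma det_sq_gt0 : 0 < \det B ^+ 2.
Proof.
by rewrite lt_neqAle sqr_ge0 andbT eq_sym expf_neq0// -unitfE -unitmxE.
Qed.

Lemma factors_neq0 t : factors t != 0 -> forall i, 1 + t * e i != 0.
Proof. by move=> /prodf_neq0 h i; exact: h. Qed.

Lemma is_derive_det t : factors t != 0 ->
  is_derive t 1 (fun r => \det (Sigma_ S0 S1 r)) (\det (Sigma_ S0 S1 t) * phi t).
Proof.
move=> /factors_neq0 f0.
rewrite (_ : (fun r => _) = \det B ^+ 2 \*: (fun r => factors r)); last first.
  by apply/funext => r; rewrite det_Sigma.
by rewrite det_Sigma -mulrA; exact: is_deriveZ (is_derive_prod_affine f0).
Qed.

Lemma dlogdet_pos t : 0 < factors t -> dlogdet_Sigma S0 S1 t = phi t.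
Proof.
move=> f0; have fn0 : factors t != 0 by rewrite gt_eqF.
have det0 : 0 < \det (Sigma_ S0 S1 t) by rewrite det_Sigma mulr_gt0// det_sq_gt0.
have [dd dE] := is_derive1_comp (is_derive1_ln det0) (is_derive_det fn0).
rewrite /dlogdet_Sigma derive1E; apply: (etrans dE).
by rewrite mulrA mulVf ?mul1r// gt_eqF.
Qed.

(** Near such a [t] the determinant stays negative and [ln] takes its default value 0. These [t] lie
    outside [[0, 1]], but the values of [A_] there enter its measurability on the whole line. *)
Lemma dlogdet_neg t : factors t < 0 -> dlogdet_Sigma S0 S1 t = 0.
Proof.
move=> f0; have fn0 : factors t != 0 by rewrite lt_eqF.
have det0 : \det (Sigma_ S0 S1 t) < 0 by rewrite det_Sigma pmulr_rlt0// det_sq_gt0.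
have [dd _] := is_derive_det fn0.
have cont : {for t, continuous (fun r => \det (Sigma_ S0 S1 r))}.
  by move/derivable1_diffP: dd => /differentiable_continuous.
rewrite /dlogdet_Sigma derive1E (@near_eq_derive _ _ _ _ (cst 0)); first exact: derive_cst.
have : \forall r \near t, \det (Sigma_ S0 S1 r) < 0 by exact: (cvgr_lt _ cont).
by apply: filterS => r r0; rewrite ln0// ltW.
Qed.

Lemma inv_Sigma t : factors t != 0 -> invmx (Sigma_ S0 S1 t) =
  (invmx B)^T *m diag_mx (\row_i (1 + t * e i)^-1) *m invmx B.
Proof.
move=> /factors_neq0 f0.
pose D := diag_mx (\row_i (1 + t * e i)); pose D' := diag_mx (\row_i (1 + t * e i)^-1).
have DD : D *m D' = 1%:M.
  rewrite /D mulmx_diag; apply/matrixP => i j; rewrite !mxE.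
  by case: eqP => // _; rewrite mulr1n mulfV.
have h : Sigma_ S0 S1 t *m ((invmx B)^T *m D' *m invmx B) = 1%:M.
  rewrite Sigma_diagE -/D !mulmxA -(mulmxA (B *m D)) -trmx_mul mulVmx// trmx1 mulmx1.
  by rewrite -(mulmxA B) DD mulmx1 mulmxV.
have uS : Sigma_ S0 S1 t \in unitmx by case: (mulmx1_unit h).
by rewrite -[RHS](mulKmx uS) h mulmx1.
Qed.

Lemma trace_dlog t : factors t != 0 -> \tr (dlog_Sigma S0 S1 t) = phi t.
Proof.
move=> f0; rewrite /dlog_Sigma inv_Sigma//.
have -> : S1 - S0 = B *m diag_mx (\row_i e i) *m B^T.
  have -> : diag_mx (\row_i e i) = diag_mx d - 1%:M.
    apply/matrixP => i j; rewrite !mxE; case: eqP => [->|_]; rewrite /= ?mulr1n ?mulr0n; ring.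
  by rewrite mulmxBr mulmxBl mulmx1.
rewrite !mulmxA -(mulmxA _ B^T) -trmx_mul mulVmx// trmx1 mulmx1 mxtrace_mulC mulmxA.
rewrite mulmxA mulVmx// mul1mx mulmx_diag mxtrace_diag.
by apply: eq_bigr => i _; rewrite !mxE.
Qed.

Lemma factors_gt0 t : 0 < t < 1 -> 0 < factors t.
Proof.
move=> /andP[t0 t1]; apply: prodr_gt0 => i _.
have := mulr_gt0 t0 (d0 i); move: (d 0 i) => x; nra.
Qed.

(** [phi s - phi t] is [t - s] times a sum of squares with positive weights; two distinct zeros
    would make every [e i] vanish, hence [S0 = S1]. *)
Lemma phi_inj (s t : R) : S0 <> S1 -> 0 < s < 1 -> 0 < t < 1 -> phi s = 0 -> phi t = 0 -> s = t.
Proof.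
move=> neq s01 t01 ps pt; apply/eqP; apply: contraT => st.
have fs i : 1 + s * e i != 0 by apply: factors_neq0; rewrite gt_eqF// factors_gt0.
have ft i : 1 + t * e i != 0 by apply: factors_neq0; rewrite gt_eqF// factors_gt0.
have pos r i : 0 < r < 1 -> 0 < 1 + r * e i.
  move=> /andP[r0 r1]; have := mulr_gt0 r0 (d0 i); move: (d 0 i) => x; nra.
have h : \sum_(i < p) e i ^+ 2 / ((1 + s * e i) * (1 + t * e i)) = 0.
  apply: (mulfI (_ : t - s != 0)); first by rewrite subr_eq0 eq_sym.
  rewrite mulr0 mulr_sumr; transitivity (phi s - phi t); last by rewrite ps pt subrr.
  rewrite -sumrB.
  by apply: eq_bigr => i _; field; rewrite fs ft.
case: neq; have -> : diag_mx d = 1%:M; last by rewrite mulmx1.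
have p0 i : true -> 0 <= e i ^+ 2 / ((1 + s * e i) * (1 + t * e i)).
  by move=> _; rewrite divr_ge0 ?sqr_ge0// mulr_ge0// ltW// pos.
have e0 i : e i = 0.
  have /psumr_eq0P/(_ h) := p0; move=> /(_ i isT) /eqP.
  rewrite mulf_eq0 invr_eq0 sqrf_eq0 mulf_eq0 (negbTE (fs i)) (negbTE (ft i)) !orbF.
  by move/eqP.
apply/matrixP => i j; rewrite !mxE; case: eqP => // _.
by rewrite mulr1n; apply/eqP; rewrite -subr_eq0 e0.
Qed.

Lemma trace_ratio : \tr (1%:M - 2^-1 *: (S0 *m invmx S1 + invmx S0 *m S1)) =
  - (2^-1 * \sum_(i < p) (d 0 i + (d 0 i)^-1 - 2)).
Proof.
pose D := diag_mx d; pose D' := diag_mx (\row_i (d 0 i)^-1).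
have DD : D *m D' = 1%:M.
  rewrite /D mulmx_diag; apply/matrixP => i j; rewrite !mxE.
  by case: eqP => // _; rewrite mulr1n mulfV// gt_eqF.
have uD : D \in unitmx by case: (mulmx1_unit DD).
have uS0 : S0 \in unitmx by rewrite unitmx_mul unitmx_tr uB.
have uS1 : S1 \in unitmx by rewrite !unitmx_mul unitmx_tr uB uD.
have i1 : invmx S1 = (invmx B)^T *m D' *m invmx B.
  have h : S1 *m ((invmx B)^T *m D' *m invmx B) = 1%:M.
    rewrite !mulmxA -(mulmxA (B *m D)) -trmx_mul mulVmx// trmx1 mulmx1.
    by rewrite -(mulmxA B) DD mulmx1 mulmxV.
  by rewrite -[RHS](mulKmx uS1) h mulmx1.
have i0 : invmx S0 = (invmx B)^T *m invmx B.
  have h : S0 *m ((invmx B)^T *m invmx B) = 1%:M.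
    by rewrite !mulmxA -(mulmxA B) -trmx_mul mulVmx// trmx1 mulmx1 mulmxV.
  by rewrite -[RHS](mulKmx uS0) h mulmx1.
rewrite linearB/= linearZ/= linearD/= mxtrace1.
have -> : \tr (S0 *m invmx S1) = \sum_(i < p) (d 0 i)^-1.
  rewrite i1 !mulmxA -(mulmxA B) -trmx_mul mulVmx// trmx1 mulmx1 mxtrace_mulC mulmxA.
  by rewrite mulVmx// mul1mx mxtrace_diag; apply: eq_bigr => i _; rewrite mxE.
have -> : \tr (invmx S0 *m S1) = \sum_(i < p) d 0 i.
  rewrite i0 !mulmxA -(mulmxA _ (invmx B)) mulVmx// mulmx1 mxtrace_mulC !mulmxA.
  by rewrite -trmx_mul mulVmx// trmx1 mul1mx mxtrace_diag.
rewrite sumrB big_split/= sumr_const card_ord -[2 *+ p]mulr_natr.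
by field.
Qed.

End logdet.

(** * Bounds on the constant, uniform in the dimension *)

Section quadratic_probability.
Context {R : realType} {d : measure_display} {T : measurableType d}.
Variables (P : probability T R) (p : nat) (y : {RV P >-> p.-tuple R}).
Hypothesis gy : centered_gaussian y 1%:M.
Hypothesis p0 : (0 < p)%N.
Local Notation gamma := (@gauss1 R).

Lemma quadform_tuple (M : 'M[R]_p) (x : p.-tuple R) :
  quadform M (col_of_tuple x) = \sum_i \sum_j M j i * tnth x j * tnth x i.
Proof.
rewrite /quadform mxE; apply: eq_bigr => i _; rewrite !mxE mulr_suml.
by apply: eq_bigr => j _; rewrite !mxE [tnth x j * _]mulrC.
Qed.

Lemma quadform_sym (M : 'M[R]_p) (v : 'cV[R]_p) :
  quadform (2^-1 *: (M + M^T)) v = quadform M v.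
Proof.
have h : quadform M^T v = quadform M v.
  by rewrite /quadform -[in RHS](tr_mx11 (v^T *m M *m v)) !trmx_mul trmxK mulmxA.
rewrite -[RHS](_ : 2^-1 * (quadform M v + quadform M^T v) = _); last by rewrite h; field.
by rewrite /quadform -scalemxAr -scalemxAl mulmxDr mulmxDl !mxE.
Qed.

Lemma quadform_diag (l : 'rV[R]_p) (x : p.-tuple R) :
  quadform (diag_mx l) (col_of_tuple x) = sq_sum [tuple l 0 i | i < p] x.
Proof.
rewrite quadform_tuple /sq_sum; apply: eq_bigr => i _.
rewrite (bigD1 i)//= big1 ?addr0 => [|j /negbTE ji].
  by rewrite mxE eqxx mulr1n tnth_mktuple; ring.
by rewrite mxE ji mulr0n !mul0r.
Qed.

(** The form sees only the symmetric part of [M], whose eigenvalues [l] add up to [p > 0] and so are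
    not all zero; by rotation invariance it has the law of [\sum_i l_i g_i ^+ 2]. The bound for [l]
    is the upper one; the bound for [- l], on the complement, gives the lower one. *)
Lemma quadratic_probability (M : 'M[R]_p) : \tr M = p%:R ->
  ((4^-1)%:E <= P (y @^-1` [set x | (quadform M (col_of_tuple x) < p%:R)%R]) <= (3 / 4)%:E)%E.
Proof.
move=> trM.
have mG : measurable [set x : p.-tuple R | quadform M (col_of_tuple x) < p%:R].
  apply: measurable_set_lt => //.
  rewrite (_ : (fun x => _) = fun x : p.-tuple R => \sum_i \sum_j M j i * tnth x j * tnth x i).
    by apply: measurable_sum => i; apply: measurable_sum => j; apply: measurable_funM;
      [apply: measurable_funM => //|]; exact: measurable_tnth.
  by apply/funext => x; rewrite quadform_tuple.
pose S := 2^-1 *: (M + M^T).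
have symS : S^T = S by rewrite /S linearZ/= linearD/= trmxK addrC.
have [U [l [UU US]]] := real_spectral symS.
have UTU : U^T *m U = 1%:M by exact: mulmx1C.
have trl : \sum_(i < p) l 0 i = p%:R.
  rewrite -(mxtrace_diag l) -US mxtrace_mulC mulmxA UTU mul1mx /S linearZ/= linearD/= mxtrace_tr trM.
  by field.
pose lt := [tuple l 0 i | i < p].
have suml (k : R) : \sum_(i < p) tnth [tuple k * l 0 i | i < p] i = k * p%:R.
  by rewrite -trl mulr_sumr; apply: eq_bigr => i _; rewrite tnth_mktuple.
have lt0 (k : R) : k != 0 -> exists i, tnth [tuple k * l 0 i | i < p] i != 0.
  move=> k0; apply: contrapT => h; have := suml k; rewrite big1.
    by move/esym/eqP; rewrite mulf_eq0 (negbTE k0) pnatr_eq0 gtn_eqF.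
  by move=> i _; apply/eqP; apply: contraT => li; case: h; exists i.
have gyU : centered_gaussian y (U^T *m U^T^T) by rewrite trmxK UTU.
rewrite (gaussian_vector_law gyU mG).
have -> : mxapp U^T @^-1` [set x | quadform M (col_of_tuple x) < p%:R] =
    [set g | sq_sum lt g < p%:R].
  apply/seteqP; split => g /=; rewrite col_of_mxapp -quadform_sym -/S -quadform_diag -US;
  by rewrite /quadform trmx_mul trmxK !mulmxA.
have mle : measurable [set g : p.-tuple R | sq_sum lt g <= p%:R].
  by apply: measurable_set_le => //; exact: measurable_sq_sum.
have mlt : measurable [set g : p.-tuple R | sq_sum lt g < p%:R].
  by apply: measurable_set_lt => //; exact: measurable_sq_sum.
have scale_sq (k : R) g : sq_sum [tuple k * l 0 i | i < p] g = k * sq_sum lt g.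
  by rewrite /sq_sum mulr_sumr; apply: eq_bigr => i _; rewrite !tnth_mktuple mulrA.
have up : (ipro gamma p [set g | (sq_sum lt g <= p%:R)%R] <= (3 / 4)%:E)%E.
  have := gauss_quadratic_le (lt0 1 (oner_neq0 _)); rewrite suml mul1r.
  congr (_ <= _)%E; congr (ipro gamma _ _).
  by apply/seteqP; split => g /=; rewrite scale_sq mul1r.
have low : (ipro gamma p [set g | (p%:R <= sq_sum lt g)%R] <= (3 / 4)%:E)%E.
  have h1 : -1 != 0 :> R by rewrite oppr_eq0 oner_neq0.
  have := gauss_quadratic_le (lt0 _ h1); rewrite suml.
  congr (_ <= _)%E; congr (ipro gamma _ _).
  by apply/seteqP; split => g /=; rewrite scale_sq !mulN1r lerN2.
apply/andP; split; last first.
  apply: le_trans up; apply: le_measure; rewrite ?inE// => g /=; exact: ltW.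
have := probability_setC (ipro gamma p) mlt.
have -> : ~` [set g | sq_sum lt g < p%:R] = [set g | p%:R <= sq_sum lt g].
  by apply/seteqP; split => g /=; rewrite leNgt => /negP.
move=> cE; move: low; rewrite cE.
have compl (q : \bar R) : q \is a fin_num -> (1 - q <= (3 / 4)%:E -> (4^-1)%:E <= q)%E.
  case: q => [q| |]// _; rewrite -[1%E]/(1%:E)%E -EFinB !lee_fin; lra.
by apply: compl; exact: fin_num_measure.
Qed.

End quadratic_probability.

Section mixture.
Context {R : realType}.
Local Notation mu := (@lebesgue_measure R).

Lemma finite_measurableR (Z : set R) : finite_set Z -> measurable Z.
Proof.
by move=> fZ; apply: countable_measurable => //; exact: finite_set_countable.
Qed.

Lemma measurable_fun_finite_exception (f g : R -> R) (Z : set R) : finite_set Z ->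
  measurable_fun setT g -> (forall t, ~ Z t -> f t = g t) -> measurable_fun setT f.
Proof.
move=> fZ mg fg _ B mB; rewrite setTI.
have mgB : measurable (g @^-1` B) by rewrite -[X in measurable X]setTI; exact: mg.
have -> : f @^-1` B = (g @^-1` B `\` Z) `|` (f @^-1` B `&` Z).
  apply/seteqP; split => t /=.
    by have [Zt|Zt] := pselect (Z t); [right|left; rewrite -fg].
  by move=> [[gB Zt]|[]//]; rewrite fg.
apply: measurableU; first exact: measurableD mgB (finite_measurableR fZ).
by apply: finite_measurableR; apply: sub_finite_set fZ; exact: subIsetr.
Qed.

Definition unif : probability R R :=
  pushp (uniform_prob (@ltr01 R) : probability (measurableTypeR R) R)
    (@measurable_id _ (measurableTypeR R) setT
      : measurable_fun setT (id : measurableTypeR R -> R)).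

Lemma unif_bounds (K : R -> \bar R) (a b t0 : R) : measurable_fun setT K ->
  (forall t, 0 <= K t)%E -> 0 <= a -> 0 <= b ->
  (forall t, 0 < t < 1 -> t != t0 -> (a%:E <= K t <= b%:E)%E) ->
  (a%:E <= \int[unif]_t K t <= b%:E)%E.
Proof.
move=> mK K0 a0 b0 Kab; rewrite ge0_integral_pushp//.
have mK' : measurable_fun [set: measurableTypeR R] (K : measurableTypeR R -> \bar R) by [].
rewrite (integral_uniform (@ltr01 R) mK' K0) subr0 invr1 mul1e.
have cstE (c : R) : (\int[mu]_(x in `[0%R, 1%R]) (cst c%:E x) = c%:E)%E.
  by rewrite integral_cst//= lebesgue_measure_itv/= lte01 oppr0 adde0 mule1.
have ae01 (Q : R -> Prop) : (forall t, 0 < t < 1 -> t != t0 -> Q t) ->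
    {ae mu, forall t, `[0, 1]%classic t -> Q t}.
  move=> h; pose N : set R := [set 0; 1; t0].
  have fN : finite_set N by rewrite /N.
  exists N; split; first exact: (finite_measurableR fN).
    by apply: countable_lebesgue_measure0; exact: finite_set_countable.
  move=> t /= nQ; apply: contrapT => nN; apply: nQ; rewrite in_itv/= => /andP[t0' t1'].
  apply: h; last by apply/eqP => tt; apply: nN; right.
  rewrite !lt_neqAle t0' t1' !andbT; apply/andP; split; apply/eqP => tt; apply: nN; left.
    by left; rewrite -tt.
  by right.
have mKD : measurable_fun (`[0, 1]%classic : set (measurableTypeR R)) K by exact: measurable_funTS.
apply/andP; split.
  rewrite -(cstE a); apply: ae_ge0_le_integral => //.
  by apply: ae01 => t t01 tt; have /andP[] := Kab t t01 tt.
rewrite -(cstE b); apply: ae_ge0_le_integral => //.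
by apply: ae01 => t t01 tt; have /andP[] := Kab t t01 tt.
Qed.

End mixture.

Section constant_bounds.
Context {R : realType} {d : measure_display} {T : measurableType d}.
Variables (P : probability T R) (p : nat).
Variables (y : {RV P >-> p.-tuple R}) (s : {RV P >-> R}).
Hypothesis gy : centered_gaussian y 1%:M.
Hypothesis us : is_uniform01 s.
Hypothesis ys : independent_RVs y s.
Variables (B : 'M[R]_p) (l : 'rV[R]_p).
Hypothesis uB : B \in unitmx.
Hypothesis l0 : forall i, 0 < l 0 i.
Local Notation S0 := (B *m B^T).
Local Notation S1 := (B *m diag_mx l *m B^T).
Hypothesis S01 : S0 <> S1.
Local Notation e i := (l 0 i - 1).
Local Notation factors t := (\prod_(i < p) (1 + t * e i)).
Local Notation phi t := (\sum_(i < p) e i / (1 + t * e i)).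

Let p0 : (0 < p)%N.
Proof.
rewrite lt0n; apply/eqP => pe; case: S01; move: (S0) (S1); rewrite pe => M N.
by apply/matrixP => -[].
Qed.

Let finite_roots : finite_set [set t : R | factors t = 0].
Proof.
apply: (@sub_finite_set _ _ ((fun i => - (e i)^-1) @` [set: 'I_p])); last first.
  by apply: finite_image; exact: finite_finset.
move=> t /eqP /prodf_eq0[i _ /eqP ti]; exists i => //.
have ei : e i != 0.
  by apply/eqP => e0; move/eqP: ti; rewrite e0 mulr0 addr0 oner_eq0.
by apply: (mulIf ei); rewrite mulNr mulVf//; lra.
Qed.

Let measurable_A i j : measurable_fun setT (fun t : R => A_ S0 S1 t i j).
Proof.
have mfac k : measurable_fun setT (fun t : R => 1 + t * e k) by meas.
have mfactors : measurable_fun setT (fun t : R => factors t) by exact: measurable_prod.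
have mphi : measurable_fun setT (fun t : R => phi t).
  apply: measurable_sum => k; apply: measurable_funM => //.
  exact: (measurableT_comp measurable_fun_inv (mfac k)).
pose Minv (t : R) := (invmx B)^T *m diag_mx (\row_k (1 + t * e k)^-1) *m invmx B.
(* An explicit formula for the entry off the finitely many [t] where [Sigma_] is singular; the
   conditional follows the sign of the determinant, as in [dlogdet_pos] and [dlogdet_neg]. *)
pose g (t : R) := p%:R / (if 0 < factors t then phi t else 0) * ((S1 - S0) *m Minv t) i j.
apply: (@measurable_fun_finite_exception _ _ g _ finite_roots).
  apply: measurable_funM.
    apply: measurable_funM => //; apply: (measurableT_comp measurable_fun_inv).
    by apply: measurable_fun_ifT => //; exact: measurable_fun_ltr.
  have mmx m n q (M : R -> 'M[R]_(m, n)) (N : R -> 'M[R]_(n, q)) :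
      (forall a b, measurable_fun setT (fun t => M t a b)) ->
      (forall a b, measurable_fun setT (fun t => N t a b)) ->
      forall a b, measurable_fun setT (fun t => (M t *m N t) a b).
    move=> mM mN a b; under eq_fun do rewrite mxE.
    by apply: measurable_sum => k; exact: measurable_funM.
  apply: (mmx _ _ _ (fun=> S1 - S0)) => // a b.
  apply: (mmx _ _ _ (fun t => (invmx B)^T *m diag_mx (\row_k (1 + t * e k)^-1)) (fun=> invmx B)) => //.
  move=> {}a {}b; apply: (mmx _ _ _ (fun=> (invmx B)^T) (fun t => diag_mx (\row_k (1 + t * e k)^-1))) => //.
  move=> {}a {}b; under eq_fun do rewrite !mxE.
  case: (a == b); last by under eq_fun do rewrite mulr0n; exact: measurable_cst.
  under eq_fun do rewrite mulr1n.
  exact: (measurableT_comp measurable_fun_inv (mfac _)).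
move=> t /eqP ft; rewrite /g /A_ mxE /dlog_Sigma (inv_Sigma uB ft) -/(Minv t); congr (_ / _ * _).
have [fpos|fneg] := ltP 0 (factors t); first exact: dlogdet_pos.
by apply: dlogdet_neg => //; rewrite lt_neqAle ft.
Qed.

Let G : set (R * p.-tuple R) :=
  [set tx | quadform (A_ S0 S1 tx.1) (col_of_tuple tx.2) < p%:R].

Let mG : measurable G.
Proof.
apply: measurable_set_lt => //; under eq_fun do rewrite quadform_tuple.
apply: measurable_sum => i; apply: measurable_sum => j.
have mt k : measurable_fun setT (fun tx : R * p.-tuple R => tnth tx.2 k).
  exact: (measurableT_comp (measurable_tnth k) (@measurable_snd _ _ _ _)).
apply: measurable_funM => //; apply: measurable_funM => //.
exact: (measurableT_comp (measurable_A j i) (@measurable_fst _ _ _ _)).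
Qed.

(** By independence the law of [(s, y)] is a product, so the probability is the mean, over uniform
    [t], of the probability at fixed [t], where [A_ S0 S1 t] has trace [p] unless [phi t = 0]. *)
Lemma C_bounds : ((4^-1)%:E <=
  P [set w | (quadform (A_ S0 S1 (s w)) (col_of_tuple (y w)) < p%:R)%R] <= (3 / 4)%:E)%E.
Proof.
have my : measurable_fun setT y by exact: measurable_funPT.
have ms : measurable_fun setT s by exact: measurable_funPT.
have msy : measurable_fun setT (fun w => (s w, y w)) by exact: measurable_fun_pair.
pose ls := pushp P ms; pose ly := pushp P my.
have joint : (ls \x ly)%E G = P [set w | quadform (A_ S0 S1 (s w)) (col_of_tuple (y w)) < p%:R].
  apply: (product_measure_unique (m' := pushp P msy)) => // A1 A2 mA1 mA2.
  rewrite [LHS]pushpE muleC; apply: etrans (ys mA2 mA1).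
  by congr (P _); apply/seteqP; split => w [].
rewrite -joint.
pose K t := P (y @^-1` [set x | quadform (A_ S0 S1 t) (col_of_tuple x) < p%:R]).
have -> : (ls \x ly)%E G = (\int[unif]_t K t)%E.
  transitivity (\int[ls]_t ly (xsection G t))%E => //.
  transitivity (\int[ls]_t K t)%E.
    apply: eq_integral => t _; rewrite [LHS]pushpE; congr (P _).
    by apply/seteqP; split => w; rewrite /xsection/= inE.
  apply: eq_measure_integral => A mA _; rewrite [LHS]pushpE [RHS]pushpE.
  exact: us.
have mK : measurable_fun setT K by exact: (@measurable_section_prob _ _ _ _ _ ly G mG).
(* The only possible zero of [phi] in []0, 1[], or 0 if there is none. At such a zero [p / 0 = 0]
   makes [A_] vanish and the probability equal to 1, so the point is set aside. *)
pose t0 := xget 0 [set t : R | 0 < t < 1 /\ phi t = 0].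
apply: (@unif_bounds _ _ _ _ t0) => // t t01 tt0.
apply: quadratic_probability => //.
have f0 := factors_gt0 l0 t01; have fn0 : factors t != 0 by rewrite gt_eqF.
have phi0 : phi t != 0.
  apply/eqP => ph; move/eqP: tt0; apply.
  have [t0' pt0] : [set t : R | 0 < t < 1 /\ phi t = 0] t0.
    by apply: xgetPex; exists t.
  exact: (phi_inj l0 S01).
rewrite /A_ linearZ/= dlogdet_pos// trace_dlog// -mulrA mulVf// mulr1//.
Qed.

End constant_bounds.

(** * Comparison of the two Gaussian laws *)

Section ball_probabilities.
Context {R : realType} {p : nat}.

Lemma one_sub_prod_le_sum n (r : 'I_n -> R) : (forall i, 0 <= r i <= 1) ->
  1 - \prod_i r i <= \sum_i (1 - r i).
Proof.
move=> r01; suff : 0 <= \prod_i r i <= 1 /\ 1 - \prod_i r i <= \sum_i (1 - r i) by case.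
elim/big_rec2: _ => [|i a b _ [b01 h]]; first by rewrite subrr lexx ler01.
have /andP[ri0 ri1] := r01 i; have /andP[b0 b1] := b01.
split; first by rewrite mulr_ge0//= mulr_ile1.
have : 0 <= (1 - r i) * (1 - b) by rewrite mulr_ge0// subr_ge0.
by move: h; clear; nra.
Qed.

(** [1 - affinity s ^+ 2] is [(1 - s) ^+ 2 / (1 + s ^+ 2)] and [s ^+ 2 + s ^- 2 - 2] is
    [(1 - s ^+ 2) ^+ 2 / s ^+ 2], so the claim reduces to [8 s ^+ 2 <= (1 + s) ^+ 2 (1 + s ^+ 2)],
    an equality at [s = 1]. Against the factor 1/2 in [J], the 1/8 becomes [J / 4]. *)
Lemma affinity_defect (s : R) : 0 < s ->
  0 <= affinity s ^+ 2 <= 1 /\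
  1 - affinity s ^+ 2 <= 8^-1 * (s ^+ 2 + (s ^+ 2)^-1 - 2).
Proof.
move=> s0; rewrite affinity_sq//.
have den : 0 < 1 + s ^+ 2 by rewrite ltr_wpDr ?sqr_ge0.
split.
  rewrite divr_ge0 ?mulr_ge0 ?(ltW s0) ?(ltW den)//= ler_pdivrMr// mul1r.
  by have := sqr_ge0 (1 - s); nra.
have h8 : 8 * s ^+ 2 <= (1 + s) ^+ 2 * (1 + s ^+ 2).
  have -> : (1 + s) ^+ 2 * (1 + s ^+ 2) = 8 * s ^+ 2 +
     ((s - 1) ^+ 2 * (s ^+ 2 + 4 * s + 1)) by ring.
  by rewrite lerDl mulr_ge0 ?sqr_ge0// !addr_ge0 ?sqr_ge0 ?mulr_ge0 ?(ltW s0).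
have -> : 8^-1 * (s ^+ 2 + (s ^+ 2)^-1 - 2) =
    1 - 2 * s / (1 + s ^+ 2) + (1 - s) ^+ 2 / (8 * s ^+ 2 * (1 + s ^+ 2)) *
     ((1 + s) ^+ 2 * (1 + s ^+ 2) - 8 * s ^+ 2).
  by field; rewrite !gt_eqF.
rewrite lerDl mulr_ge0 ?subr_ge0// divr_ge0 ?sqr_ge0//.
by apply: mulr_ge0; [rewrite mulr_ge0// sqr_ge0|exact: ltW].
Qed.

Lemma measurable_ball t : measurable [set x : p.-tuple R | eball t (col_of_tuple x)].
Proof.
apply: (@measurable_set_lt _ _ _ (fun x : p.-tuple R => enorm (col_of_tuple x)) (cst (Num.sqrt t))) => //.
apply: measurableT_comp.
  by apply: continuous_measurable_fun; exact: sqrt_continuous.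
under eq_fun do under eq_bigr do rewrite mxE.
by apply: measurable_sum => i; apply: measurable_funX; exact: measurable_tnth.
Qed.

End ball_probabilities.

Section covariance_ratio.
Context {R : realType} {p : nat} {d : measure_display} {T : measurableType d}.
Variables (P : probability T R) (x0 x1 : {RV P >-> p.-tuple R}).
Variables (B : 'M[R]_p) (l : 'rV[R]_p).
Hypothesis uB : B \in unitmx.
Hypothesis l0 : forall i, 0 < l 0 i.
Local Notation S0 := (B *m B^T).
Local Notation S1 := (B *m diag_mx l *m B^T).
Hypothesis gx0 : centered_gaussian x0 S0.
Hypothesis gx1 : centered_gaussian x1 S1.
Local Notation trace_gap := `|\tr (1%:M - 2^-1 *: (S0 *m invmx S1 + invmx S0 *m S1))|.

(** With [D] the diagonal matrix of the [sqrt l_i], [S1 = (B D) (B D)^T]: the two vectors have the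
    laws of [B g] and of [B] applied to the scaled [g]. Pulling [A] back by [B] leaves a comparison
    of product laws. *)
Lemma gaussian_vectors_tv (A : set (p.-tuple R)) : measurable A ->
  (fine (P (x1 @^-1` A)) - fine (P (x0 @^-1` A))) ^+ 2 <= 4^-1 * trace_gap.
Proof.
move=> mA; pose r := [tuple Num.sqrt (l 0 i) | i < p].
have r0 i : 0 < tnth r i by rewrite tnth_mktuple sqrtr_gt0.
have r2 i : tnth r i ^+ 2 = l 0 i by rewrite tnth_mktuple sqr_sqrtr// ltW.
pose D := diag_mx (\row_i tnth r i).
have DD : D *m D^T = diag_mx l.
  rewrite tr_diag_mx mulmx_diag; congr diag_mx.
  by apply/rowP => i; rewrite !mxE -expr2 r2.
have gx1' : centered_gaussian x1 ((B *m D) *m (B *m D)^T).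
  by rewrite trmx_mul mulmxA -(mulmxA B D) DD.
rewrite (gaussian_vector_law gx0 mA) (gaussian_vector_law gx1' mA).
have -> : mxapp (B *m D) @^-1` A = scale r @^-1` (mxapp B @^-1` A).
  have mxappD g : mxapp (B *m D) g = mxapp B (scale r g).
    apply: eq_from_tnth => i; rewrite !tnth_mktuple; apply: eq_bigr => j _.
    by rewrite mul_mx_diag /scale !tnth_mktuple !mxE !tnth_mktuple mulrA.
  by apply/seteqP; split => g /=; rewrite mxappD.
have mBA : measurable (mxapp B @^-1` A).
  by rewrite -[X in measurable X]setTI; exact: measurable_mxapp.
apply: le_trans (scale_gauss_tv r0 mBA) _.
apply: (le_trans (one_sub_prod_le_sum _)) => [i|]; first by have [] := affinity_defect (r0 i).
have u0 i : 0 <= l 0 i + (l 0 i)^-1 - 2.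
  have [/andP[_ a1] a2] := affinity_defect (r0 i); move: a2; rewrite r2.
  lra.
rewrite trace_ratio// normrN ger0_norm; last first.
  by rewrite mulr_ge0// sumr_ge0.
rewrite mulrA mulr_sumr; apply: ler_sum => i _.
have [_ a2] := affinity_defect (r0 i); move: a2; rewrite r2.
lra.
Qed.

(** For equal covariances [A_] is zero and [C_bounds] does not apply; the two probabilities
    coincide, which settles the inequality directly. *)
Lemma equal_covariance_law (A : set (p.-tuple R)) : S0 = S1 -> measurable A ->
  P (x1 @^-1` A) = P (x0 @^-1` A).
Proof.
move=> S01 mA; move: gx1; rewrite -S01 => gx.
by rewrite (gaussian_vector_law gx0 mA) (gaussian_vector_law gx mA).
Qed.

End covariance_ratio.

Theorem theorem3p5 (R : realType) :
  exists c : R, c < 1 /\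
  forall (p : nat) (Sigma0 Sigma1 : 'M[R]_p)
    (d : measure_display) (T : measurableType d) (P : probability T R)
    (x0 x1 : {RV P >-> p.-tuple R})
    (d' : measure_display) (T' : measurableType d') (P' : probability T' R)
    (y : {RV P' >-> p.-tuple R}) (s : {RV P' >-> R}),
  posdefmx Sigma0 -> posdefmx Sigma1 ->
  centered_gaussian x0 Sigma0 -> centered_gaussian x1 Sigma1 ->
  independent_RVs x0 x1 ->
  centered_gaussian y 1%:M -> is_uniform01 s -> independent_RVs y s ->
  (Sigma0 <> Sigma1 -> C_ Sigma0 Sigma1 y s <= c) /\
  (ereal_sup [set `|ball_prob x1 t - ball_prob x0 t|%E
              | t in [set t : R | (0 <= t)%R]]
   <= (C_ Sigma0 Sigma1 y s *
       Num.sqrt `|\tr (1%:M - 2^-1 *: (Sigma0 *m invmx Sigma1 +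
                                       invmx Sigma0 *m Sigma1))|)%:E)%E.
Proof.
exists (Num.sqrt (3 / 4)); split.
  by rewrite -[ltRHS]sqrtr1 ltr_sqrt// ltr_pdivrMr// mul1r ltr_nat.
move=> p Sigma0 Sigma1 d T P x0 x1 d' T' P' y s pd0 pd1 gx0 gx1 _ gy us ys.
have [B [l [uB l0 E0 E1]]] := posdefmx_diag pd0 pd1.
move: gx0 gx1; rewrite E0 E1 {Sigma0 Sigma1 pd0 pd1 E0 E1} => gx0 gx1.
set S0 := B *m B^T; set S1 := B *m diag_mx l *m B^T.
have C_between : S0 <> S1 -> 2^-1 <= C_ S0 S1 y s <= Num.sqrt (3 / 4).
  move=> S01; have fine_between (q : \bar R) :
      ((4^-1)%:E <= q <= (3 / 4)%:E)%E -> 4^-1 <= fine q <= 3 / 4.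
    case: q => [q| |]; rewrite ?lee_fin ?leye_eq ?leeNy_eq ?andbF//.
  have /andP[q1 q2] := fine_between _ (C_bounds gy us ys uB l0 S01); rewrite /C_.
  rewrite (ler_wsqrtr q2) andbT -[leLHS]ger0_norm// -sqrtr_sqr ler_wsqrtr//.
  by apply: le_trans q1; clear; lra.
split => [/C_between/andP[]//|].
apply: ge_ereal_sup => _ [t _ <-].
have mA := @measurable_ball R p t; set A := [set x | _] in mA.
rewrite -[ball_prob x1 t]/(P (x1 @^-1` A)) -[ball_prob x0 t]/(P (x0 @^-1` A)).
have finA (x : {RV P >-> p.-tuple R}) : P (x @^-1` A) \is a fin_num.
  apply: fin_num_measure; rewrite -[X in measurable X]setTI.
  exact: (measurable_funPT x).
have C0 : 0 <= C_ S0 S1 y s by exact: sqrtr_ge0.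
have [S01|S01] := pselect (S0 = S1).
  rewrite (equal_covariance_law gx0 gx1 S01 mA) subee ?finA// abse0 lee_fin.
  by rewrite mulr_ge0// sqrtr_ge0.
have /andP[C_half _] := C_between S01.
rewrite -(fineK (finA x1)) -(fineK (finA x0)) -EFinB lee_fin.
(* The square root of [J / 4] is half that of [J], and [C_half] absorbs the 1/2. *)
rewrite -sqrtr_sqr; apply: (le_trans (ler_wsqrtr (gaussian_vectors_tv uB l0 gx0 gx1 mA))).
rewrite sqrtrM// ler_wpM2r ?sqrtr_ge0//; apply: le_trans C_half.
rewrite -[leRHS]ger0_norm// -sqrtr_sqr ler_wsqrtr//.
by clear; lra.
Qed.
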